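(* Let $\Gamma$ be a countable discrete group and let $\mu\in\mathrm{Prob}(\Gamma)$. If $\Gamma$ admits an essentially free $\mu$-USB, then the canonical trace $\tau_0$ is the unique $\mu$-stationary state on $C^*_\lambda(\Gamma)$ (with respect to the action of $\Gamma$ by inner automorphisms).
   Context: Measurable actions $\Gamma\curvearrowright(Y,\eta)$ on probability spaces are assumed non-singular; such an action is $\mu$-stationary if $\sum_g\mu(g)\,g\eta=\eta$, and essentially free if $\eta(\{y:gy=y\})=0$ for all $g\neq e$. A compact model of $(Y,\eta)$ is a compact Hausdorff space $K$ with an action of $\Gamma$ by homeomorphisms and a Borel probability measure $\bar\nu$ on $K$ such that $(K,\bar\nu)$ and $(Y,\eta)$ are measurably isomorphic as $\Gamma$-spaces. Let $\omega_k=g_1\cdots g_k$ with $g_i$ i.i.d. of law $\mu$. A compact metrizable $\Gamma$-space $X$ with a $\mu$-stationary Borel probability measure $\nu$ is a $\mu$-boundary if for almost every path $(\omega_k)$ the sequence $\omega_k\nu$ converges weak* to a Dirac measure. A measurable $\mu$-stationary action is a $\mu$-boundary if it has a compact metrizable model that is a $\mu$-boundary. A $\mu$-USB is a $\mu$-boundary having a compact model $(K,\bar\nu)$ such that $\bar\nu$ is the unique $\mu$-stationary Borel probability measure on $K$. $C^*_\lambda(\Gamma)\subset\mathcal{B}(\ell^2(\Gamma))$ is generated by the left regular representation $\lambda$; $\Gamma$ acts on it by $g\cdot a=\lambda_ga\lambda_{g^{-1}}$, and on states by $(g\tau)(a)=\tau(g^{-1}\cdot a)$. A state $\tau$ is $\mu$-stationary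 if $\sum_g\mu(g)\,g\tau=\tau$. The canonical trace satisfies $\tau_0(\lambda_g)=0$ for $g\neq e$ and $\tau_0(\lambda_e)=1$. *)

(* Defs.v *)
From HB Require Import structures.
From mathcomp Require Import all_boot all_order all_algebra finmap complex.
From mathcomp Require Import all_classical all_reals all_analysis.
From mathcomp Require Import ring.
From mathcomp.analysis.showcase Require summability.
Import numFieldNormedType.Exports.
Set Implicit Arguments.
Unset Strict Implicit.
Unset Printing Implicit Defensive.
Import Order.TTheory GRing.Theory Num.Theory.
Local Open Scope classical_set_scope.
Local Open Scope ring_scope.

(* A probability measure on the countable discrete group [G] is given by its
   mass function. *)
Definition prob_mass (R : realType) (G : groupType) (mu : G -> R) : Prop :=
  (forall g, 0 <= mu g) /\ (\esum_(g in [set: G]) (mu g)%:E = 1)%E.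

Definition is_action (G : groupType) (T : Type) (act : G -> T -> T) : Prop :=
  (forall x, act 1%g x = x) /\
  (forall g h x, act (g * h)%g x = act g (act h x)).

Section Actions.
Context (R : realType) (G : groupType) (mu : G -> R).
Context d (Y : measurableType d).
Implicit Types (act : G -> Y -> Y) (eta : set Y -> \bar R).

(* [pushforward eta (act g)] is the measure g eta : A |-> eta (g^-1 A). *)
Definition nonsingular act eta : Prop :=
  forall g A, measurable A -> (pushforward eta (act g) A = 0 <-> eta A = 0)%E.

Definition nonsingular_action act eta : Prop :=
  [/\ is_action act, forall g, measurable_fun [set: Y] (act g)
    & nonsingular act eta].

Definition stationary act eta : Prop :=
  forall A, measurable A ->
  (\esum_(g in [set: G]) ((mu g)%:E * pushforward eta (act g) A) = eta A)%E.

Definition essentially_free act eta : Prop :=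
  forall g, g <> 1%g -> eta.-negligible [set y | act g y = y].

End Actions.

(* Isomorphism of measurable G-spaces, modulo null sets. Since [G] is countable
   and acts nonsingularly, the almost everywhere identities hold on invariant
   conull sets, where [phi] and [psi] are mutually inverse equivariant
   bijections. *)
Definition measurably_isomorphic (R : realType) (G : groupType)
    d (Y : measurableType d) (act : G -> Y -> Y) (eta : probability Y R)
    d' (Z : measurableType d') (act' : G -> Z -> Z) (zeta : probability Z R)
    : Prop :=
  exists (phi : Y -> Z) (psi : Z -> Y),
  [/\ measurable_fun [set: Y] phi /\ measurable_fun [set: Z] psi,
      (forall B, measurable B -> pushforward eta phi B = zeta B) /\
      (forall A, measurable A -> pushforward zeta psi A = eta A),
      {ae eta, forall y, psi (phi y) = y},
      {ae zeta, forall z, phi (psi z) = z}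
    & forall g, {ae eta, forall y, phi (act g y) = act' g (phi y)}].

(* [ptopologicalType] only asks for a point, and a space that carries a
   probability measure is not empty. *)
Notation borel K := (g_sigma_algebraType (@open K)).

Definition compact_hausdorff_action (G : groupType) (K : ptopologicalType)
    (act : G -> K -> K) : Prop :=
  [/\ compact [set: K], hausdorff_space K, is_action act
    & forall g, continuous (act g)].

Definition metrizable (R : realType) (X : topologicalType) : Prop :=
  exists dist : X -> X -> R,
  [/\ forall x y, 0 <= dist x y,
      forall x y, dist x y = 0 <-> x = y,
      forall x y, dist x y = dist y x,
      forall x y z, dist x z <= dist x y + dist y z
    & forall x (A : set X), nbhs x A <->
        exists2 e : R, 0 < e & [set y | dist x y < e] `<=` A].

Definition compact_model (R : realType) (G : groupType)
    d (Y : measurableType d) (act : G -> Y -> Y) (eta : probability Y R)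
    (K : ptopologicalType) (actK : G -> K -> K) (nu : probability (borel K) R)
    : Prop :=
  compact_hausdorff_action actK /\
  measurably_isomorphic act eta (actK : G -> borel K -> borel K) nu.

Definition iid_steps (R : realType) (G : groupType) (mu : G -> R)
    d (Omega : measurableType d) (P : probability Omega R)
    (s : nat -> Omega -> G) : Prop :=
  [/\ forall n (A : set G), measurable (s n @^-1` A),
      forall n g, P (s n @^-1` [set g]) = (mu g)%:E
    & forall (J : {fset nat}) (A : nat -> set G),
        P (\bigcap_(n in [set` J]) (s n @^-1` A n)) =
        (\prod_(n <- J) P (s n @^-1` A n))%E].

Fixpoint walk (G : groupType) (Omega : Type) (s : nat -> Omega -> G) (k : nat)
    (w : Omega) : G :=
  if k is k'.+1 then (walk s k' w * s k' w)%g else 1%g.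

Definition weak_star_cvg (R : realType) (X : ptopologicalType)
    (m : nat -> set (borel X) -> \bar R) (m' : set (borel X) -> \bar R) : Prop :=
  forall f : X -> R, continuous f ->
  (\int[m k]_(x in [set: borel X]) (f x)%:E)%E @[k --> \oo] -->
  (\int[m']_(x in [set: borel X]) (f x)%:E)%E.

Section Boundaries.
Context (R : realType) (G : groupType) (mu : G -> R).

(* The law of the path [(walk s k w)_k] does not depend on the probability
   space on which the steps are realized. *)
Definition topological_mu_boundary (X : ptopologicalType) (act : G -> X -> X)
    (nu : probability (borel X) R) : Prop :=
  [/\ compact_hausdorff_action act, metrizable R X,
      stationary mu (act : G -> borel X -> borel X) nu
    & exists d (Omega : measurableType d) (P : probability Omega R)
        (s : nat -> Omega -> G),
      iid_steps mu P s /\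
      {ae P, forall w, exists x0 : X,
        weak_star_cvg
          (fun k => pushforward nu (act (walk s k w) : borel X -> borel X))
          (dirac (x0 : borel X))}].

Context d (Y : measurableType d) (act : G -> Y -> Y) (eta : probability Y R).

Definition mu_boundary : Prop :=
  [/\ nonsingular_action act eta, stationary mu act eta
    & exists (X : ptopologicalType) (actX : G -> X -> X)
        (nu : probability (borel X) R),
      compact_model act eta actX nu /\ topological_mu_boundary actX nu].

Definition uniquely_stationary (K : ptopologicalType) (actK : G -> K -> K)
    (nu : probability (borel K) R) : Prop :=
  stationary mu (actK : G -> borel K -> borel K) nu /\
  forall nu' : probability (borel K) R,
    stationary mu (actK : G -> borel K -> borel K) nu' ->
    forall A, measurable A -> nu' A = nu A.

Definition mu_USB : Prop :=
  mu_boundary /\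
  exists (K : ptopologicalType) (actK : G -> K -> K)
    (nu : probability (borel K) R),
  compact_model act eta actK nu /\ uniquely_stationary actK nu.

End Boundaries.

Section L2.
Context (R : realType) (G : groupType).
Local Notation C := (R[i]).

(* The norm of [R[i]] takes values in [R[i]], hence the real part. *)
Definition sqnorm (x : G -> C^o) : \bar R :=
  \esum_(g in [set: G]) (complex.Re (`|x g| ^+ 2))%:E.

Definition square_summable : {pred (G -> C^o)} :=
  fun x => `[< (sqnorm x < +oo)%E >].

Let Re_sqrE (z : C) :
  complex.Re (`|z| ^+ 2) = (complex.Re z) ^+ 2 + (complex.Im z) ^+ 2.
Proof. by rewrite -add_Re2_Im2. Qed.

Let Re_sqr_ge0 (z : C) : 0 <= complex.Re (`|z| ^+ 2).
Proof. by rewrite Re_sqrE addr_ge0 ?sqr_ge0. Qed.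

Let esum_lty_scale (a : G -> R) (c : R) :
  (forall g, 0 <= a g) -> 0 <= c ->
  (\esum_(g in [set: G]) (a g)%:E < +oo)%E ->
  (\esum_(g in [set: G]) (c * a g)%:E < +oo)%E.
Proof.
move=> a0 c0 aoo.
have sfin : (\esum_(g in [set: G]) (a g)%:E)%E \is a fin_num.
  by rewrite ge0_fin_numE// esum_ge0// => g _; rewrite lee_fin.
apply: (@le_lt_trans _ _ (c%:E * \esum_(g in [set: G]) (a g)%:E)%E); last first.
  by rewrite -(fineK sfin) -EFinM ltry.
apply: ge_ereal_sup => _ [A finA <-].
under eq_fsbigr do rewrite EFinM.
rewrite -ge0_mule_fsumr//.
apply: lee_wpmul2l => //.
by apply: ereal_sup_ubound; exists A.
Qed.

Lemma square_summable_submod : submod_closed square_summable.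
Proof.
split=> [|k x y /asboolP xoo /asboolP yoo].
  apply/asboolP; rewrite /sqnorm esum1 ?ltry// => g _.
  by rewrite normr0 expr0n.
apply/asboolP; rewrite /sqnorm.
pose a := complex.Re (`|k| ^+ 2).
apply: (@le_lt_trans _ _ (\esum_(g in [set: G])
  ((2 * a * complex.Re (`|x g| ^+ 2))%:E
    + (2 * complex.Re (`|y g| ^+ 2))%:E))%E); last first.
  rewrite esumD; first last.
  - by move=> g _; rewrite lee_fin mulr_ge0 ?Re_sqr_ge0.
  - by move=> g _; rewrite lee_fin !mulr_ge0 ?Re_sqr_ge0.
  by apply: lte_add_pinfty; apply: esum_lty_scale => //;
    rewrite ?mulr_ge0 ?Re_sqr_ge0 // => g; exact: Re_sqr_ge0.
apply: le_esum => g _; rewrite -EFinD lee_fin /a !Re_sqrE.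
rewrite [(k *: x + y) g]/(k * x g + y g) {xoo yoo a}.
case: k (x g) (y g) => [a1 a2] [b1 b2] [c1 c2] /=; rewrite -subr_ge0.
have -> : 2 * (a1 ^+ 2 + a2 ^+ 2) * (b1 ^+ 2 + b2 ^+ 2)
    + 2 * (c1 ^+ 2 + c2 ^+ 2)
    - ((a1 * b1 - a2 * b2 + c1) ^+ 2 + (a1 * b2 + a2 * b1 + c2) ^+ 2)
  = (a1 * b1 - a2 * b2 - c1) ^+ 2 + (a1 * b2 + a2 * b1 - c2) ^+ 2 by ring.
by rewrite addr_ge0 ?sqr_ge0.
Qed.

HB.instance Definition _ :=
  GRing.isSubmodClosed.Build C (G -> C^o) square_summable square_summable_submod.

Record l2 := L2 { l2val :> G -> C^o; _ : l2val \in square_summable }.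

HB.instance Definition _ := [isSub for l2val].
HB.instance Definition _ := [Choice of l2 by <:].
HB.instance Definition _ := [SubChoice_isSubLmodule of l2 by <:].

Definition l2norm (x : l2) : R := Num.sqrt (fine (sqnorm x)).

#[local] Existing Instance summability.totally_filter.

(* Unconditional sum, in the topology of the modulus on [C]. *)
Definition inner (x y : l2) : C :=
  summability.sum (fun g => x g * (y g)^* : C^o).

Lemma delta_subproof (h : G) :
  (fun g => (g == h)%:R : C^o) \in square_summable.
Proof.
apply/asboolP; rewrite /sqnorm (esumID [set h])//.
  rewrite !setTI esum_set1; last by rewrite lee_fin.
  rewrite [X in (_ + X)%E]esum1 ?adde0 ?ltry// => g gh.
  have /eqP/negPf -> : g <> h by [].
  by rewrite mulr0n normr0 expr0n.
by move=> g _; rewrite lee_fin.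
Qed.

Definition delta (h : G) : l2 := L2 (delta_subproof h).

Lemma lam_subproof (g : G) (x : l2) :
  (fun h => x (g^-1 * h)%g) \in square_summable.
Proof.
apply/asboolP; case: x => x /= /asboolP; congr (_ < _)%E.
rewrite /sqnorm (@reindex_esum _ _ _ [set: G] [set: G] (fun h => (g^-1 * h)%g))//.
split=> // [h1 h2 _ _|h _]; first exact: mulgI.
by exists (g * h)%g => //; rewrite mulKg.
Qed.

Definition lam (g : G) : l2 -> l2 := fun x => L2 (lam_subproof g x).

Definition bounded_operator (T : l2 -> l2) : Prop :=
  linear T /\ exists M : R, forall x, l2norm (T x) <= M * l2norm x.

(* A bounded operator has exactly one adjoint, so [adjoint] is the graph of the
   involution of B(l2(G)). *)
Definition adjoint (T S : l2 -> l2) : Prop :=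
  forall x y, inner (T x) y = inner x (S y).

(* The last clause says that [A] is closed in operator norm. *)
Definition cstar_subalgebra (A : set (l2 -> l2)) : Prop :=
  [/\ A `<=` bounded_operator,
      A 0 /\ (forall (k : C) S T, A S -> A T -> A (k *: S + T)),
      forall S T, A S -> A T -> A (S \o T),
      forall S T, A S -> adjoint S T -> A T
    & forall T, bounded_operator T ->
        (forall e : R, 0 < e -> exists2 S, A S &
           forall x, l2norm (T x - S x) <= e * l2norm x) ->
        A T].

Definition reduced_cstar : set (l2 -> l2) :=
  [set T | forall A, cstar_subalgebra A -> (forall g, A (lam g)) -> A T].

(* A state is given as a function on all operators, of which only the values on
   the reduced C*-algebra matter. Positivity is 0 <= tau (a^* a). *)
Definition is_state (tau : (l2 -> l2) -> C) : Prop :=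
  [/\ forall (k : C) a b, reduced_cstar a -> reduced_cstar b ->
        tau (k *: a + b) = k * tau a + tau b,
      forall a b, reduced_cstar a -> adjoint a b -> 0 <= tau (b \o a)
    & tau idfun = 1].

Definition inner_act (g : G) (a : l2 -> l2) : l2 -> l2 :=
  lam g \o a \o lam g^-1%g.

Definition state_act (g : G) (tau : (l2 -> l2) -> C) : (l2 -> l2) -> C :=
  fun a => tau (inner_act g^-1%g a).

Definition stationary_state (mu : G -> R) (tau : (l2 -> l2) -> C) : Prop :=
  forall a, reduced_cstar a ->
  summability.partial_sum (fun g => (mu g)%:C%C * state_act g tau a : C^o)
    @ summability.totally --> (tau a : C^o).

Definition canonical_trace (a : l2 -> l2) : C :=
  inner (a (delta 1%g)) (delta 1%g).

Lemma canonical_trace_lam (g : G) :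
  canonical_trace (lam g) = (g == 1%g)%:R.
Proof.
rewrite /canonical_trace /inner /summability.sum.
apply: (@cvg_lim C^o); first exact: norm_hausdorff.
apply: cvg_near_cst; exists [fset 1%g]%fset => // J /=; rewrite fsub1set => J1.
rewrite /summability.partial_sum (bigD1 [` J1]%fset)//= big1 ?addr0.
  rewrite eqxx conjC1 mulr1 mulg1; congr (_%:R); congr nat_of_bool.
  by rewrite -(inj_eq invg_inj) invgK invg1.
by move=> i; rewrite -val_eqE /= => /negPf ->; rewrite conjC0 mulr0.
Qed.

End L2.

(* Main.v *)
(* Fix a stationary state [tau] and [a <> 1].  By Hahn-Banach and averaging along
   [mu], the functional [<T v, v> |-> tau T] on quadratic forms extends to a
   stationary mean [m] on all bounded functions on the unit sphere of l2(G).
   Pushing [|v|^2] forward under an orbit map into the compact model [K] turns [m]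
   into a stationary mean on C(K); by Riesz and unique stationarity it is the given
   measure, hence free, and (as [Y] is a boundary) the variance of a continuous
   function translated by the random walk tends to 0 in mean.
   A unit vector [v] for which a function [f] is concentrated near [c] and [f o a]
   near [c'] satisfies [|c - c'| |<lam a v, v>| ~ 0].  By freeness finitely many
   [f_i] have [sum (f_i - f_i o a)^2] bounded below off a set of small measure, so
   the mean of [|<lam a v, v>|], which is invariant under the walk, vanishes. *)

From HB Require Import structures.
Require Import Defs.
From mathcomp Require Import all_boot all_order all_algebra finmap complex.
From mathcomp Require Import all_classical all_reals all_analysis.
From mathcomp Require Import measurable_realfun ring lra.
From mathcomp.analysis.showcase Require summability.
Import numFieldNormedType.Exports.
Set Implicit Arguments.
Unset Strict Implicit.
Unset Printing Implicit Defensive.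
Import Order.TTheory GRing.Theory Num.Theory.
Local Open Scope classical_set_scope.
Local Open Scope ring_scope.

(* Stationarity says nothing about a single translate of the mean, so every estimate is made for the
   translates by the walk at time [k] and averaged by iterates of the Markov operator at [1%g]. A
   function [h |-> m (F (h v))] is harmonic and keeps its average at all times, while translated
   variances average to 0 in the limit. Hence the plan: bound the harmonic function built from
   [|<lam a v, v>|] by products that decay, plus a harmonic remainder made small by freeness. The
   absolute value is not a quadratic form; this is why the state is extended to all bounded
   functions on the sphere. Two mismatches shape the rest. [K] need not be metrizable and unique
   stationarity speaks of Borel sets, so the Riesz measure has to be proved stationary set by set,
   starting from open sets; the metrizable boundary [X] communicates with [K] only through [Y]. And
   states are positive on products [a^* a] only: for [tau] to depend positively on quadratic forms,
   square roots must be built inside the reduced algebra. *)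
#[local] Existing Instance summability.totally_filter.

(** * Unordered sums and means *)

Section UnorderedSums.
Context (R : realType) (I : choiceType).
Implicit Types (a b : I -> R) (J : {fset I}).

Definition fsum a J : R := \sum_(i <- J) a i.

Lemma partial_sumE (V : zmodType) (x : I -> V) J :
  summability.partial_sum x J = \sum_(i <- J) x i.
Proof. by rewrite /summability.partial_sum big_seq_fsetE. Qed.

Definition has_sum a (l : R) := fsum a @ summability.totally --> l.

Lemma has_sumP a l : has_sum a l <-> forall e, 0 < e ->
  exists J0, forall J, (J0 `<=` J)%fset -> `|l - fsum a J| < e.
Proof.
split=> [/cvgrPdist_lt h e e0|h].
  by have [J _ hJ] := h _ e0; exists J => J' /hJ.
apply/cvgrPdist_lt => e /h[J hJ]; exists J => // J'; exact: hJ.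
Qed.

Lemma has_sum_unique a l l' : has_sum a l -> has_sum a l' -> l = l'.
Proof. by move=> h h'; apply: cvg_unique h h'; apply: norm_hausdorff. Qed.

Lemma has_sum_lin c a b l l' : has_sum a l -> has_sum b l' ->
  has_sum (fun i => c * a i + b i) (c * l + l').
Proof.
move=> h h'; rewrite /has_sum.
have -> : fsum (fun i => c * a i + b i) = (fun J => c * fsum a J + fsum b J).
  by apply/funext => J; rewrite /fsum big_split/= mulr_sumr.
by apply: cvgD => //; apply: cvgM => //; apply: cvg_cst.
Qed.

Arguments has_sum_lin c {a b l l'}.

Lemma has_sum0 : has_sum (fun=> 0) 0.
Proof.
apply/has_sumP => e e0; exists fset0 => J _.
by rewrite /fsum big1// subrr normr0.
Qed.

Lemma has_sumZ c a l : has_sum a l -> has_sum (fun i => c * a i) (c * l).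
Proof.
move=> h; have := has_sum_lin c h has_sum0.
by rewrite addr0; congr has_sum; apply/funext => i; rewrite addr0.
Qed.

Arguments has_sumZ c {a l}.

Lemma has_sumD a b l l' : has_sum a l -> has_sum b l' ->
  has_sum (fun i => a i + b i) (l + l').
Proof.
move=> h h'; have := has_sum_lin 1 h h'.
by rewrite mul1r; congr has_sum; apply/funext => i; rewrite mul1r.
Qed.

Lemma has_sumB a b l l' : has_sum a l -> has_sum b l' ->
  has_sum (fun i => a i - b i) (l - l').
Proof.
move=> h h'; have := has_sum_lin (-1) h' h.
by rewrite mulN1r addrC; congr has_sum; apply/funext => i; rewrite mulN1r addrC.
Qed.

Lemma has_sum_ge0 a l : (forall i, 0 <= a i) -> has_sum a l -> 0 <= l.
Proof.
move=> a0 /has_sumP h; rewrite leNgt; apply/negP => l0.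
have [|J hJ] := h (- l); first by rewrite oppr_gt0.
have := hJ _ (fsubset_refl J); rewrite ltNge => /negP; apply.
rewrite ltr0_norm; last by rewrite subr_lt0 (lt_le_trans l0)// sumr_ge0.
by rewrite opprB lerDr sumr_ge0.
Qed.

Lemma has_sum_le a b l l' : (forall i, a i <= b i) -> has_sum a l ->
  has_sum b l' -> l <= l'.
Proof.
move=> ab h h'; rewrite -subr_ge0.
by apply: has_sum_ge0 (has_sumB h' h) => i; rewrite subr_ge0.
Qed.

Lemma has_sum_abs_le a b l l' : (forall i, `|a i| <= b i) -> has_sum a l ->
  has_sum b l' -> `|l| <= l'.
Proof.
move=> ab h h'; rewrite ler_norml; apply/andP; split.
  rewrite -mulN1r; apply: has_sum_le (has_sumZ (-1) h') h => i.
  by rewrite mulN1r; have := ab i; rewrite ler_norml => /andP[].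
by apply: has_sum_le h h' => i; have := ab i; rewrite ler_norml => /andP[].
Qed.

Lemma fsum_sub a J J' : (forall i, 0 <= a i) -> (J `<=` J')%fset ->
  fsum a J <= fsum a J'.
Proof.
move=> a0 JJ'; rewrite /fsum (big_fsetID _ (mem J) J')/=.
rewrite (_ : [fset x in J' | x \in J]%fset = J); last first.
  apply/fsetP => x; rewrite !inE/= andbC; case: (boolP (x \in J)) => //= xJ.
  exact: (fsubsetP JJ').
by rewrite lerDl sumr_ge0.
Qed.

Lemma fsum_has_sum_le a l J : (forall i, 0 <= a i) -> has_sum a l ->
  fsum a J <= l.
Proof.
move=> a0 /has_sumP h; apply/ler_addgt0Pr => e e0.
have [J0 hJ] := h e e0.
apply: le_trans (fsum_sub a0 (fsubsetUl J J0)) _.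
have := hJ _ (fsubsetUr J J0); rewrite ltr_norml => /andP[+ _].
by rewrite ltrBrDl => /ltW; rewrite lerBlDr.
Qed.

Lemma nonneg_has_sum a M : (forall i, 0 <= a i) ->
  (forall J, fsum a J <= M) -> exists l, has_sum a l.
Proof.
move=> a0 aM; exists (sup (range (fsum a))); apply/has_sumP => e e0.
have hs : has_sup (range (fsum a)).
  by split; [exists (fsum a fset0), fset0|exists M => _ [J _ <-]].
have [_ [J _ <-] hJ] := sup_adherent e0 hs.
exists J => J' JJ'; rewrite ger0_norm; last first.
  by rewrite subr_ge0; apply: (ub_le_sup (proj2 hs)); exists J'.
by have := fsum_sub a0 JJ'; lra.
Qed.

(** Adding [b] makes the terms non-negative with partial sums below [2 * l]; subtracting [b] from
    the resulting sum leaves the sum of [a]. *)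
Lemma dominated_has_sum a b l : (forall i, `|a i| <= b i) -> has_sum b l ->
  exists l', has_sum a l'.
Proof.
move=> ab hb.
have b0 i : 0 <= b i by exact: le_trans (ab i).
have [|J|l' h] := @nonneg_has_sum (fun i => a i + b i) (2 * l).
- by move=> i; have := ab i; rewrite ler_norml => /andP[]; lra.
- apply: le_trans (fsum_has_sum_le J _ (has_sumZ 2 hb)).
    by apply: ler_sum => i _; have := ab i; rewrite ler_norml => /andP[]; lra.
  by move=> i; rewrite mulr_ge0.
exists (l' - l); have := has_sumB h hb.
by congr has_sum; apply/funext => i; rewrite addrK.
Qed.

Lemma has_sum_esum a l : (forall i, 0 <= a i) -> has_sum a l ->
  (\esum_(i in [set: I]) (a i)%:E = l%:E)%E.
Proof.
move=> a0 h; apply/eqP; rewrite eq_le; apply/andP; split.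
  apply: ge_ereal_sup => _ [A [finA _] <-].
  rewrite fsbig_finite// sumEFin lee_fin.
  exact: fsum_has_sum_le.
apply/lee_addgt0Pr => e e0.
have /has_sumP/(_ e e0)[J hJ] := h.
apply: (@le_trans _ _ ((fsum a J)%:E + e%:E)%E).
  have := hJ _ (fsubset_refl J); rewrite -EFinD lee_fin ltr_norml => /andP[_].
  by rewrite ltrBlDl => /ltW.
apply: leeD2r; apply: ereal_sup_ubound; exists [set` J].
  by split => //; exact: finite_fset.
by rewrite fsbig_finite ?set_fsetK ?sumEFin//; exact: finite_fset.
Qed.

(** Translates the [\esum] conditions of the definitions ([prob_mass], [sqnorm]) into nets of finite
    sums, where signed terms can be handled. *)
Lemma esum_has_sum a l : (forall i, 0 <= a i) ->
  (\esum_(i in [set: I]) (a i)%:E = l%:E)%E -> has_sum a l.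
Proof.
move=> a0 h.
have [J|l' h'] := @nonneg_has_sum a l a0.
  rewrite -lee_fin -h; apply: ereal_sup_ubound; exists [set` J].
    by split => //; exact: finite_fset.
  by rewrite fsbig_finite ?set_fsetK ?sumEFin//; exact: finite_fset.
by have := has_sum_esum a0 h'; rewrite h => -[->].
Qed.

Lemma has_sum_reindex a l (f f' : I -> I) : cancel f f' -> cancel f' f ->
  has_sum a l -> has_sum (fun i => a (f i)) l.
Proof.
move=> fK fK' /has_sumP h; apply/has_sumP => e /h[J0 hJ].
exists [fset f' x | x in J0]%fset => J sJ.
have -> : fsum (fun i => a (f i)) J = fsum a [fset f x | x in J]%fset.
  rewrite /fsum big_imfset//= => x y _ _; exact: (can_inj fK).
apply: hJ; apply/fsubsetP => x xJ; apply/imfsetP; exists (f' x) => //=.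
by apply: (fsubsetP sJ); apply/imfsetP; exists x.
Qed.

End UnorderedSums.
Arguments has_sum_lin {R I} c {a b l l'}.
Arguments has_sumZ {R I} c {a l}.

(** * Finitely additive means and their variances *)

Section Means.
Context (R : realType).

Definition bdd_fun (T : Type) (f : T -> R) := exists M, forall x, `|f x| <= M.

Lemma bdd_fun_lin T c (f g : T -> R) : bdd_fun f -> bdd_fun g ->
  bdd_fun (fun x => c * f x + g x).
Proof.
move=> [M hM] [N hN]; exists (`|c| * M + N) => x.
by rewrite (le_trans (ler_normD _ _))// normrM lerD// ler_wpM2l.
Qed.

Lemma bdd_fun_cst T c : bdd_fun (fun _ : T => c).
Proof. by exists `|c|. Qed.

Lemma bdd_funD T (f g : T -> R) : bdd_fun f -> bdd_fun g ->
  bdd_fun (fun x => f x + g x).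
Proof.
move=> [M hM] [N hN]; exists (M + N) => x.
by rewrite (le_trans (ler_normD _ _))// lerD.
Qed.

Lemma bdd_funM T (f g : T -> R) : bdd_fun f -> bdd_fun g ->
  bdd_fun (fun x => f x * g x).
Proof. by move=> [M hM] [N hN]; exists (M * N) => x; rewrite normrM ler_pM. Qed.

Lemma bdd_funZ T c (f : T -> R) : bdd_fun f ->
  bdd_fun (fun x => c * f x).
Proof. by move=> ?; apply: bdd_funM => //; exact: bdd_fun_cst. Qed.

Lemma bdd_funN T (f : T -> R) : bdd_fun f -> bdd_fun (fun x => - f x).
Proof. by move=> [M hM]; exists M => x; rewrite normrN. Qed.

Lemma bdd_funB T (f g : T -> R) : bdd_fun f -> bdd_fun g ->
  bdd_fun (fun x => f x - g x).
Proof. by move=> hf hg; apply: bdd_funD => //; exact: bdd_funN. Qed.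

Lemma bdd_funX T (f : T -> R) n : bdd_fun f ->
  bdd_fun (fun x => f x ^+ n).
Proof.
by move=> [M hM]; exists (M ^+ n) => x; rewrite normrX lerXn2r// nnegrE;
  exact: le_trans (hM x).
Qed.

Lemma bdd_fun_norm T (f : T -> R) : bdd_fun f ->
  bdd_fun (fun x => `|f x|).
Proof. by move=> [M hM]; exists M => x; rewrite normr_id. Qed.

Lemma bdd_fun_comp T T' (f : T -> R) (h : T' -> T) : bdd_fun f ->
  bdd_fun (fun x => f (h x)).
Proof. by move=> [M hM]; exists M => x. Qed.

Lemma bdd_fun_sum T (K : Type) (r : seq K) (f : K -> T -> R) :
  (forall k, bdd_fun (f k)) -> bdd_fun (fun x => \sum_(k <- r) f k x).
Proof.
move=> hf; elim: r => [|k r ih].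
  by exists 0 => x; rewrite big_nil normr0.
have [M hM] := bdd_funD (hf k) ih.
by exists M => x; rewrite big_cons.
Qed.

Lemma bdd_fun_itv T (f : T -> R) M : (forall x, 0 <= f x <= M) ->
  bdd_fun f.
Proof. by move=> h; exists M => x; have /andP[? ?] := h x; rewrite ger0_norm. Qed.

(** A finitely additive probability on all subsets of [T], seen as a functional. The axioms
    constrain [m] on bounded functions only, hence the [bdd_fun] side conditions everywhere. *)
Record mean (T : Type) (m : (T -> R) -> R) : Prop := Mean {
  mean_lin : forall c f g, bdd_fun f -> bdd_fun g ->
    m (fun x => c * f x + g x) = c * m f + m g;
  mean_ge0 : forall f, bdd_fun f -> (forall x, 0 <= f x) -> 0 <= m f;
  mean_1 : m (fun=> 1) = 1 }.

Section MeanTheory.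
Context (T : Type) (m : (T -> R) -> R) (mm : mean m).
Implicit Types f g : T -> R.
Let bcst := @bdd_fun_cst T.

Lemma mean0 : m (fun=> 0) = 0.
Proof.
have := mean_lin mm (-1) (bcst 0) (bcst 0).
rewrite (_ : (fun _ => -1 * 0 + 0) = (fun _ : T => 0)); last first.
  by apply/funext => x; rewrite mulr0 addr0.
by rewrite mulN1r addNr.
Qed.

Lemma meanZ c f : bdd_fun f -> m (fun x => c * f x) = c * m f.
Proof.
move=> hf; have := mean_lin mm c hf (bcst 0).
by rewrite mean0 addr0 => <-; congr m; apply/funext => x; rewrite addr0.
Qed.

Lemma meanD f g : bdd_fun f -> bdd_fun g ->
  m (fun x => f x + g x) = m f + m g.
Proof.
move=> hf hg; have := mean_lin mm 1 hf hg; rewrite mul1r => <-.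
by congr m; apply/funext => x; rewrite mul1r.
Qed.

Lemma meanB f g : bdd_fun f -> bdd_fun g ->
  m (fun x => f x - g x) = m f - m g.
Proof.
move=> hf hg; have := mean_lin mm (-1) hg hf; rewrite mulN1r addrC => <-.
by congr m; apply/funext => x; rewrite mulN1r addrC.
Qed.

Lemma mean_cst c : m (fun=> c) = c.
Proof.
have := meanZ c (bcst 1); rewrite (mean_1 mm) mulr1 => {2}<-.
by congr m; apply/funext => x; rewrite mulr1.
Qed.

Lemma mean_le f g : bdd_fun f -> bdd_fun g -> (forall x, f x <= g x) ->
  m f <= m g.
Proof.
move=> hf hg fg; rewrite -subr_ge0 -meanB//; apply: (mean_ge0 mm).
  exact: bdd_funB.
by move=> x; rewrite subr_ge0.
Qed.

Lemma mean_abs_le f M : (forall x, `|f x| <= M) -> `|m f| <= M.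
Proof.
move=> h; have hf : bdd_fun f by exists M.
rewrite ler_norml; apply/andP; split.
  rewrite -[leLHS]mean_cst; apply: mean_le => // x.
  by have := h x; rewrite ler_norml => /andP[].
rewrite -[leRHS]mean_cst; apply: mean_le => // x.
by have := h x; rewrite ler_norml => /andP[].
Qed.

Lemma mean_abs f : bdd_fun f -> `|m f| <= m (fun x => `|f x|).
Proof.
move=> hf; have hn := bdd_fun_norm hf; rewrite ler_norml -mulN1r -meanZ//.
apply/andP; split; apply: mean_le => //; first exact: bdd_funZ.
  by move=> x; rewrite mulN1r lerNl -normrN ler_norm.
by move=> x; rewrite ler_norm.
Qed.

Lemma mean_sum (K : Type) (r : seq K) (f : K -> T -> R) :
  (forall k, bdd_fun (f k)) ->
  m (fun x => \sum_(k <- r) f k x) = \sum_(k <- r) m (f k).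
Proof.
move=> hf; elim: r => [|k r ih].
  by rewrite big_nil -[RHS]mean0; congr m; apply/funext => x; rewrite big_nil.
rewrite big_cons -ih -meanD//; last exact: bdd_fun_sum.
by congr m; apply/funext => x; rewrite big_cons.
Qed.

Definition mvariance f := m (fun x => f x ^+ 2) - m f ^+ 2.

(** The decomposition of a mean square error into variance and squared bias. With [c = 0] it splits
    a second moment, which is how the oscillation of a function is reduced to a difference of two
    means. *)
Lemma mvariance_cst f c : bdd_fun f ->
  m (fun x => (f x - c) ^+ 2) = mvariance f + (m f - c) ^+ 2.
Proof.
move=> hf.
have -> : (fun x => (f x - c) ^+ 2) =
    (fun x => - (2 * c) * f x + (1 * f x ^+ 2 + c ^+ 2)).
  by apply/funext => x; ring.
rewrite (mean_lin mm)//; last first.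
  by apply: bdd_fun_lin; [exact: bdd_funX|exact: bcst].
rewrite (mean_lin mm) ?mean_cst /mvariance; [ring|exact: bdd_funX|exact: bcst].
Qed.

Lemma mvariance_centered f : bdd_fun f ->
  mvariance f = m (fun x => (f x - m f) ^+ 2).
Proof. by move=> hf; rewrite mvariance_cst// subrr expr0n addr0. Qed.

Lemma mvariance_ge0 f : bdd_fun f -> 0 <= mvariance f.
Proof.
move=> hf; rewrite mvariance_centered//; apply: (mean_ge0 mm).
  by apply: bdd_funX; apply: bdd_funB => //; exact: bcst.
by move=> x; rewrite sqr_ge0.
Qed.

Lemma mvariance_le f : bdd_fun f -> mvariance f <= m (fun x => f x ^+ 2).
Proof. by move=> hf; rewrite lerBlDr lerDl sqr_ge0. Qed.

(** After centering this is [(p + q)^2 <= 2 p^2 + 2 q^2]. The factor 2 is harmless, because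
    variances are only ever shown to vanish. *)
Lemma mvarianceD f g : bdd_fun f -> bdd_fun g ->
  mvariance (fun x => f x + g x) <= 2 * mvariance f + 2 * mvariance g.
Proof.
move=> hf hg; have hd := bdd_funD hf hg.
rewrite !mvariance_centered//.
have b h : bdd_fun h -> bdd_fun (fun x => (h x - m h) ^+ 2).
  by move=> bh; apply: bdd_funX; apply: bdd_funB => //; exact: bcst.
rewrite -(meanZ 2 (b f hf)) -(meanZ 2 (b g hg)) -meanD;
  try by apply: bdd_funZ; exact: b.
apply: mean_le; [exact: b|by apply: bdd_funD; apply: bdd_funZ; exact: b|].
move=> x; rewrite meanD//.
have := sqr_ge0 ((f x - m f) - (g x - m g)); lra.
Qed.

End MeanTheory.

Lemma mvariance_scale (T : Type) (m : (T -> R) -> R) c f : mean m ->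
  bdd_fun f -> mvariance m (fun x => c * f x) = c ^+ 2 * mvariance m f.
Proof.
move=> mm hf; rewrite /mvariance meanZ// exprMn mulrBr; congr (_ - _).
rewrite -meanZ//; last exact: bdd_funX.
by congr m; apply/funext => x; rewrite exprMn.
Qed.

Lemma mean_comp T T' (m : (T -> R) -> R) (h : T -> T') : mean m ->
  mean (fun f => m (fun x => f (h x))).
Proof.
move=> mm; split => [c f g hf hg|f hf f0|]; last exact: (mean_1 mm).
  by rewrite (mean_lin mm)//; exact: bdd_fun_comp.
by apply: (mean_ge0 mm) => //; exact: bdd_fun_comp.
Qed.

Lemma bdd_mean_comp T T' J (m : (T -> R) -> R) (h : J -> T -> T') f : mean m ->
  bdd_fun f -> bdd_fun (fun g => m (fun x => f (h g x))).
Proof. by move=> mm [M hM]; exists M => g; apply: (mean_abs_le mm) => x. Qed.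

End Means.

(** * Countably additive expectations, and their exchange with means *)

Section Expectation.
Context (R : realType) (I : choiceType) (mu : I -> R).
Hypotheses (mu0 : forall i, 0 <= mu i) (mu1 : has_sum mu 1).

(** Serves for two laws on the group: the step law of the walk, and the weights [|v g|^2] of a unit
    vector [v]. *)
Definition expect (phi : I -> R) : R :=
  lim (fsum (fun i => mu i * phi i) @ summability.totally).

Lemma expect_has_sum phi : bdd_fun phi ->
  has_sum (fun i => mu i * phi i) (expect phi).
Proof.
move=> [M hM].
have [||l hl] := @dominated_has_sum R I (fun i => mu i * phi i)
    (fun i => M * mu i) (M * 1); last by apply: cvgP hl.
  by move=> i; rewrite normrM ger0_norm// mulrC ler_wpM2r.
exact: has_sumZ.
Qed.

Lemma has_sum_expect phi l : bdd_fun phi ->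
  has_sum (fun i => mu i * phi i) l -> expect phi = l.
Proof. by move=> /expect_has_sum h h'; exact: has_sum_unique h h'. Qed.

Lemma mean_expect : mean expect.
Proof.
split => [c f g hf hg|f hf f0|].
- apply: has_sum_expect; first exact: bdd_fun_lin.
  have := has_sum_lin c (expect_has_sum hf) (expect_has_sum hg).
  by congr has_sum; apply/funext => i; ring.
- by apply: has_sum_ge0 (expect_has_sum hf) => i; rewrite mulr_ge0.
- apply: has_sum_expect; first exact: bdd_fun_cst.
  by move: mu1; congr has_sum; apply/funext => i; rewrite mulr1.
Qed.

Lemma expect_tail e : 0 < e -> exists J : {fset I},
  forall phi M, (forall i, `|phi i| <= M) ->
  `|expect phi - fsum (fun i => mu i * phi i) J| <= M * e.
Proof.
move=> e0; have /has_sumP/(_ e e0)[J hJ] := mu1.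
exists J => phi M hM.
have hphi : bdd_fun phi by exists M.
(* [I] has an element, since otherwise the total mass would be an empty sum; any value of [phi] then
   shows that [M] is non-negative. *)
have M0 : 0 <= M.
  have [ [i _]|h] := pselect (exists i : I, True); first exact: le_trans (hM i).
  have := @has_sum_unique R I _ _ _ mu1; move=> /(_ 0) h0.
  have /eqP : (1 : R) = 0.
    apply: h0; move: (@has_sum0 R I); congr has_sum; apply/funext => i.
    by case: h; exists i.
  by rewrite oner_eq0.
(* The finite sum is rewritten as an unordered sum of the truncated family, so that the difference
   can be estimated term by term. *)
have fin (a : I -> R) : has_sum (fun i => a i * (i \in J)%:R) (fsum a J).
  apply/has_sumP => e' e'0; exists J => J' JJ'.
  rewrite /fsum (big_fsetID _ (mem J) J')/= [X in _ - (_ + X)]big1_fset ?addr0.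
    rewrite (_ : [fset x in J' | x \in J]%fset = J); last first.
      apply/fsetP => x; rewrite !inE/= andbC; case: (boolP (x \in J)) => //= xJ.
      exact: (fsubsetP JJ').
    under [X in _ - X]eq_big_seq => i -> do rewrite mulr1.
    by rewrite subrr normr0.
  by move=> i; rewrite !inE => /andP[_ /negPf ->] _; rewrite mulr0.
have h1 := has_sumB (expect_has_sum hphi) (fin (fun i => mu i * phi i)).
have h2 := has_sumZ M (has_sumB mu1 (fin mu)).
apply: le_trans (has_sum_abs_le _ h1 h2) _.
  move=> i; case: (i \in J); first by rewrite !mulr1 !subrr normr0 mulr0.
  by rewrite !mulr0 !subr0 normrM ger0_norm// mulrC ler_wpM2r.
rewrite ler_wpM2l// ltW// (le_lt_trans _ (hJ _ (fsubset_refl J)))//.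
exact: ler_norm.
Qed.

Lemma mean_expectC T (m : (T -> R) -> R) (F : I -> T -> R) M : mean m ->
  (forall i x, `|F i x| <= M) ->
  m (fun x => expect (fun i => F i x)) = expect (fun i => m (F i)).
Proof.
move=> mm hM.
have hF i : bdd_fun (F i) by exists M.
have hE : bdd_fun (fun x => expect (fun i => F i x)).
  by exists M => x; apply: (mean_abs_le mean_expect) => i.
apply/eqP; rewrite -subr_eq0 -normr_le0; apply/ler_addgt0Pr => e e0.
rewrite add0r.
have M0 : 0 <= `|M| + 1 by rewrite addr_ge0.
have Mp : 0 < `|M| + 1 by rewrite ltr_wpDl.
have hM' i x : `|F i x| <= `|M| + 1.
  by rewrite (le_trans (hM i x))// (le_trans (ler_norm M))// lerDl.
have [|J hJ] := @expect_tail (e / 2 / (`|M| + 1)).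
  by rewrite divr_gt0// divr_gt0.
have e2 : (`|M| + 1) * (e / 2 / (`|M| + 1)) = e / 2.
  by rewrite mulrC divfK// gt_eqF.
have h1 : `|expect (fun i => m (F i)) - fsum (fun i => mu i * m (F i)) J| <= e / 2.
  by rewrite -e2; apply: hJ => i; apply: (mean_abs_le mm) => x.
have bs : bdd_fun (fun x => fsum (fun i => mu i * F i x) J).
  by apply: bdd_fun_sum => i; exact: bdd_funZ.
have h2 : `|m (fun x => expect (fun i => F i x))
    - fsum (fun i => mu i * m (F i)) J| <= e / 2.
  have -> : fsum (fun i => mu i * m (F i)) J =
      m (fun x => fsum (fun i => mu i * F i x) J).
    rewrite /fsum mean_sum//; last by move=> i; exact: bdd_funZ.
    by apply: eq_bigr => i _; rewrite meanZ.
  rewrite -meanB//; apply: (mean_abs_le mm) => x; rewrite -e2; exact: hJ.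
have := ler_normB (m (fun x => expect (fun i => F i x))
    - fsum (fun i => mu i * m (F i)) J)
  (expect (fun i => m (F i)) - fsum (fun i => mu i * m (F i)) J).
rewrite opprB addrA subrK => /le_trans; apply; lra.
Qed.

Lemma expect_esum phi : (forall i, 0 <= phi i) -> bdd_fun phi ->
  (\esum_(i in [set: I]) ((mu i)%:E * (phi i)%:E) = (expect phi)%:E)%E.
Proof.
move=> p0 hp; have := has_sum_esum _ (expect_has_sum hp); apply.
by move=> i; rewrite mulr_ge0.
Qed.

End Expectation.

(** * Extension of positive functionals to means *)

Section MeanExtension.
Context (R : realType) (T : Type).

(** A partial linear functional is encoded by its graph, so that extension is inclusion and Zorn's
    lemma applies to plain sets. Single-valuedness is not imposed: positivity forces it. *)
Definition positive_graph (G : set ((T -> R) * R)) : Prop :=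
  [/\ forall p, G p -> bdd_fun p.1,
      forall c p q, G p -> G q ->
        G ((fun x => c * p.1 x + q.1 x), c * p.2 + q.2),
      G ((fun=> 1), 1)
    & forall p, G p -> (forall x, 0 <= p.1 x) -> 0 <= p.2].

(** If [f] had values [r] and [r'], the zero function would have the values [r - r'] and [r' - r];
    both are non-negative by positivity. *)
Lemma positive_graph_uniq G f r r' : positive_graph G ->
  G (f, r) -> G (f, r') -> r = r'.
Proof.
case=> _ Glin _ Gpos Gr Gr'.
apply/eqP; rewrite eq_le -[r <= r']subr_ge0 -[r' <= r]subr_ge0.
have h (a b : R) : G (f, a) -> G (f, b) -> 0 <= b - a.
  move=> Ga Gb; have := Gpos _ (Glin (-1) _ _ Ga Gb).
  by rewrite /= mulN1r addrC; apply => x; rewrite mulN1r addNr.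
by rewrite !h.
Qed.

Lemma positive_graph_maximal G0 : positive_graph G0 ->
  exists G, [/\ positive_graph G, G0 `<=` G
    & forall G', positive_graph G' -> G `<=` G' -> G' `<=` G].
Proof.
move=> pos0.
(* Zorn is applied to the sets whose union with [G0] is a positive graph. In this way the empty
   chain, whose union is empty, also satisfies the predicate. *)
have [F FP Ftot|A [PA Amax]] :=
    @Zorn_bigcup _ [set X | positive_graph (X `|` G0)].
  have two p q : (\bigcup_(X in F) X `|` G0) p -> (\bigcup_(X in F) X `|` G0) q ->
      exists X, [/\ positive_graph (X `|` G0), X `<=` \bigcup_(X in F) X,
        (X `|` G0) p & (X `|` G0) q].
    have sub0 X : F X -> X `<=` \bigcup_(X in F) X by move=> FX x Xx; exists X.
    move=> [[X FX Xp]|Gp] [[Y FY Yq]|Gq].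
    - have [XY|YX] := Ftot _ _ FX FY.
        exists Y; split; [exact: FP|exact: sub0|left; exact: XY|by left].
      exists X; split; [exact: FP|exact: sub0|by left|left; exact: YX].
    - by exists X; split; [exact: FP|exact: sub0|left|right].
    - by exists Y; split; [exact: FP|exact: sub0|right|left].
    - exists set0; rewrite set0U; split => // ?.
  split.
  - by move=> p hp; have [X [[+ _ _ _] _ Xp _]] := two p p hp hp; apply.
  - move=> c p q hp hq; have [X [[_ + _ _] sX Xp Xq]] := two p q hp hq.
    by move=> /(_ c _ _ Xp Xq)[/sX|]; [left|right].
  - by right; case: pos0.
  - by move=> p hp; have [X [[_ _ _ +] _ Xp _]] := two p p hp hp; apply.
exists (A `|` G0); split; [exact: PA|by move=> x; right|].
move=> G' posG' sG'; apply: contrapT => nsub.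
apply: (Amax G') => /=.
  split; first by move=> x Ax; apply: sG'; left.
  by move=> sG'A; apply: nsub => x /sG'A; left.
rewrite (_ : G' `|` G0 = G')//.
by apply/seteqP; split=> [x []// G0x|x]; [apply: sG'; right|left].
Qed.

(** Kantorovich's form of the Hahn-Banach theorem. Constants belong to the graph, so a bounded
    function always has members of the graph below and above it, and a maximal graph must contain
    it. *)
Lemma mean_of_positive_graph G0 : positive_graph G0 ->
  exists2 m : (T -> R) -> R, mean m & forall p, G0 p -> m p.1 = p.2.
Proof.
move=> /positive_graph_maximal[G [posG sG Gmax]].
have [Gbd Glin G1 Gpos] := posG.
have GZ c p : G p -> G ((fun x => c * p.1 x), c * p.2).
  move=> Gp; have := Glin c _ _ Gp (Glin (-1) _ _ Gp Gp).
  rewrite /= mulN1r addNr addr0; congr (G (_, _)).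
  by apply/funext => x; rewrite mulN1r addNr addr0.
have Gcst c : G ((fun=> c), c).
  by have := GZ c _ G1; rewrite /= mulr1.
have Gle p q : G p -> G q -> (forall x, p.1 x <= q.1 x) -> p.2 <= q.2.
  move=> Gp Gq pq; have := Gpos _ (Glin (-1) _ _ Gp Gq).
  rewrite /= mulN1r addrC subr_ge0; apply=> x.
  by rewrite mulN1r addrC subr_ge0.
have total f : bdd_fun f -> exists r, G (f, r).
  move=> hf; have [M hM] := hf.
  pose lower := [set p.2 | p in [set p | G p /\ forall x, p.1 x <= f x]].
  have upper p : G p -> (forall x, f x <= p.1 x) -> ubound lower p.2.
    move=> Gp fp _ [q [Gq qf] <-]; apply: Gle => // x.
    exact: le_trans (qf x) (fp x).
  have fM x : f x <= M by apply: le_trans (hM x); rewrite ler_norm.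
  have hs : has_sup lower.
    split; last by exists M; apply: (upper _ (Gcst M)).
    exists (- M), ((fun=> - M), - M) => //; split => //= x.
    by have := hM x; rewrite ler_norml => /andP[].
  (* Any number between the values of the lower and of the upper approximants would keep the
     extension positive; the supremum of the lower values is one. *)
  pose a := sup lower.
  have lea p : G p -> (forall x, p.1 x <= f x) -> p.2 <= a.
    by move=> Gp pf; apply: (ub_le_sup (proj2 hs)); exists p.
  have gea p : G p -> (forall x, f x <= p.1 x) -> a <= p.2.
    by move=> Gp fp; apply: ge_sup; [exact: (proj1 hs)|exact: upper].
  pose G' : set ((T -> R) * R) :=
    [set q | exists c, exists2 p, G p &
       q = ((fun x => c * f x + p.1 x), c * a + p.2)].
  exists a; apply: (Gmax G').
  - split.
    + by move=> _ [c [p Gp ->]]; apply: bdd_fun_lin => //; exact: Gbd.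
    + move=> k _ _ [c [p Gp ->]] [c' [p' Gp' ->]].
      exists (k * c + c'); exists ((fun x => k * p.1 x + p'.1 x), k * p.2 + p'.2).
        exact: Glin.
      by congr (_, _) => /=; [apply/funext => x; ring|ring].
    + exists 0, ((fun=> 1), 1) => //=.
      by congr (_, _); [apply/funext => x|]; rewrite mul0r add0r.
    + move=> _ [c [p Gp ->]] /= h.
      (* Dividing [c * f + p >= 0] by [c] makes [- c^-1 * p] an upper approximant of [f] when
         [c < 0] and a lower one when [c > 0], to be compared with [a]. *)
      have [c0|c0|c0] := ltgtP c 0.
      * have h' : a <= ((- c^-1) * p.2).
          apply: (gea _ (GZ (- c^-1) _ Gp)) => x /=.
          rewrite mulNr mulrC -mulNr ler_ndivlMr//.
          by have := h x; rewrite -lerBlDr sub0r mulrC.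
        move: h'; rewrite mulNr mulrC -mulNr ler_ndivlMr//.
        by rewrite -subr_ge0 opprK addrC; rewrite [a * c]mulrC addrC.
      * have h' : ((- c^-1) * p.2) <= a.
          apply: (lea _ (GZ (- c^-1) _ Gp)) => x /=.
          rewrite mulNr mulrC -mulNr ler_pdivrMr//.
          by have := h x; rewrite -lerBlDr sub0r mulrC.
        move: h'; rewrite mulNr mulrC -mulNr ler_pdivrMr//.
        by rewrite -subr_ge0 opprK [a * c]mulrC.
      * move: h; rewrite c0 mul0r add0r => h; apply: Gpos => // x.
        by have := h x; rewrite mul0r add0r.
  - move=> [g r] Gp; exists 0, (g, r) => //=.
    by congr (_, _); [apply/funext => x|]; rewrite mul0r add0r.
  - exists 1, ((fun=> 0), 0) => //=.
    by congr (_, _); [apply/funext => x|]; rewrite mul1r addr0.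
have [m hm] : {m : (T -> R) -> R & forall f, bdd_fun f -> G (f, m f)}.
  apply: (@choice _ _ (fun f r => bdd_fun f -> G (f, r))) => f.
  by have [/total[r]|nf] := pselect (bdd_fun f); [exists r|exists 0].
have mE f r : G (f, r) -> m f = r.
  by move=> Gf; apply: (positive_graph_uniq posG _ Gf); apply/hm/(Gbd _ Gf).
exists m; last by move=> [f r] /sG; exact: mE.
split=> [c f g hf hg|f hf f0|]; last exact: mE.
- exact: mE (Glin c _ _ (hm _ hf) (hm _ hg)).
- exact: Gpos (hm _ hf) f0.
Qed.

End MeanExtension.

(** A generalized limit for bounded sequences, extended from the convergent ones. It condenses a
    sequence of Cesaro averages into one mean. *)
Lemma mean_limit (R : realType) : exists2 L : (nat -> R) -> R, mean L &
  forall u l, bdd_fun u -> u n @[n --> \oo] --> l -> L u = l.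
Proof.
have [|L mL hL] := @mean_of_positive_graph R nat
  [set p | bdd_fun p.1 /\ p.1 n @[n --> \oo] --> p.2].
  split => [p []//|c p q [bp cp] [bq cq]||p [_ cp] p0] /=.
  - split; first exact: bdd_fun_lin.
    by apply: cvgD => //; apply: cvgM => //; exact: cvg_cst.
  - by split; [exact: bdd_fun_cst|exact: cvg_cst].
  - rewrite -(cvg_lim _ cp)//; apply: limr_ge; first by apply: cvgP cp.
    by apply: nearW.
by exists L => // u l bu cu; exact: (hL (u, l)).
Qed.

(** * Probability measures as means *)

Section MeanMeasure.
Context (R : realType) d (Y : measurableType d) (P : probability Y R).
Implicit Types f g : Y -> R.

Lemma bdd_fun_integrable f : measurable_fun setT f -> bdd_fun f ->
  P.-integrable setT (EFin \o f).
Proof.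
move=> mf [M hM]; apply: measurable_bounded_integrable => //.
  by rewrite -ge0_fin_numE // fin_num_measure.
by exists M; split; [exact: num_real|move=> x Mx y _; exact: le_trans (hM y) (ltW Mx)].
Qed.

Definition represents (m : (Y -> R) -> R) : Prop :=
  forall A : set Y, measurable A -> P A = (m \1_A)%:E.

Lemma integral_mean : exists2 m, mean m &
  forall f, measurable_fun setT f -> bdd_fun f ->
    (\int[P]_x (f x)%:E)%E = (m f)%:E.
Proof.
have [|m mm hm] := @mean_of_positive_graph R Y
  [set p | [/\ bdd_fun p.1, measurable_fun setT p.1
             & (\int[P]_x (p.1 x)%:E)%E = p.2%:E]].
  split => [p []//|c p q [bp mp cp] [bq mq cq]||p [bp mp cp] p0] /=.
  - split; first exact: bdd_fun_lin.
      by apply: measurable_funD => //; exact: measurable_realfun.measurable_funM.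
    under eq_integral do rewrite EFinD EFinM.
    rewrite integralD//=.
    + by rewrite integralZl//= ?cp ?cq -?EFinM//; exact: bdd_fun_integrable.
    + by apply: integrableZl => //; exact: bdd_fun_integrable.
    + exact: bdd_fun_integrable.
  - split; [exact: bdd_fun_cst|exact: measurable_cst|].
    by rewrite integral_cst// [X in (_ * X)%E](_ : _ = 1%E) ?mule1//; exact: probability_setT.
  - by rewrite -lee_fin -cp; apply: integral_ge0 => x _; rewrite lee_fin.
exists m => // f mf bf.
have fin : (\int[P]_x (f x)%:E)%E \is a fin_num.
  by apply: integrable_fin_num => //; exact: bdd_fun_integrable.
have /= -> := hm (f, fine (\int[P]_x (f x)%:E)%E); rewrite fineK//.
Qed.

Lemma integral_mean_represents m :
  (forall f, measurable_fun setT f -> bdd_fun f ->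
    (\int[P]_x (f x)%:E)%E = (m f)%:E) -> represents m.
Proof.
move=> h A mA; rewrite -h//; first by rewrite integral_indic// setIT.
by exists 1 => x; rewrite indicE; case: (_ \in _); rewrite ?normr1 ?normr0.
Qed.

Lemma mean_dominated m (g : nat -> Y -> R) M : 
  (forall f, measurable_fun setT f -> bdd_fun f ->
    (\int[P]_x (f x)%:E)%E = (m f)%:E) ->
  (forall n, measurable_fun setT (g n)) -> (forall n x, `|g n x| <= M) ->
  {ae P, forall x, g n x @[n --> \oo] --> (0 : R)} ->
  m (g n) @[n --> \oo] --> (0 : R).
Proof.
move=> hm mg hM aeg.
have [|||||_ _] := @dominated_convergence _ _ _ P setT measurableT
    (fun n x => (g n x)%:E) (fun=> 0%E) (fun=> M%:E).
- by move=> n; apply/measurable_EFinP.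
- exact: measurable_cst.
- apply: filterS aeg => x hx _; apply: cvg_EFin hx; exact: nearW.
- by apply: (@bdd_fun_integrable (fun=> M)); [exact: measurable_cst|exact: bdd_fun_cst].
- by apply: aeW => x n _; rewrite lee_fin.
rewrite integral0 => h.
have hE n : fine (\int[P]_x (g n x)%:E)%E = m (g n) by rewrite hm//; exists M.
have := fine_cvg h; rewrite (_ : fine \o _ = (fun n => m (g n))); [|exact/funext].
by apply.
Qed.

End MeanMeasure.

Lemma bdd_indic (R : realType) T (A : set T) : bdd_fun (\1_A : T -> R).
Proof.
by exists 1 => x; rewrite indicE; case: (_ \in _); rewrite ?normr1 ?normr0.
Qed.

(** * Random walks *)

Section ProbMass.
Context (R : realType) (G : groupType) (mu : G -> R).
Hypothesis mum : prob_mass mu.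

Lemma prob_mass_ge0 g : 0 <= mu g. Proof. by case: mum. Qed.

Lemma prob_mass_has_sum : has_sum mu 1.
Proof. by case: mum => mu0 mu1; exact: esum_has_sum. Qed.

(** The transition operator of the walk [h -> h * g]. Its iterates at [1%g] are the expectations at
    time [k], expressed without a path space; paths occur only where the boundary hypothesis is
    exploited. *)
Definition markov_op (phi : G -> R) (h : G) : R := expect mu (fun g => phi (h * g)%g).

Lemma mean_iter_markov k h : mean (fun phi => iter k markov_op phi h).
Proof.
have mE := mean_expect prob_mass_ge0 prob_mass_has_sum.
elim: k h => [h|k ih h] /=.
  by split => // f _; apply.
have bi f : bdd_fun f -> bdd_fun (iter k markov_op f).
  by move=> [M hM]; exists M => x; apply: (mean_abs_le (ih x)).
split=> [c f g hf hg|f hf f0|]; rewrite /markov_op.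
- rewrite -(mean_lin mE); last 2 first.
  + by apply: bdd_fun_comp; exact: bi.
  + by apply: bdd_fun_comp; exact: bi.
  by congr (expect mu); apply/funext => x; rewrite (mean_lin (ih _)).
- apply: (mean_ge0 mE); first by apply: bdd_fun_comp; exact: bi.
  by move=> x; apply: (mean_ge0 (ih _)).
- rewrite (_ : (fun g => _) = (fun=> 1)) ?(mean_1 mE)//.
  by apply/funext => x; rewrite (mean_1 (ih _)).
Qed.

Lemma iter_markov_harmonic phi k h :
  (forall h, markov_op phi h = phi h) -> iter k markov_op phi h = phi h.
Proof.
move=> hphi; elim: k h => [//|k ih] h /=.
by rewrite -[RHS]hphi; congr (expect mu); apply/funext => g; exact: ih.
Qed.

Lemma iter_markov_shift phi k a h :
  iter k markov_op (fun x => phi (a * x)%g) h = iter k markov_op phi (a * h)%g.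
Proof.
elim: k h => [//|k ih] h /=; congr (expect mu); apply/funext => g.
by rewrite ih mulgA.
Qed.

Section Walk.
Context d (Omega : measurableType d) (P : probability Omega R)
  (s : nat -> Omega -> G).
Hypothesis iid : iid_steps mu P s.
Context (m : (Omega -> R) -> R).
Hypotheses (mm : mean m) (mP : represents P m).

(** Splits off the first step instead of the last one, as the iterates of [markov_op] do; the index
    [i] records how many steps have already been conditioned on. *)
Fixpoint walk_from i k w : G :=
  if k is k'.+1 then (s i w * walk_from i.+1 k' w)%g else 1%g.

Lemma walk_fromS i k w :
  walk_from i k.+1 w = (walk_from i k w * s (i + k)%N w)%g.
Proof.
elim: k i => [|k ih] i; first by rewrite /= mulg1 mul1g addn0.
by rewrite [LHS]/= -/(walk_from i.+1 k.+1 w) ih mulgA addSnnS.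
Qed.

Lemma walkE k w : walk s k w = walk_from 0 k w.
Proof. by elim: k => [//|k ih]; rewrite walk_fromS /= ih add0n. Qed.

(** The weight [c] stands for an indicator of an event determined by the steps before [i].
    Conditioning on one more step is then a multiplication. *)
Definition independent_of_steps (c : Omega -> R) i :=
  forall (J : {fset nat}) (A : nat -> set G), (forall n, n \in J -> (i <= n)%N) ->
  m (fun w => c w * \prod_(n <- J) \1_(A n) (s n w)) =
  m c * \prod_(n <- J) m (fun w => \1_(A n) (s n w)).

Lemma mean_step g n : m (fun w => (s n w == g)%:R) = mu g.
Proof.
case: iid => ms Pmu _.
have := mP (ms n [set g]); rewrite Pmu => -[->]; congr m; apply/funext => w.
rewrite indicE; congr (_%:R); congr nat_of_bool.
by apply/eqP/idP; rewrite inE.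
Qed.

Lemma iid_independent : independent_of_steps (fun=> 1) 0.
Proof.
case: iid => ms _ ind J A _.
have indicpre n : (fun w => \1_(A n) (s n w)) = \1_(s n @^-1` A n) :> (Omega -> R).
  by [].
have mJ : measurable (\bigcap_(n in [set` J]) (s n @^-1` A n)).
  by apply: fin_bigcap_measurable => // n _; exact: ms.
rewrite (mean_1 mm) mul1r.
have := ind J A; rewrite (mP mJ).
rewrite (eq_bigr (fun n => (m \1_(s n @^-1` A n))%:E)); last first.
  by move=> n _; exact: mP.
rewrite prodEFin => -[]; under [in RHS]eq_bigr do rewrite -indicpre.
move=> <-; congr m; apply/funext => w; rewrite mul1r indicE.
case: (boolP (w \in _)) => [/set_mem hw|/negP hw].
  rewrite big_seq big1// => n nJ; rewrite indicE mem_set//; exact: hw.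
have {}hw : ~ (\bigcap_(n in [set` J]) (s n @^-1` A n)) w by move=> /mem_set.
move/existsNP: hw => [n /not_implyP[nJ nA]].
by rewrite (big_fsetD1 n)//= indicE memNset// mul0r.
Qed.

(** The new factor is absorbed by adding the index [i], with the event [[set g]], to the finite
    family on which independence is tested. *)
Lemma independent_step c i g : independent_of_steps c i ->
  m (fun w => c w * (s i w == g)%:R) = m c * mu g /\
  independent_of_steps (fun w => c w * (s i w == g)%:R) i.+1.
Proof.
move=> ind.
have eqE n w : (s n w == g)%:R = \1_[set g] (s n w) :> R.
  by rewrite indicE; congr (_%:R); congr nat_of_bool; apply/eqP/idP; rewrite inE.
have key (J : {fset nat}) (A : nat -> set G) :
    (forall n, n \in J -> (i < n)%N) ->
    m (fun w => c w * (s i w == g)%:R * \prod_(n <- J) \1_(A n) (s n w)) =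
    m c * mu g * \prod_(n <- J) m (fun w => \1_(A n) (s n w)).
  move=> hJ; pose A' n := if n == i then [set g] else A n.
  have iJ : i \notin J by apply/negP => /hJ; rewrite ltnn.
  have AA' n : n \in J -> A' n = A n.
    by move=> nJ; rewrite /A' ifN//; apply: contraNneq iJ => <-.
  have -> : (fun w => c w * (s i w == g)%:R * \prod_(n <- J) \1_(A n) (s n w)) =
      (fun w => c w * \prod_(n <- (i |` J)%fset) \1_(A' n) (s n w)).
    apply/funext => w; rewrite big_fsetU1//= {1}/A' eqxx -eqE mulrA.
    by congr (_ * _); apply: eq_big_seq => n /AA' ->.
  rewrite ind => [|n]; last by rewrite !inE => /orP[/eqP->//|/hJ/ltnW].
  rewrite big_fsetU1//= mulrA; congr (_ * _ * _).
    rewrite -(mean_step g i); congr m; apply/funext => w.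
    by rewrite /A' eqxx eqE.
  by apply: eq_big_seq => n /AA' ->.
split.
  have := key fset0 (fun=> setT); rewrite big_seq_fset0 mulr1 => <-//.
  by congr m; apply/funext => w; rewrite big_seq_fset0 mulr1.
move=> J A hJ; rewrite key//; have := key fset0 (fun=> setT).
rewrite big_seq_fset0 mulr1 => <-//; congr (m _ * _).
by apply/funext => w; rewrite big_seq_fset0 mulr1.
Qed.

(** Induction on the first remaining step. Since [m] is only finitely additive, the step is split
    over a finite set [J] of values, and what happens outside [J] costs at most [M] times the
    missing mass of [mu]. *)
Lemma mean_walk k i c psi : independent_of_steps c i ->
  (forall w, 0 <= c w <= 1) -> bdd_fun psi ->
  m (fun w => c w * psi (walk_from i k w)) = m c * iter k markov_op psi 1%g.
Proof.
elim: k i c psi => [|k ih] i c psi ind c01 bpsi.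
  rewrite [RHS]mulrC -meanZ//; last by apply: (@bdd_fun_itv _ _ _ 1).
  by congr m; apply/funext => w; rewrite mulrC.
have [M hM] := bpsi.
have M0 : 0 <= M by exact: le_trans (hM 1%g).
have bc : bdd_fun c by apply: (@bdd_fun_itv _ _ _ 1).
have bs g : bdd_fun (fun w => (s i w == g)%:R : R).
  by apply: (@bdd_fun_itv _ _ _ 1) => w; case: eqP => _; rewrite ?lexx ?ler01.
pose q g := iter k markov_op psi g.
have bq : bdd_fun q.
  by exists M => g; apply: (mean_abs_le (mean_iter_markov k g)).
have mE := mean_expect prob_mass_ge0 prob_mass_has_sum.
pose F w := c w * psi (walk_from i k.+1 w).
have bF : bdd_fun F by apply: bdd_funM => //; exact: bdd_fun_comp.
have qE g : iter k markov_op (fun x => psi (g * x)%g) 1%g = q g.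
  by rewrite iter_markov_shift mulg1.
apply: (@has_sum_unique _ _ (fun g => m c * (mu g * q g))); last first.
  rewrite (_ : iter _ _ _ _ = expect mu q); last first.
    by rewrite /= {1}/markov_op; congr (expect mu); apply/funext => g; rewrite mul1g.
  by apply: has_sumZ; apply: expect_has_sum prob_mass_ge0 prob_mass_has_sum _ _.
apply/has_sumP => e e0.
have e1 : 0 < e / (M + 1) by rewrite divr_gt0// ltr_wpDl.
have /has_sumP/(_ _ e1)[J0 hJ] := prob_mass_has_sum.
exists J0 => J /hJ{}hJ.
pose chi w := \sum_(g <- J) (s i w == g)%:R : R.
have chiE w : chi w = (s i w \in J)%:R.
  rewrite /chi; case: (boolP (s i w \in J)) => wJ.
    rewrite (big_fsetD1 _ wJ)/= eqxx big1_fset ?addr0// => g.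
    by rewrite !inE eq_sym => /andP[/negPf->].
  rewrite big_seq big1// => g gJ.
  by case: eqP => // gE; move: wJ; rewrite gE gJ.
have bchi : bdd_fun chi by exact: bdd_fun_sum.
(* On the event that step [i] is [g], the induction hypothesis is applied to [psi] translated by
   [g]. *)
have -> : fsum (fun g => m c * (mu g * q g)) J = m (fun w => F w * chi w).
  rewrite /fsum /chi; under [in RHS]eq_fun do rewrite mulr_sumr.
  rewrite mean_sum//; last by move=> g; apply: bdd_funM.
  apply: eq_bigr => g _; have [mcg indg] := independent_step g ind.
  rewrite mulrA -mcg -qE -(ih _ _ _ indg); first last.
  - exact: bdd_fun_comp.
  - by move=> w; case: eqP => _; rewrite ?mulr1 ?mulr0 ?lexx ?ler01 ?c01.
  congr m; apply/funext => w; rewrite /F /=.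
  by case: eqP => [->|_]; rewrite ?mulr0 ?mul0r// !mulr1.
rewrite -meanB//; last exact: bdd_funM.
apply: (@le_lt_trans _ _ (M * (1 - fsum mu J))).
  have -> : fsum mu J = m chi.
    by rewrite mean_sum//; apply: eq_bigr => g _; rewrite mean_step.
  rewrite -[X in X - m chi](mean_1 mm) -meanB//; last exact: bdd_fun_cst.
  have bd : bdd_fun (fun w => 1 - chi w) by apply: bdd_funB => //; exact: bdd_fun_cst.
  rewrite -meanZ//.
  apply: le_trans (mean_abs mm _) _; first by apply: bdd_funB => //; exact: bdd_funM.
  apply: mean_le => //; [by apply: bdd_fun_norm; apply: bdd_funB => //; exact: bdd_funM
    |exact: bdd_funZ|] => w.
  rewrite (_ : F w - F w * chi w = F w * (1 - chi w)); last by rewrite mulrBr mulr1.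
  rewrite normrM chiE; case: (_ \in J).
    by rewrite subrr normr0 !mulr0.
  rewrite subr0 normr1 !mulr1 /F normrM.
  have /andP[c0 c1] := c01 w; rewrite (ger0_norm c0).
  by rewrite (le_trans (ler_piMl (normr_ge0 _) c1)).
apply: (@le_lt_trans _ _ (M * (e / (M + 1)))).
  by rewrite ler_wpM2l// ltW// (le_lt_trans (ler_norm _)).
rewrite mulrC -mulrA gtr_pMr// mulrC ltr_pdivrMr ?mul1r ?ltrDl//.
by rewrite ltr_wpDl.
Qed.

Lemma mean_walk1 k psi : bdd_fun psi ->
  m (fun w => psi (walk s k w)) = iter k markov_op psi 1%g.
Proof.
move=> bpsi; rewrite -[RHS]mul1r -(mean_1 mm) -(@mean_walk k 0 (fun=> 1))//.
- by congr m; apply/funext => w; rewrite walkE mul1r.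
- exact: iid_independent.
- by move=> w; rewrite ler01 lexx.
Qed.

Hypothesis cG : countable [set: G].

(** Countability of [G] enters here: the event is a countable union over the values of the walk one
    step earlier. *)
Lemma measurable_walk k A : measurable (walk s k @^-1` A).
Proof.
elim: k A => [|k ih] A.
  have [A1|A1] := pselect (A 1%g).
    by rewrite (_ : _ @^-1` _ = setT)//; apply/seteqP; split.
  by rewrite (_ : _ @^-1` _ = set0)//; apply/seteqP; split.
have [e eE] : exists e : nat -> G, forall g, exists n, e n = g.
  have /countable_injP[f finj] := cG.
  exists (fun n => xget 1%g [set g | f g = n]) => g; exists (f g).
  by apply: finj; rewrite ?inE//; apply: (@xgetPex _ 1%g [set x | f x = f g]); exists g.
rewrite (_ : _ @^-1` A = \bigcup_n ((walk s k @^-1` [set e n]) `&`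
    (s k @^-1` [set g | A (e n * g)%g]))).
  apply: bigcupT_measurable => n; apply: measurableI; first exact: ih.
  by case: iid => + _ _; apply.
apply/seteqP; split=> [w /= Aw|w [n _ [/= ->]]//].
by have [n en] := eE (walk s k w); exists n => //=; split; rewrite ?en.
Qed.

End Walk.

(** The bridge from almost sure convergence along paths to convergence of averages, by dominated
    convergence. *)
Lemma cvg_iter_markov d (Omega : measurableType d) (P : probability Omega R)
    (s : nat -> Omega -> G) (phi : G -> R) :
  countable [set: G] -> iid_steps mu P s -> bdd_fun phi ->
  {ae P, forall w, phi (walk s k w) @[k --> \oo] --> (0 : R)} ->
  iter k markov_op phi 1%g @[k --> \oo] --> (0 : R).
Proof.
move=> cG iid bphi aephi; have [M hM] := bphi.
have mphi k : measurable_fun setT (fun w => phi (walk s k w)).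
  by move=> _ B mB; rewrite setTI; exact: (measurable_walk iid cG k (phi @^-1` B)).
have bphik k : bdd_fun (fun w => phi (walk s k w)) by exact: bdd_fun_comp.
have [m mm hm] := integral_mean P.
have mP := integral_mean_represents hm.
under eq_fun do rewrite -(mean_walk1 iid mm mP)//.
exact: (@mean_dominated _ _ _ P m (fun k w => phi (walk s k w)) M).
Qed.

End ProbMass.

(** The sum counts the integers in [[1, x]], so it is the integer part of [x]. *)
Lemma layer_sum_bound (R : realType) n (x : R) : 0 <= x <= n%:R ->
  `|x - \sum_(j < n) (j.+1%:R <= x)%R%:R| <= 1.
Proof.
elim: n x => [|n ih] x /andP[x0 xn].
  by rewrite big_ord0 subr0 ger0_norm// (le_trans xn).
rewrite big_ord_recr/=; have [nx|nx] := leP n%:R x.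
  rewrite (eq_bigr (fun=> 1)); last first.
    by move=> i _; rewrite (le_trans _ nx)// ler_nat.
  rewrite sumr_const card_ord -mulr_natl mulr1.
  rewrite -(natr1 n) in xn *.
  by rewrite ler_norml; case: (lerP (n%:R + 1) x) => /= ?; lra.
have -> : (n.+1%:R <= x) = false by apply/negbTE; rewrite -ltNge (lt_trans nx)// ltr_nat.
rewrite addr0; apply: ih.
by rewrite x0 ltW.
Qed.

Section DisjointUnions.
Context (R : realType) (T : Type) (A : nat -> set T).
Hypothesis tA : trivIset setT A.

Lemma trivIset_indic_sum n x : \sum_(i < n) \1_(A i) x =
  \1_[set y | exists2 i, (i < n)%N & A i y] x :> R.
Proof.
elim: n => [|n ih].
  by rewrite big_ord0 indicE memNset// => -[].
rewrite big_ord_recr/= ih !indicE; have [Ax|Ax] := pselect (A n x).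
  have Bx : [set y | exists2 i, (i < n.+1)%N & A i y] x by exists n.
  have nBx : ~ [set y | exists2 i, (i < n)%N & A i y] x.
    move=> [i ilt Aix].
    have nE := tA Logic.I Logic.I (ex_intro _ x (conj Ax Aix)).
    by rewrite nE ltnn in ilt.
  by rewrite (mem_set Bx) (mem_set Ax) (memNset nBx) add0r.
rewrite (memNset Ax) addr0; congr (_%:R); congr nat_of_bool.
apply/idP/idP; rewrite !inE => -[i ilt Aix]; exists i => //; first exact: ltnW.
by move: ilt; rewrite ltnS leq_eqVlt => /orP[/eqP iE|//]; rewrite iE in Aix.
Qed.

Lemma trivIset_indic_sum_norm n x : `|\sum_(i < n) \1_(A i) x : R| <= 1.
Proof.
by rewrite trivIset_indic_sum indicE; case: (_ \in _); rewrite ?normr1 ?normr0.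
Qed.

Lemma trivIset_indic_cvg x :
  \sum_(i < n) \1_(A i) x @[n --> \oo] --> (\1_(\bigcup_n A n) x : R).
Proof.
rewrite indicE; have [[k _ Ak]|nA] := pselect ((\bigcup_n A n) x).
  rewrite mem_set; last by exists k.
  apply: cvg_near_cst; near=> n; rewrite trivIset_indic_sum indicE mem_set//.
  by exists k => //; near: n; exact: nbhs_infty_gt.
rewrite memNset//; apply: cvg_near_cst; apply: nearW => n.
by rewrite trivIset_indic_sum indicE memNset// => -[i _ Ai]; apply: nA; exists i.
Unshelve. all: by end_near. Qed.

End DisjointUnions.

(** * Induction on bounded measurable functions *)

Section SimpleApproximation.
Context (R : realType) d (Y : measurableType d).

Lemma measurable_indicator (A : set Y) : measurable A ->
  measurable_fun setT (\1_A : Y -> R).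
Proof. by move=> mA; apply: measurable_indic. Qed.

Lemma bdd_measurable_ind (Q : (Y -> R) -> Prop) :
  (forall A, measurable A -> Q \1_A) ->
  (forall c f g, measurable_fun setT f -> bdd_fun f -> Q f ->
    measurable_fun setT g -> bdd_fun g -> Q g -> Q (fun y => c * f y + g y)) ->
  (forall f, measurable_fun setT f -> bdd_fun f ->
    (forall e, 0 < e -> exists g, [/\ measurable_fun setT g, bdd_fun g, Q g
       & forall y, `|f y - g y| <= e]) -> Q f) ->
  forall f, measurable_fun setT f -> bdd_fun f -> Q f.
Proof.
move=> Qind Qlin Qlim f mf bf; apply: Qlim => // e e0.
have [M hM] := bf.
have M0 : 0 < `|M| + 1 by rewrite ltr_wpDl.
have fM y : `|f y| <= `|M| + 1.
  by rewrite (le_trans (hM y))// (le_trans (ler_norm M))// lerDl.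
set K := `|M| + 1 in M0 fM.
pose n := (Num.truncn (2 * K / e)).+1.
have nlt : 2 * K / e < n%:R by rewrite /n; exact: truncnS_gt.
have n0 : (0 : R) < n%:R by rewrite ltr0n.
(* [f + K] takes its values in [[0, 2 * K]], which is cut into [n] layers of height [c <= e]. The
   function [g n] below adds up the indicators of the layers reached and subtracts [K] again. *)
pose c := 2 * K / n%:R.
have c0 : 0 < c by rewrite !(divr_gt0, mulr_gt0).
have ce : c <= e.
  by rewrite /c ler_pdivrMr// [leRHS]mulrC -ler_pdivrMr//; exact: ltW.
pose A j := [set y | j.+1%:R <= (f y + K) / c].
have mA j : measurable (A j).
  rewrite (_ : A j = f @^-1` `[j.+1%:R * c - K, +oo[).
    by rewrite -[X in measurable X]setTI; apply: mf => //; exact: measurable_itv.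
  by apply/seteqP; split => y; rewrite /A /= in_itv/= andbT ler_pdivlMr// lerBlDr.
pose g r y := c * (\sum_(j < r) \1_(A j) y) + (- K) * \1_[set: Y] y : R.
have QT k : Q (fun y => k * \1_[set: Y] y).
  have -> : (fun y => k * \1_[set: Y] y) =
      (fun y => (k - 1) * \1_[set: Y] y + \1_[set: Y] y) :> (Y -> R).
    by apply/funext => y; ring.
  by apply: Qlin; first [exact: measurable_indicator|exact: bdd_indic|exact: Qind].
have Qg r : [/\ measurable_fun setT (g r), bdd_fun (g r) & Q (g r)].
  elim: r => [|r [mg bg qg]].
    rewrite /g (_ : (fun y => _) = fun y => (- K) * \1_[set: Y] y).
      split; [by apply: measurable_funM; [exact: measurable_cst|exact: measurable_indicator]|exact/bdd_funZ/bdd_indic|exact: QT].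
    by apply/funext => y; rewrite big_ord0 mulr0 add0r.
  have -> : g r.+1 = (fun y => c * \1_(A r) y + g r y).
    by apply/funext => y; rewrite /g big_ord_recr/=; ring.
  split.
  - apply: measurable_funD; last exact: mg.
    by apply: measurable_funM; [exact: measurable_cst|exact: measurable_indicator (mA r)].
  - by apply: bdd_fun_lin => //; exact: bdd_indic.
  - by apply: Qlin => //; first [exact: measurable_indicator (mA r)|exact: bdd_indic|exact: Qind (mA r)].
have [mg bg qg] := Qg n.
exists (g n); split => // y.
have -> : f y - g n y =
    c * ((f y + K) / c - \sum_(j < n) (j.+1%:R <= (f y + K) / c)%R%:R).
  rewrite /g indicE in_setT mulr1 mulrBr mulrCA divff ?gt_eqF// mulr1.
  rewrite opprD opprK addrA addrAC; congr (_ - _ * _).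
  by apply: eq_bigr => j _; rewrite indicE; congr (_%:R); congr nat_of_bool;
    apply/idP/idP; rewrite inE.
rewrite normrM gtr0_norm//; apply: le_trans ce; apply: ler_piMr; first exact: ltW.
apply: layer_sum_bound; have := fM y; rewrite ler_norml => /andP[h1 h2].
rewrite (divr_ge0 _ (ltW c0))/=; last lra.
rewrite ler_pdivrMr// /c mulrCA mulfV ?gt_eqF// mulr1; lra.
Qed.

Lemma mean_eq_measurable (m m' : (Y -> R) -> R) : mean m -> mean m' ->
  (forall A, measurable A -> m \1_A = m' \1_A) ->
  forall f, measurable_fun setT f -> bdd_fun f -> m f = m' f.
Proof.
move=> mm mm' mE; apply: bdd_measurable_ind => //.
  by move=> c f g _ bf ef _ bg eg; rewrite !mean_lin// ef eg.
move=> f _ bf happ; apply/eqP; rewrite -subr_eq0 -normr_le0.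
apply/ler_addgt0Pr => e e0; rewrite add0r.
have [|g [_ bg eg hg]] := happ (e / 2); first exact: divr_gt0.
have h n : mean n -> `|n f - n g| <= e / 2.
  by move=> mn; rewrite -meanB//; exact: mean_abs_le.
have h1 := h m mm; have h2 := h m' mm'; rewrite -eg in h2.
have := ler_normB (m f - m g) (m' f - m g).
rewrite opprB addrA subrK => /le_trans; apply.
by rewrite [leRHS](splitr e) lerD.
Qed.

End SimpleApproximation.

(** * Borel sets and their approximation by continuous functions *)

Section BorelFunctions.
Context (R : realType).

Lemma open_measurable_borel (K : ptopologicalType) (U : set K) : open U ->
  measurable (U : set (borel K)).
Proof. by move=> oU; apply: sub_sigma_algebra. Qed.

Lemma continuous_measurable_borel (K : ptopologicalType) (f : K -> R) :
  continuous f -> measurable_fun [set: borel K] (f : borel K -> R).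
Proof.
move=> cf; apply: (measurability _ (RGenOpens.measurableE R)).
move=> _ [_ [a [b ->] <-]]; rewrite setTI; apply: open_measurable_borel.
by apply: open_comp; [move=> x _; exact: cf|exact: interval_open].
Qed.

Lemma borel_ind (K : ptopologicalType) (Q : set K -> Prop) :
  (forall U, open U -> Q U) ->
  (forall A, measurable (A : set (borel K)) -> Q A -> Q (~` A)) ->
  (forall A : nat -> set K, (forall n, measurable (A n : set (borel K))) ->
    trivIset setT A -> (forall n, Q (A n)) -> Q (\bigcup_n A n)) ->
  forall A, measurable (A : set (borel K)) -> Q A.
Proof.
move=> Qo QC QU A mA.
apply: (@dynkin_induction _ (borel K) (@open K) Q) => //.
  by move=> U V; exact: openI.
by apply: Qo; exact: openT.
Qed.

(** With [f] the distance to the complement, take [min 1 (n * f)]: openness of [U] makes [f]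
    positive on [U], and [f] vanishes off it. *)
Lemma metrizable_open_approx (X : topologicalType) (U : set X) :
  metrizable R X -> open U -> exists F : nat -> X -> R,
  [/\ forall n, continuous (F n), forall n x, 0 <= F n x <= 1
    & forall x, F n x @[n --> \oo] --> (\1_U x : R)].
Proof.
move=> [dist [d0 dsep dsym dtri dnbhs]] oU.
(* The full space is set apart because the distance to an empty complement is an infimum over the
   empty set. *)
have [[c Uc]|UT] := pselect (exists c, ~ U c); last first.
  exists (fun _ _ => 1); split => [n|n x|x]; first exact: cst_continuous.
    by rewrite ler01 lexx.
  rewrite indicE mem_set; first exact: cvg_cst.
  by apply: contrapT => nU; apply: UT; exists x.
pose D x := [set dist x c | c in ~` U].
have hD x : has_inf (D x).
  split; first by exists (dist x c), c.
  by exists 0 => _ [y _ <-].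
pose f x := inf (D x).
have f0 x : 0 <= f x by apply: lb_le_inf; [exact: (hD x).1|move=> _ [y _ <-]].
have fle x y : ~ U y -> f x <= dist x y.
  by move=> Uy; apply: ge_inf; [exact: (hD x).2|exists y].
have flip x y : f x <= dist x y + f y.
  rewrite -lerBlDl; apply: lb_le_inf; first exact: (hD y).1.
  move=> _ [z Uz <-]; rewrite lerBlDl; apply: le_trans (dtri x y z).
  exact: fle.
have cf : continuous f.
  move=> x; apply/cvgrPdist_lt => e e0.
  rewrite near_simpl; apply/dnbhs; exists e => // y /= xy.
  rewrite (le_lt_trans _ xy)// ler_norml.
  have h1 := flip x y; have h2 := flip y x; rewrite (dsym y x) in h2.
  by apply/andP; split; lra.
have fpos x : U x -> 0 < f x.
  move=> Ux; have : nbhs x U by apply: open_nbhs_nbhs.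
  move=> /dnbhs[e e0 he]; rewrite (lt_le_trans e0)//.
  apply: lb_le_inf; first exact: (hD x).1.
  by move=> _ [z Uz <-]; rewrite leNgt; apply/negP => /he.
have fzero x : ~ U x -> f x = 0.
  move=> Ux; apply/eqP; rewrite eq_le f0 andbT (le_trans (fle _ _ Ux))//.
  by rewrite (proj2 (dsep x x)).
exists (fun n x => Num.min 1 (n%:R * f x)); split.
- move=> n x; apply: (@continuous_min R X (fun=> 1) (fun x => n%:R * f x) x); first exact: cvg_cst.
  by apply: cvgM; [exact: cvg_cst|exact: cf].
- by move=> n x; rewrite ge_min lexx/= le_min ler01 mulr_ge0.
- move=> x; rewrite indicE; have [Ux|Ux] := pselect (U x).
    rewrite mem_set//; apply: cvg_near_cst.
    have fx := fpos x Ux.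
    near=> n; apply/min_idPl; rewrite -ler_pdivrMr//.
    by near: n; exact: nbhs_infty_ger.
  rewrite memNset//; apply: cvg_near_cst; apply: nearW => n.
  by rewrite fzero// mulr0; apply/min_idPr; rewrite ler01.
Unshelve. all: by end_near. Qed.

End BorelFunctions.

(** * Vanishing variance along a boundary *)

Section TranslateVariance.
Context (R : realType) (G : groupType) (mu : G -> R).
Context (T : Type) (act : G -> T -> T) (m : (T -> R) -> R).

Definition translate_variance f g := mvariance m (fun x => f (act g x)).

Lemma bdd_translate_variance f : mean m -> bdd_fun f -> bdd_fun (translate_variance f).
Proof.
move=> mm bf; have [M hM] := bdd_funX 2 bf; exists M => g.
have bg := bdd_fun_comp (act g) bf.
rewrite ger0_norm; last exact: (mvariance_ge0 mm bg).
apply: le_trans (mvariance_le m bg) _.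
by apply: le_trans (ler_norm _) _; apply: (mean_abs_le mm) => y.
Qed.

(** The expected variance of [f] under the mean translated by the walk at time [k]. Convergence of
    the translates to Dirac masses makes it tend to 0. *)
Definition variance_vanishes f :=
  iter k (markov_op mu) (translate_variance f) 1%g @[k --> \oo] --> (0 : R).

End TranslateVariance.

Section BoundaryVariance.
Context (R : realType) (G : groupType) (mu : G -> R).
Hypothesis mum : prob_mass mu.
Context d (Y : measurableType d) (act : G -> Y -> Y) (eta : probability Y R).
Hypotheses (actY : is_action act)
  (mact : forall g, measurable_fun [set: Y] (act g))
  (stat : stationary mu act eta).
Context (m : (Y -> R) -> R).
Hypotheses (mm : mean m) (hm : forall f, measurable_fun setT f -> bdd_fun f ->
    (\int[eta]_x (f x)%:E)%E = (m f)%:E).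

Let mu0 := prob_mass_ge0 mum.
Let mu1 := prob_mass_has_sum mum.
Let mE := mean_expect mu0 mu1.

Lemma measurable_act f g : measurable_fun setT f ->
  measurable_fun setT (fun y => f (act g y) : R).
Proof. by move=> mf; apply: (measurableT_comp mf (mact g)). Qed.

(** Both sides are means in [f], so the setwise definition of stationarity, which is the case of
    indicators, determines them on bounded measurable functions. *)
Lemma stationary_mean f : measurable_fun setT f -> bdd_fun f ->
  expect mu (fun g => m (fun y => f (act g y))) = m f.
Proof.
have bexp h : bdd_fun h -> bdd_fun (fun g => m (fun y => h (act g y))).
  exact: bdd_mean_comp.
apply: (@mean_eq_measurable _ _ _
  (fun f => expect mu (fun g => m (fun y => f (act g y))))) => //.
- split => [c f' f'' bf' bf''|f' bf' f0|].
  + rewrite -(mean_lin mE c (bexp _ bf') (bexp _ bf'')); congr (expect mu); apply/funext => g.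
    by rewrite (mean_lin mm)//; exact: bdd_fun_comp.
  + apply: (mean_ge0 mE); first exact: bexp.
    by move=> g; apply: (mean_ge0 mm) => //; exact: bdd_fun_comp.
  + by rewrite -[RHS](mean_1 mE); congr (expect mu); apply/funext => g; exact: mean_1.
- move=> A mA; have := stat mA.
  have mAg g : measurable (act g @^-1` A) by rewrite -[X in measurable X]setTI; exact: mact.
  have mP := integral_mean_represents hm.
  have pE g : (fun y => \1_A (act g y)) = \1_(act g @^-1` A) :> (Y -> R) by [].
  rewrite mP// => statA; apply: (@EFin_inj R); rewrite -statA -(expect_esum mu0 mu1)//.
  + apply: eq_esum => g _; congr (_ * _)%E; rewrite /pushforward pE.
    by rewrite -mP.
  + by move=> g; apply: (mean_ge0 mm) => [|y]; [exact/bdd_fun_comp/bdd_indic|rewrite indicE].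
  + exact/bexp/bdd_indic.
Qed.

Lemma stationary_harmonic f h : measurable_fun setT f -> bdd_fun f ->
  markov_op mu (fun g => m (fun y => f (act g y))) h = m (fun y => f (act h y)).
Proof.
move=> mf bf; rewrite /markov_op.
rewrite -(@stationary_mean (fun y => f (act h y))).
- congr (expect mu); apply/funext => g; congr m; apply/funext => y.
  by rewrite (proj2 actY).
- exact: measurable_act.
- exact: bdd_fun_comp.
Qed.

Let V k f := iter k (markov_op mu) (translate_variance act m f) 1%g.

Let mV k := mean_iter_markov mum k 1%g.

Let bact (f : Y -> R) g : bdd_fun f -> bdd_fun (fun y => f (act g y)).
Proof. exact: bdd_fun_comp. Qed.

Let V_ge0 k f : bdd_fun f -> 0 <= V k f.
Proof.
move=> bf; apply: (mean_ge0 (mV k)); first exact: bdd_translate_variance.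
by move=> g; apply: mvariance_ge0 => //; exact: bact.
Qed.

(** A variance is at most a second moment, and the translated second moments form a harmonic
    function by stationarity. This makes the bound independent of [k], which is the reason why
    approximations survive the limit. *)
Let V_le k f : measurable_fun setT f -> bdd_fun f ->
  V k f <= m (fun y => f y ^+ 2).
Proof.
move=> mf bf.
have mf2 : measurable_fun setT (fun y => f y ^+ 2) by exact: measurable_funX.
have bf2 := bdd_funX 2 bf.
apply: (@le_trans _ _ (iter k (markov_op mu)
    (fun g => m (fun y => f (act g y) ^+ 2)) 1%g)).
  apply: (mean_le (mV k)); first exact: bdd_translate_variance.
    exact: (bdd_mean_comp act mm bf2).
  by move=> g; apply: (mvariance_le m); exact: bact.
rewrite iter_markov_harmonic => [|h]; last exact: (stationary_harmonic h mf2 bf2).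
by under eq_fun do rewrite (proj1 actY).
Qed.

Let VD k f g : bdd_fun f -> bdd_fun g ->
  V k (fun y => f y + g y) <= 2 * V k f + 2 * V k g.
Proof.
move=> bf bg; have b h : bdd_fun h -> bdd_fun (fun x => 2 * translate_variance act m h x).
  by move=> ?; apply: bdd_funZ; exact: bdd_translate_variance.
rewrite -(meanZ (mV k) 2 (bdd_translate_variance act mm bf)).
rewrite -(meanZ (mV k) 2 (bdd_translate_variance act mm bg)) -(meanD (mV k) (b _ bf) (b _ bg)).
apply: (mean_le (mV k)).
- by apply: bdd_translate_variance => //; exact: bdd_funD.
- by apply: bdd_funD; exact: b.
- by move=> h; apply: mvarianceD => //; exact: bact.
Qed.

Lemma variance_vanishes_lin c f g : bdd_fun f -> bdd_fun g ->
  variance_vanishes mu act m f -> variance_vanishes mu act m g ->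
  variance_vanishes mu act m (fun y => c * f y + g y).
Proof.
move=> bf bg vf vg.
have vcf : variance_vanishes mu act m (fun y => c * f y).
  have h k : c ^+ 2 * V k f = V k (fun y => c * f y).
    rewrite -(meanZ (mV k) _ (bdd_translate_variance act mm bf)); congr (iter k _ _ _).
    by apply/funext => h; rewrite /translate_variance mvariance_scale//; exact: bact.
  rewrite /variance_vanishes -[X in _ --> X](mulr0 (c ^+ 2)).
  rewrite (_ : (fun k => _) = (fun k => c ^+ 2 * V k f)); last first.
    by apply/funext => k; rewrite h.
  by apply: cvgM => //; exact: cvg_cst.
apply: (@squeeze_cvgr _ _ _ _ (fun=> 0) (fun k => 2 * V k (fun y => c * f y) + 2 * V k g)).
- apply: nearW => k; apply/andP; split; first exact/V_ge0/bdd_fun_lin.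
  exact: VD (bdd_funZ c bf) bg.
- exact: cvg_cst.
- rewrite -[X in _ --> X](_ : 2 * 0 + 2 * 0 = 0 :> R); last by rewrite !mulr0 addr0.
  by apply: cvgD; apply: cvgM => //; exact: cvg_cst.
Qed.

(** By [V_le] the error [f - g] contributes at most its second moment at every time, so the property
    is closed under approximation in quadratic mean. *)
Lemma variance_vanishes_approx f : measurable_fun setT f -> bdd_fun f ->
  (forall e, 0 < e -> exists g, [/\ measurable_fun setT g, bdd_fun g,
     variance_vanishes mu act m g & m (fun y => (f y - g y) ^+ 2) <= e]) ->
  variance_vanishes mu act m f.
Proof.
move=> mf bf happ; apply/cvgrPdist_lt => e e0.
(* Two errors of size [e / 4], each doubled by [VD]. *)
have [|g [mg bg vg hg]] := happ (e / 4); first exact: divr_gt0.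
have e4 : 0 < e / 4 by rewrite divr_gt0.
have /cvgrPdist_lt/(_ _ e4) := vg; apply: filterS => k.
rewrite !sub0r !normrN -/(V k g) -/(V k f) !ger0_norm; try exact: V_ge0.
move=> hk.
have := @VD k g (fun y => f y - g y) bg (bdd_funB bf bg).
have := @V_le k (fun y => f y - g y) (measurable_funB mf mg) (bdd_funB bf bg).
rewrite (_ : (fun y => g y + (f y - g y)) = f); first lra.
by apply/funext => y; rewrite addrC subrK.
Qed.

Lemma variance_vanishes_limit (F : nat -> Y -> R) (f : Y -> R) (M : R) :
  measurable_fun setT f -> (forall n, measurable_fun setT (F n)) ->
  (forall y, `|f y| <= M) -> (forall n y, `|F n y| <= M) ->
  {ae eta, forall y, F n y @[n --> \oo] --> (f y : R)} ->
  (forall n, variance_vanishes mu act m (F n)) -> variance_vanishes mu act m f.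
Proof.
move=> mf mF fM FM cF vF.
have bf : bdd_fun f by exists M.
have bF n : bdd_fun (F n) by exists M.
apply: variance_vanishes_approx => // e e0.
have mD n : measurable_fun setT (fun y => (f y - F n y) ^+ 2).
  by apply: measurable_funX; exact: measurable_funB.
have := @mean_dominated _ _ _ eta m (fun n y => (f y - F n y) ^+ 2)
  ((2 * M) ^+ 2) hm mD.
have D2 n y : `|(f y - F n y) ^+ 2| <= (2 * M) ^+ 2.
  rewrite normrX lerXn2r ?nnegrE//.
    by rewrite mulr_ge0//; exact: le_trans (fM y).
  rewrite (le_trans (ler_normB _ _))//.
  by have := fM y; have := FM n y; lra.
move=> /(_ D2) h.
have {}h : m (fun y => (f y - F n y) ^+ 2) @[n --> \oo] --> (0 : R).
  apply: h; apply: filterS cF => y hy.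
  have h0 : f y - F n y @[n --> \oo] --> (0 : R).
    by rewrite -(subrr (f y)); apply: cvgB => //; exact: cvg_cst.
  by under eq_fun do rewrite expr2; have := cvgM h0 h0; rewrite mulr0; apply.
have /cvgrPdist_lt/(_ _ e0)[n _ /(_ n (leqnn n))] := h.
rewrite sub0r normrN => hn.
by exists (F n); split => //; rewrite (le_trans (ler_norm _))// ltW.
Qed.

(** Open sets of [X] are bounded limits of continuous functions, Borel sets follow by complements
    and disjoint unions, and a measurable set of [Y] agrees almost everywhere with the preimage
    under [phi] of a Borel set of [X]. *)
Lemma variance_vanishes_metrizable (X : ptopologicalType) (phi : Y -> X)
    (psi : X -> Y) :
  metrizable R X ->
  measurable_fun [set: Y] (phi : Y -> borel X) ->
  measurable_fun [set: borel X] (psi : borel X -> Y) ->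
  {ae eta, forall y, psi (phi y) = y} ->
  (forall F : X -> R, continuous F -> (forall x, 0 <= F x <= 1) ->
     variance_vanishes mu act m (fun y => F (phi y))) ->
  forall f, measurable_fun setT f -> bdd_fun f -> variance_vanishes mu act m f.
Proof.
move=> metX mphi mpsi psiphi vC.
have mcomp (F : X -> R) : measurable_fun [set: borel X] (F : borel X -> R) ->
    measurable_fun setT (fun y => F (phi y)).
  by move=> mF; exact: (measurableT_comp mF mphi).
have vB (B : set X) : measurable (B : set (borel X)) ->
    variance_vanishes mu act m (fun y => \1_B (phi y)).
  move: B; apply: borel_ind.
  - move=> U oU; have [F [cF F01 FU]] := metrizable_open_approx metX oU.
    apply: (@variance_vanishes_limit (fun n y => F n (phi y)) _ 1).
    + by apply: (mcomp \1_U); apply: (@measurable_indicator R _ (borel X));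
        exact: open_measurable_borel.
    + by move=> n; apply: (mcomp (F n)); exact: continuous_measurable_borel.
    + by move=> y; rewrite indicE; case: (_ \in _); rewrite ?normr1 ?normr0.
    + by move=> n y; have /andP[? ?] := F01 n (phi y); rewrite ger0_norm.
    + by apply: aeW => y; exact: FU.
    + by move=> n; exact: vC.
  - move=> A mA vA.
    have -> : (fun y => \1_(~` A) (phi y)) =
        (fun y => (-1) * \1_A (phi y) + 1) :> (Y -> R).
      by apply/funext => y; rewrite !indicE in_setC; case: (_ \in A) => /=; lra.
    apply: variance_vanishes_lin => //; last first.
      apply: (vC (fun=> 1)) => [|x]; first exact: cst_continuous.
      by rewrite ler01 lexx.
    + exact: bdd_fun_cst.
    + exact/bdd_fun_comp/bdd_indic.
  - move=> A mA tA vA.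
    have mind (C : set X) : measurable (C : set (borel X)) ->
        measurable_fun setT (fun y => \1_C (phi y) : R).
      by move=> mC; apply: (mcomp \1_C); exact: (@measurable_indicator R _ (borel X)).
    apply: (@variance_vanishes_limit (fun n y => \sum_(i < n) \1_(A i) (phi y)) _ 1).
    + by apply: mind; exact: bigcupT_measurable.
    + by move=> n; apply: measurable_sum => i; exact: mind.
    + by move=> y; rewrite indicE; case: (_ \in _); rewrite ?normr1 ?normr0.
    + by move=> n y; exact: trivIset_indic_sum_norm.
    + by apply: aeW => y; exact: trivIset_indic_cvg.
    + elim=> [|n ih].
        rewrite (_ : (fun y => _) = (fun y => (-1) * \1_(A 0%N) (phi y) + \1_(A 0%N) (phi y))).
          by apply: variance_vanishes_lin => //; exact/bdd_fun_comp/bdd_indic.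
        by apply/funext => y; rewrite big_ord0 mulN1r addNr.
      rewrite (_ : (fun y => _) = (fun y => 1 * \1_(A n) (phi y) + \sum_(i < n) \1_(A i) (phi y))).
        apply: variance_vanishes_lin => //; first exact/bdd_fun_comp/bdd_indic.
        by exists 1 => y; exact: trivIset_indic_sum_norm.
      by apply/funext => y; rewrite big_ord_recr/= mul1r addrC.
apply: bdd_measurable_ind.
(* A constant sequence: its only purpose is to replace the indicator of [A] by an almost everywhere
   equal one that factors through [phi]. *)
- move=> A mA; apply: (@variance_vanishes_limit (fun _ y => \1_(psi @^-1` A) (phi y)) _ 1).
  + exact: measurable_indicator.
  + move=> _; apply: (mcomp \1_(psi @^-1` A)); apply: (@measurable_indicator R _ (borel X)).
    by rewrite -[X in measurable X]setTI; exact: mpsi.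
  + by move=> y; rewrite indicE; case: (_ \in _); rewrite ?normr1 ?normr0.
  + by move=> _ y; rewrite indicE; case: (_ \in _); rewrite ?normr1 ?normr0.
  + apply: filterS psiphi => y py; rewrite (_ : \1_A y = \1_(psi @^-1` A) (phi y)).
      exact: cvg_cst.
    by rewrite !indicE; congr (_%:R); congr nat_of_bool; apply/idP/idP; rewrite !inE /= py.
  + by move=> _; apply: vB; rewrite -[X in measurable X]setTI; exact: mpsi.
- by move=> c f g _ bf vf _ bg vg; exact: variance_vanishes_lin.
- move=> f mf bf happ; apply: variance_vanishes_approx => // e e0.
  (* An error below both [1] and [e] has its square below [e]. *)
  have [|g [mg bg vg hg]] := happ (Num.min 1 e); first by rewrite lt_min ltr01.
  exists g; split => //; apply: le_trans (ler_norm _) _.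
  apply: (mean_abs_le mm) => y; rewrite normrX.
  have := hg y; rewrite le_min => /andP[h1 h2].
  by rewrite expr2 (le_trans _ h2)// ler_piMr.
Unshelve. all: by end_near. Qed.

End BoundaryVariance.

(** * Riesz representation of means *)

Section CompactFunctions.
Context (R : realType) (K : ptopologicalType).
Hypotheses (cK : compact [set: K]) (hK : hausdorff_space K).

Lemma continuous_bdd (f : K -> R) : continuous f -> bdd_fun f.
Proof.
move=> cf.
have /compact_bounded[M [_ hM]] : compact (f @` [set: K]).
  by apply: continuous_compact => //; apply: continuous_subspaceT.
exists (M + 1) => x; apply: (hM (M + 1)); first by rewrite ltrDl.
by exists x.
Qed.

Lemma separating_function (U : set K) x : open U -> U x -> exists u : K -> R,
  [/\ continuous u, forall y, 0 <= u y <= \1_U y & u x = 1].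
Proof.
move=> oU Ux.
have sep : uniform_separator (~` U) [set x].
  have /(@normal_separatorP R) : normal_space K by exact: compact_normal.
  apply.
  - exact: open_closedC.
  - exact: compact_closed (@compact_set1 _ x).
  - by apply/seteqP; split => // y [nU /= yx]; apply: nU; rewrite yx.
exists (Urysohn (R := R) (~` U) [set x]); split.
- exact: Urysohn_continuous.
- move=> y; have := @Urysohn_range K R (~` U) [set x] _ (imageP _ (Logic.I : setT y)).
  rewrite /= in_itv/= => /andP[-> u1]; rewrite indicE.
  have [Uy|Uy] := pselect (U y); first by rewrite mem_set.
  have -> : Urysohn (R := R) (~` U) [set x] y = 0 by apply: (Urysohn_sub0 sep); exists y.
  by rewrite memNset//= lexx.
- by apply: (Urysohn_sub1 sep); exists x.
Qed.

Lemma continuous_maxr (f g : K -> R) : continuous f -> continuous g ->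
  continuous (fun x => Num.max (f x) (g x)).
Proof. by move=> cf cg x; exact: (continuous_max (cf x) (cg x)). Qed.

Lemma continuous_minr (f g : K -> R) : continuous f -> continuous g ->
  continuous (fun x => Num.min (f x) (g x)).
Proof. by move=> cf cg x; exact: (continuous_min (cf x) (cg x)). Qed.

Lemma continuous_fsum (J : Type) (r : seq J) (f : J -> K -> R) :
  (forall j, continuous (f j)) -> continuous (fun x => \sum_(j <- r) f j x).
Proof.
move=> cf; elim: r => [|j r ih] x.
  rewrite (_ : (fun x => _) = fun=> 0); first exact: cvg_cst.
  by apply/funext => y; rewrite big_nil.
rewrite (_ : (fun x => _) = (fun x => f j x + \sum_(j <- r) f j x)).
  by apply: cvgD; [exact: cf|exact: ih].
by apply/funext => y; rewrite big_cons.
Qed.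

Lemma closed_superlevel (f : K -> R) e : continuous f -> closed [set x | e <= f x].
Proof.
move=> cf; apply: (@preimage_closed _ _ f [set y | e <= y]) => [x _|].
  exact: cf.
exact: closed_ge.
Qed.

Lemma compact_superlevel (f : K -> R) e : continuous f ->
  compact [set x | e <= f x].
Proof.
by move=> cf; apply: (subclosed_compact _ cK) => //; exact: closed_superlevel.
Qed.

End CompactFunctions.

(** * Construction of the representing measure from its values on open sets *)

Section Riesz.
Context (R : realType) (K : ptopologicalType).
Hypotheses (cK : compact [set: K]) (hK : hausdorff_space K).
Context (I : (K -> R) -> R).
Hypothesis mI : mean I.
Implicit Types (U V : set K) (f g : K -> R).

(** Replaces the usual requirement of a compact support inside [U]. When compactness is wanted, it
    is recovered from a superlevel set by means of [shrink]. *)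
Definition below (U : set K) (f : K -> R) :=
  continuous f /\ forall x, 0 <= f x <= \1_U x.

Lemma below_bdd U f : below U f -> bdd_fun f.
Proof. by case=> cf _; exact: continuous_bdd. Qed.

Lemma below_le1 U f x : below U f -> f x <= 1.
Proof.
move=> [_ /(_ x)/andP[_ fU]]; apply: le_trans fU _.
by rewrite indicE; case: (_ \in _).
Qed.

Lemma below_eq0 U f x : below U f -> ~ U x -> f x = 0.
Proof.
move=> [_ /(_ x)]; rewrite indicE => + nU; rewrite memNset//= => f0.
by apply/eqP; rewrite eq_le andbC.
Qed.

Lemma belowP U f : continuous f -> (forall x, 0 <= f x <= 1) ->
  (forall x, ~ U x -> f x = 0) -> below U f.
Proof.
move=> cf f01 fU; split=> // x; have /andP[-> f1] := f01 x.
by rewrite indicE; have [Ux|Ux] := pselect (U x);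
  rewrite ?(mem_set Ux)// (memNset Ux) fU ?lexx.
Qed.

Lemma below0 U : below U (fun=> 0).
Proof.
by apply: belowP => //; [exact: cst_continuous|move=> x; rewrite lexx ler01].
Qed.

Definition open_content (U : set K) : R := sup [set I f | f in below U].

Lemma open_content_has_sup U : has_sup [set I f | f in below U].
Proof.
split; first by exists (I (fun=> 0)), (fun=> 0) => //; exact: below0.
exists 1 => _ [f fU <-]; rewrite -(mean_1 mI); apply: mean_le => //.
- exact: below_bdd fU.
- exact: bdd_fun_cst.
- by move=> x; exact: below_le1 fU.
Qed.

Lemma open_content_ub U f : below U f -> I f <= open_content U.
Proof.
by move=> fU; apply: (ub_le_sup (open_content_has_sup U).2); exists f.
Qed.

Lemma open_content_le U c : (forall f, below U f -> I f <= c) ->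
  open_content U <= c.
Proof.
move=> h; apply: ge_sup; first exact: (open_content_has_sup U).1.
by move=> _ [f fU <-]; exact: h.
Qed.

Lemma open_content_adherent U e : 0 < e ->
  exists2 f, below U f & open_content U - e < I f.
Proof.
move=> e0; have [_ [f fU <-] h] := sup_adherent e0 (open_content_has_sup U).
by exists f.
Qed.

Lemma open_content_ge0 U : 0 <= open_content U.
Proof. by rewrite -(mean0 mI); apply: open_content_ub; exact: below0. Qed.

Lemma le_open_content U V : U `<=` V -> open_content U <= open_content V.
Proof.
move=> UV; apply: open_content_le => f fU; apply: open_content_ub.
apply: belowP; first by case: fU.
- move=> x; rewrite (below_le1 x fU) andbT.
  by case: fU => _ /(_ x)/andP[].
- by move=> x Vx; apply: (below_eq0 fU) => /UV.
Qed.

Lemma open_content0 : open_content set0 = 0.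
Proof.
apply/eqP; rewrite eq_le open_content_ge0 andbT; apply: open_content_le => f f0.
rewrite (_ : f = fun=> 0) ?mean0//; apply/funext => x.
by apply: (below_eq0 f0); case.
Qed.

Lemma open_contentT : open_content setT = 1.
Proof.
apply/eqP; rewrite eq_le; apply/andP; split.
  apply: open_content_le => f fT; rewrite -(mean_1 mI); apply: mean_le => //.
  - exact: below_bdd fT.
  - exact: bdd_fun_cst.
  - by move=> x; exact: below_le1 fT.
rewrite -(mean_1 mI); apply: open_content_ub; apply: belowP => [||x []//]; first exact: cst_continuous.
by move=> x; rewrite ler01 lexx.
Qed.

(** Cutting off the bottom layer costs at most [e] in the mean and leaves a function that vanishes
    off the compact set where [f >= e]. *)
Definition shrink (e : R) (f : K -> R) x := Num.max 0 (f x - e).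

Lemma continuous_shrink e f : continuous f -> continuous (shrink e f).
Proof.
move=> cf; apply: continuous_maxr; first exact: cst_continuous.
by move=> x; apply: cvgB; [exact: cf|exact: cvg_cst].
Qed.

Lemma shrink_eq0 e f x : f x <= e -> shrink e f x = 0.
Proof. by move=> fe; apply/max_idPl; rewrite subr_le0. Qed.

Lemma shrink_bounds e f x : 0 <= e -> 0 <= f x -> 0 <= shrink e f x <= f x.
Proof. by move=> e0 f0; rewrite /shrink le_max lexx/= ge_max f0/=; lra. Qed.

Lemma mean_shrink e f : 0 <= e -> continuous f -> I f <= I (shrink e f) + e.
Proof.
move=> e0 cf; rewrite -{2}(mean_cst mI e) -meanD//; first last.
- exact: bdd_fun_cst.
- exact/continuous_bdd/continuous_shrink.
have bs := continuous_bdd cK (continuous_shrink (e := e) cf).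
apply: mean_le => //; first exact: continuous_bdd.
  by apply: bdd_funD => //; exact: bdd_fun_cst.
by move=> x; rewrite -lerBlDr /shrink le_max lexx orbT.
Qed.

(** A nearly optimal [f] below the union is shrunk, so that it lives on a compact set. Finitely many
    bumps, each below one [U n], cover this set and together dominate the shrunk function. One
    [e / 2] pays for optimality, the other for shrinking. *)
Lemma open_content_bigcup (U : nat -> set K) e : (forall n, open (U n)) ->
  0 < e -> exists N, open_content (\bigcup_n U n) <=
                     \sum_(i < N) open_content (U i) + e.
Proof.
move=> oU e0; have e2 : 0 < e / 2 by exact: divr_gt0.
have [f fU hf] := open_content_adherent (\bigcup_n U n) e2.
have [cf f01] := fU.
pose C := [set x | e / 2 <= f x].
have cC : compact C by exact: compact_superlevel.
have CU x : C x -> exists p : nat * (K -> R),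
    below (U p.1) p.2 /\ p.2 x = 1.
  move=> Cx; have [[n _ Unx]|nU] := pselect ((\bigcup_n U n) x).
    have [u [cu u01 ux]] := separating_function R cK hK (oU n) Unx.
    by exists (n, u); split.
  by move: Cx; rewrite /C /= (below_eq0 fU nU) leNgt e2.
have [p hp] : {p : K -> nat * (K -> R) & forall x, C x ->
    below (U (p x).1) (p x).2 /\ (p x).2 x = 1}.
  apply: (@choice _ _ (fun x q => C x -> below (U q.1) q.2 /\ q.2 x = 1)) => x.
  have [Cx|nCx] := pselect (C x); last by exists (0%N, fun=> 0).
  by have [q hq] := CU x Cx; exists q.
move: cC; rewrite compact_cover => /(_ K C (fun x => [set y | 1 / 2 < (p x).2 y])).
case=> [x Cx|x Cx|D DC CD].
- have [[cu _] _] := hp x Cx.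
  apply: (@open_comp _ _ (p x).2 [set y | 1 / 2 < y]) => [y _|]; first exact: cu.
  exact: open_gt.
- by exists x => //=; have [_ ->] := hp x Cx; lra.
pose N := (\max_(x : D) (p (val x)).1).+1.
have pN x : x \in D -> ((p x).1 < N)%N.
  by move=> xD; rewrite ltnS (@leq_bigmax _ (fun x : D => (p (val x)).1) [` xD]%fset).
(* Bumps are grouped by the open set that carries them. The factor 2 lifts values above [1 / 2] to
   values above 1, and the minimum brings the group back below the indicator of [U i]. *)
pose v i y := Num.min 1 (\sum_(x <- [fset x in D | (p x).1 == i]%fset) 2 * (p x).2 y).
have pU i x y : x \in [fset x in D | (p x).1 == i]%fset -> 0 <= (p x).2 y.
  rewrite !inE/= => /andP[xD _].
  by have [[_ /(_ y)/andP[]]] := hp x (set_mem (DC _ xD)).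
have vU i : below (U i) (v i).
  apply: belowP.
  - apply: continuous_minr; first exact: cst_continuous.
    rewrite (_ : (fun y => _) = (fun y => \sum_(x <- [fset x in D | (p x).1 == i]%fset)
      (if x \in D then 2 * (p x).2 y else 0))); last first.
      by apply/funext => y; apply: eq_big_seq => x; rewrite !inE/= => /andP[->].
    apply: continuous_fsum => x; case: (boolP (x \in D)) => xD y; last exact: cvg_cst.
    have [[cu _] _] := hp x (set_mem (DC _ xD)).
    by apply: cvgM; [exact: cvg_cst|exact: cu].
  - move=> y; rewrite le_min ler01 ge_min lexx/= andbT big_seq sumr_ge0// => x xi.
    by rewrite mulr_ge0//; exact: pU xi.
  - move=> y nU; rewrite /v big_seq big1 => [|x]; first by apply/min_idPr; exact: ler01.
    rewrite !inE/= => /andP[xD /eqP xi].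
    have [xU _] := hp x (set_mem (DC _ xD)).
    by rewrite (below_eq0 xU) ?mulr0// xi.
exists N.
have bv i : bdd_fun (v i) by exact: below_bdd (vU i).
have fv : I (shrink (e / 2) f) <= \sum_(i < N) I (v i).
  rewrite -mean_sum//; apply: mean_le => //.
  - exact/continuous_bdd/continuous_shrink.
  - exact: bdd_fun_sum.
  move=> y; have v0 i : 0 <= v i y by have [_ /(_ y)/andP[]] := vU i.
  have [fy|fy] := lerP (f y) (e / 2); first by rewrite shrink_eq0// sumr_ge0.
  have [x xD hx] := CD y (ltW fy).
  have vx1 : v (p x).1 y = 1.
    apply/min_idPl; rewrite (big_fsetD1 x)/=; last by rewrite !inE/= eqxx andbT.
    rewrite -[1]addr0 lerD//; first by move: hx => /=; lra.
    rewrite big_seq sumr_ge0// => z; rewrite in_fsetD1 => /andP[_ zi].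
    by rewrite mulr_ge0//; exact: pU zi.
  apply: (@le_trans _ _ 1).
    rewrite (le_trans _ (below_le1 y fU))//.
    by have /andP[] := @shrink_bounds (e / 2) f y (ltW e2) (proj1 (andP (f01 y))).
  rewrite -vx1 (bigD1 (Ordinal (pN x xD)))//= lerDl sumr_ge0//.
have := mean_shrink (ltW e2) cf.
have : \sum_(i < N) I (v i) <= \sum_(i < N) open_content (U i).
  by apply: ler_sum => i _; exact: open_content_ub.
by move: fv hf; lra.
Qed.

Definition outer_content (A : set K) : R :=
  inf [set open_content U | U in [set U | open U /\ A `<=` U]].

Lemma outer_content_has_inf A :
  has_inf [set open_content U | U in [set U | open U /\ A `<=` U]].
Proof.
split; first by exists (open_content setT), setT => //; split => //; exact: openT.
by exists 0 => _ [U _ <-]; exact: open_content_ge0.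
Qed.

Lemma outer_content_le A U : open U -> A `<=` U ->
  outer_content A <= open_content U.
Proof.
by move=> oU AU; apply: ge_inf; [exact: (outer_content_has_inf A).2|exists U].
Qed.

Lemma outer_content_ge A c :
  (forall U, open U -> A `<=` U -> c <= open_content U) -> c <= outer_content A.
Proof.
move=> h; apply: lb_le_inf; first exact: (outer_content_has_inf A).1.
by move=> _ [U [oU AU] <-]; exact: h.
Qed.

Lemma outer_content_adherent A e : 0 < e -> exists U,
  [/\ open U, A `<=` U & open_content U < outer_content A + e].
Proof.
move=> e0; have [_ [U [oU AU] <-] h] := inf_adherent e0 (outer_content_has_inf A).
by exists U.
Qed.

Lemma outer_content_open U : open U -> outer_content U = open_content U.
Proof.
move=> oU; apply/eqP; rewrite eq_le outer_content_le//=.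
by apply: outer_content_ge => V _; exact: le_open_content.
Qed.

Lemma outer_content_ge0 A : 0 <= outer_content A.
Proof. by apply: outer_content_ge => U _ _; exact: open_content_ge0. Qed.

Lemma le_outer_content A B : A `<=` B -> outer_content A <= outer_content B.
Proof.
move=> AB; apply: outer_content_ge => U oU BU; apply: outer_content_le => //.
exact: subset_trans BU.
Qed.

Definition riesz_outer (A : set K) : \bar R := (outer_content A)%:E.

Let riesz_outer0 : riesz_outer set0 = 0%E.
Proof.
by rewrite /riesz_outer outer_content_open ?open_content0//; exact: open0.
Qed.

Let riesz_outer_ge0 A : (0 <= riesz_outer A)%E.
Proof. by rewrite lee_fin outer_content_ge0. Qed.

Let le_riesz_outer : {homo riesz_outer : A B / A `<=` B >-> (A <= B)%E}.
Proof. by move=> A B AB; rewrite lee_fin le_outer_content. Qed.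

Let riesz_outer_subadditive : sigma_subadditive riesz_outer.
Proof.
move=> A; apply/lee_addgt0Pr => e e0.
have e2 : 0 < e / 2 by exact: divr_gt0.
have [U hU] : {U : nat -> set K & forall n, [/\ open (U n), A n `<=` U n
    & open_content (U n) < outer_content (A n) + e / 2 / (2 ^ n.+1)%:R]}.
  apply: (@choice _ _ (fun n U => [/\ open U, A n `<=` U
    & open_content U < outer_content (A n) + e / 2 / (2 ^ n.+1)%:R])) => n.
  by apply: outer_content_adherent; rewrite divr_gt0// ltr0n expn_gt0.
have oU n : open (U n) by have [] := hU n.
have [N hN] := open_content_bigcup oU e2.
have AU : \bigcup_n A n `<=` \bigcup_n U n.
  by move=> x [n _ Ax]; exists n => //; have [_ + _] := hU n; apply.
rewrite [in leRHS](splitr e) EFinD addeA.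
apply: le_trans (leeD2r _ (epsilon_trick _ _ _)) => //; last first.
  exact: ltW.
apply: (@le_trans _ _ (\sum_(0 <= i < N)
   (riesz_outer (A i) + (e / 2 / (2 ^ i.+1)%:R)%:E) + (e / 2)%:E)%E); last first.
  apply: leeD2r; apply: nneseries_lim_ge => i _ _.
  rewrite adde_ge0// lee_fin divr_ge0//; last exact: ltW.
under eq_bigr do rewrite -EFinD.
rewrite sumEFin -EFinD lee_fin.
apply: le_trans (outer_content_le (bigcup_open (fun i _ => oU i)) AU) _.
apply: le_trans hN _; rewrite lerD2r big_mkord; apply: ler_sum => i _.
by have [_ _ /ltW] := hU i.
Qed.

HB.instance Definition _ := isOuterMeasure.Build R K riesz_outer
  riesz_outer0 riesz_outer_ge0 le_riesz_outer riesz_outer_subadditive.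

(** The Caratheodory inequality for open sets. Take [f] nearly optimal below the intersection of [V]
    and [U], then [h] nearly optimal below the open set [W] where [f < e / 3], which contains [V]
    minus [U]. The shrunk [f] and [h] are never both non-zero, so their sum is still below [V]. The
    three thirds pay for [f], [h] and the shrinking. *)
Lemma open_content_split U V : open U -> open V ->
  open_content (V `&` U) + outer_content (V `&` ~` U) <= open_content V.
Proof.
move=> oU oV; apply/ler_addgt0Pr => e e0.
have e3 : 0 < e / 3 by exact: divr_gt0.
have [f fVU hf] := open_content_adherent (V `&` U) e3.
have [cf f01] := fVU.
pose W := V `&` [set x | f x < e / 3].
have oW : open W.
  apply: openI => //; apply: (@open_comp _ _ f [set y | y < e / 3]) => [x _|].
    exact: cf.
  exact: open_lt.
have VW : V `&` ~` U `<=` W.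
  move=> x [Vx nUx]; split => //=; rewrite (below_eq0 fVU)// => -[_ Ux].
  exact: nUx.
have [h hW hh] := open_content_adherent W e3.
have [ch h01] := hW.
have f0 x : 0 <= f x by have /andP[] := f01 x.
have h0 x : 0 <= h x by have /andP[] := h01 x.
have s01 x : 0 <= shrink (e / 3) f x <= f x by apply: (@shrink_bounds (e / 3) f x); [apply: ltW|apply: f0].
have gV : below V (fun x => shrink (e / 3) f x + h x).
  apply: belowP.
  - by move=> x; apply: cvgD; [exact: continuous_shrink|exact: ch].
  - move=> x; have /andP[s0 s1] := s01 x; rewrite addr_ge0//=.
    have [fx|fx] := ltP (f x) (e / 3).
      by rewrite (shrink_eq0 (ltW fx)) add0r (below_le1 x hW).
    rewrite (below_eq0 hW) ?addr0; last by move=> [_ /=]; rewrite ltNge fx.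
    exact: le_trans s1 (below_le1 x fVU).
  - move=> x nV; rewrite (below_eq0 hW) ?addr0; last by move=> [].
    have /andP[s0 s1] := s01 x; apply/eqP; rewrite eq_le s0 andbT.
    by rewrite (le_trans s1)// (below_eq0 fVU)// => -[].
have := open_content_ub gV; rewrite meanD//; first last.
- exact: below_bdd hW.
- exact/continuous_bdd/continuous_shrink.
have := mean_shrink (ltW e3) cf; have := outer_content_le oW VW.
by move: hf hh; lra.
Qed.

Lemma open_caratheodory U : open U -> riesz_outer.-caratheodory U.
Proof.
move=> oU; apply: le_caratheodory_measurable => X.
rewrite /riesz_outer -EFinD lee_fin; apply: outer_content_ge => V oV XV.
apply: le_trans (open_content_split oU oV).
rewrite lerD//; last by apply: le_outer_content => x [Xx Ux]; split => //; exact: XV.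
apply: outer_content_le; first exact: openI.
by move=> x [Xx Ux]; split => //; exact: XV.
Qed.

Lemma borel_caratheodory (A : set (borel K)) :
  measurable A -> riesz_outer.-caratheodory A.
Proof.
move: A; apply: smallest_sub; last by move=> U; exact: open_caratheodory.
split; first exact: caratheodory_measurable_set0.
- by move=> B mB; rewrite setTD; exact: caratheodory_measurable_setC.
- exact: caratheodory_measurable_bigcup.
Qed.

Definition riesz_measure : set (borel K) -> \bar R := riesz_outer.

Let riesz_measure_additive : semi_sigma_additive riesz_measure.
Proof.
move=> F mF tF mUF.
apply: (@caratheodory_measure_sigma_additive R K riesz_outer F) => //.
- by move=> i; apply: borel_caratheodory.
- exact: borel_caratheodory.
Qed.

HB.instance Definition _ := isMeasure.Build _ (borel K) R riesz_measure
  riesz_outer0 riesz_outer_ge0 riesz_measure_additive.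

Let riesz_measureT : riesz_measure setT = 1%E.
Proof.
by rewrite /riesz_measure /riesz_outer outer_content_open ?open_contentT//; exact: openT.
Qed.

HB.instance Definition _ :=
  Measure_isProbability.Build _ (borel K) R riesz_measure riesz_measureT.

(** Retains only the values on open sets: stationarity, the integral formula and the identification
    with the given measure all start from them. *)
Lemma riesz_open : exists P : probability (borel K) R,
  forall U, open U -> P U = (open_content U)%:E.
Proof.
exists (riesz_measure : probability (borel K) R) => U oU.
by rewrite /= /riesz_measure /riesz_outer outer_content_open.
Qed.

(** Slices of height 1 that depend continuously on [x], so that [I] can be evaluated on continuous
    slices of a function. *)
Lemma clamp_sum n (x : R) : 0 <= x <= n%:R ->
  x = \sum_(j < n) Num.min 1 (Num.max 0 (x - j%:R)).
Proof.
elim: n x => [|n ih] x /andP[x0 xn].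
  by apply/eqP; rewrite big_ord0 eq_le x0 andbT.
rewrite big_ord_recr/=; have [nx|nx] := leP n%:R x.
  rewrite (eq_bigr (fun=> 1)); last first.
    move=> i _; apply/min_idPl; rewrite le_max; apply/orP; right.
    by rewrite lerBrDr (le_trans _ nx)// addrC natr1 ler_nat.
  rewrite sumr_const card_ord -mulr_natl mulr1 -(natr1 n) in xn *.
  have /max_idPr -> : 0 <= x - n%:R by rewrite subr_ge0.
  have /min_idPr -> : x - n%:R <= 1 by lra.
  lra.
have /max_idPl -> : x - n%:R <= 0 by rewrite subr_le0 ltW.
by rewrite (min_idPr ler01) addr0 -ih// x0 ltW.
Qed.

(** For each slice of [h], both [I] and the integral lie between the contents of the sets
    [h > j + 1] and [h > j]. The sums over [j] telescope to an error of at most 1, whatever the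
    height of [h], and scaling [f] up makes this error negligible. *)
Lemma riesz_representation (P : probability (borel K) R) :
  (forall U, open U -> P U = (open_content U)%:E) ->
  forall f, continuous f -> (\int[P]_x (f x)%:E)%E = (I f)%:E.
Proof.
move=> hP f cf.
have [m mm hm] := integral_mean P.
have mP := integral_mean_represents hm.
rewrite hm; [|exact: continuous_measurable_borel|exact: continuous_bdd].
congr (_%:E).
have mU U : open U -> m \1_U = open_content U.
  by move=> oU; have := mP U (open_measurable_borel oU); rewrite hP// => -[].
have key n (h : K -> R) : continuous h -> (forall x, 0 <= h x <= n%:R) ->
    `|m h - I h| <= 1.
  move=> ch hn; pose c j := fun x => Num.min 1 (Num.max 0 (h x - j%:R)).
  have hE : h = (fun x => \sum_(j < n) c j x).
    by apply/funext => x; exact: clamp_sum.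
  pose U (j : nat) := [set x | j%:R < h x].
  have oU j : open (U j).
    apply: (@open_comp _ _ h [set y | j%:R < y]) => [x _|]; first exact: ch.
    exact: open_gt.
  have cc j : continuous (c j).
    apply: continuous_minr; first exact: cst_continuous.
    apply: continuous_maxr; first exact: cst_continuous.
    by move=> x; apply: cvgB; [exact: ch|exact: cvg_cst].
  have cU j : below (U j) (c j).
    apply: belowP => // x.
      by rewrite /c le_min ler01 le_max lexx ge_min lexx.
    move=> /negP; rewrite /U /= -leNgt => hj.
    by rewrite /c (max_idPl _) ?subr_le0// (min_idPr ler01).
  have c1 j x : U j.+1 x -> c j x = 1.
    rewrite /U /= => hj; apply/min_idPl; rewrite le_max; apply/orP; right.
    by rewrite lerBrDr addrC natr1 ltW.
  have bc j : bdd_fun (c j) by exact: below_bdd (cU j).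
  have bound (k : (K -> R) -> R) : mean k ->
      (forall j, k (c j) <= open_content (U j)) ->
      (forall j, open_content (U j.+1) <= k (c j)) ->
      \sum_(j < n) open_content (U j.+1) <= k h <= \sum_(j < n) open_content (U j).
    move=> mk h1 h2; rewrite hE mean_sum//.
    by apply/andP; split; apply: ler_sum => j _.
  have bI := bound I mI (fun j => open_content_ub (cU j)).
  have /bI/andP[I1 I2] j : open_content (U j.+1) <= I (c j).
    apply: open_content_le => g gU; apply: mean_le => //; first exact: below_bdd gU.
    move=> x; have [Ux|Ux] := pselect (U j.+1 x).
      by rewrite c1// (below_le1 x gU).
    by rewrite (below_eq0 gU Ux); have [_ /(_ x)/andP[]] := cU j.
  have bm : forall j, m (c j) <= open_content (U j).
    move=> j; rewrite -mU//; apply: mean_le => //; first exact: bdd_indic.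
    by move=> x; have [_ /(_ x)/andP[]] := cU j.
  have /(bound m mm bm)/andP[m1 m2] j : open_content (U j.+1) <= m (c j).
    rewrite -mU//; apply: mean_le => //; first exact: bdd_indic.
    move=> x; rewrite indicE; have [Ux|Ux] := pselect (U j.+1 x).
      by rewrite c1// mem_set.
    by rewrite memNset//; have [_ /(_ x)/andP[]] := cU j.
  have tele : \sum_(j < n) open_content (U j) <=
      \sum_(j < n) open_content (U j.+1) + 1.
    rewrite -lerBlDl -sumrB.
    rewrite -(big_mkord xpredT (fun j => open_content (U j) - open_content (U j.+1))).
    have -> : \sum_(0 <= j < n) (open_content (U j) - open_content (U j.+1)) =
        open_content (U 0%N) - open_content (U n).
      elim: (n) => [|k ih]; first by rewrite big_nil subrr.
      by rewrite big_nat_recr//= ih addrA subrK.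
    have h1 : open_content (U 0%N) <= 1.
      by rewrite -open_contentT; exact: le_open_content.
    by have := open_content_ge0 (U n); lra.
  rewrite ler_norml; apply/andP; split; lra.
have bf := continuous_bdd cK cf; have [M hM] := bf.
apply/eqP; rewrite -subr_eq0 -normr_le0; apply/ler_addgt0Pr => e e0; rewrite add0r.
(* The error 1 for [N * f + N * M], where the constant ensures non-negativity, becomes [1 / N < e]
   for [f]. *)
pose N := (Num.truncn e^-1).+1.
have hN : e^-1 < N%:R by exact: truncnS_gt.
have N0 : (0 : R) < N%:R by rewrite ltr0n.
pose n := (Num.truncn (N%:R * (2 * M))).+1.
have hn : N%:R * (2 * M) < n%:R by exact: truncnS_gt.
have ch : continuous (fun x => N%:R * f x + N%:R * M).
  move=> x; apply: cvgD; last exact: cvg_cst.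
  by apply: cvgM; [exact: cvg_cst|exact: cf].
have := key n _ ch; rewrite !mean_lin//; try exact: bdd_fun_cst.
rewrite !mean_cst// opprD addrACA subrr addr0 -mulrBr normrM gtr0_norm// => h.
rewrite -(ler_pM2l N0); apply: le_trans (h _) _.
  move=> x; have := hM x; rewrite ler_norml => /andP[h1 h2].
  rewrite -mulrDr (mulr_ge0 (ltW N0))/=; last lra.
  by apply: le_trans (ltW hn); apply: ler_wpM2l; [exact: ltW|lra].
by rewrite mulrC -ler_pdivrMl// mulr1 ltW.
Qed.

End Riesz.

(** * Stationarity of the representing measure *)

Section StationaryRiesz.
Context (R : realType) (G : groupType) (mu : G -> R).
Hypothesis mum : prob_mass mu.

Let mu0 := prob_mass_ge0 mum.
Let mu1 := prob_mass_has_sum mum.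
Let mE := mean_expect mu0 mu1.

Lemma expect_le_fsum (phi : G -> R) c : bdd_fun phi ->
  (forall J : {fset G}, \sum_(g <- J) mu g * phi g <= c) -> expect mu phi <= c.
Proof.
move=> bphi h; apply/ler_addgt0Pr => e e0.
have /has_sumP/(_ e e0)[J hJ] := expect_has_sum mu0 mu1 bphi.
have := hJ _ (fsubset_refl J); rewrite ltr_norml => /andP[_].
by have := h J; rewrite /fsum; lra.
Qed.

Lemma expect_dominated (phi : nat -> G -> R) (M : R) :
  (forall n g, `|phi n g| <= M) ->
  (forall g, phi n g @[n --> \oo] --> (0 : R)) ->
  expect mu (phi n) @[n --> \oo] --> (0 : R).
Proof.
move=> hM h0; apply/cvgrPdist_lt => e e0.
have M0 : 0 <= M by exact: le_trans (hM 0%N 1%g).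
have e1 : 0 < e / (2 * (M + 1)) by rewrite divr_gt0// mulr_gt0// ltr_wpDl.
have [J hJ] := expect_tail mu0 mu1 e1.
have cJ : fsum (fun g => mu g * phi n g) J @[n --> \oo] --> (0 : R).
  rewrite /fsum; elim: (enum_fset J) => [|g r ih].
    by under eq_fun do rewrite big_nil; exact: cvg_cst.
  rewrite (_ : (fun n => _) = (fun n => mu g * phi n g + \sum_(i <- r) mu i * phi n i)).
    have h : mu g * phi n g + \sum_(i <- r) mu i * phi n i @[n --> \oo] --> mu g * 0 + 0.
      by apply: cvgD => //; apply: cvgM => //; exact: cvg_cst.
    by rewrite mulr0 addr0 in h.
  by apply/funext => n; rewrite big_cons.
have e2 : 0 < e / 2 by exact: divr_gt0.
move/cvgrPdist_lt: cJ => /(_ _ e2); apply: filterS => n.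
rewrite !sub0r !normrN => hn.
have := hJ _ _ (hM n).
have Me : M * (e / (2 * (M + 1))) <= e / 2.
  rewrite invfM [e * _]mulrA mulrCA ler_piMr ?ltW//.
  by rewrite ltr_pdivrMr ?mul1r ?ltrDl// ltr_wpDl.
have := ler_normD (expect mu (phi n) - fsum (fun g => mu g * phi n g) J)
  (fsum (fun g => mu g * phi n g) J).
by rewrite subrK; lra.
Qed.

Context (K : ptopologicalType).
Hypotheses (cK : compact [set: K]) (hK : hausdorff_space K).
Context (act : G -> K -> K).
Hypotheses (actK : is_action act) (cact : forall g, continuous (act g)).
Context (I : (K -> R) -> R).
Hypotheses (mI : mean I) (statI : forall f, continuous f ->
  expect mu (fun g => I (fun x => f (act g x))) = I f).

Let comp_act (f : K -> R) g : continuous f -> continuous (fun x => f (act g x)).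
Proof. by move=> cf x; apply: continuous_comp; [exact: cact|exact: cf]. Qed.

Let actVK g x : act g (act g^-1%g x) = x.
Proof. by rewrite -(proj2 actK) mulgV (proj1 actK). Qed.

Let actKV g x : act g^-1%g (act g x) = x.
Proof. by rewrite -(proj2 actK) mulVg (proj1 actK). Qed.

Lemma bdd_open_content (U : G -> set K) : bdd_fun (fun g => open_content I (U g)).
Proof.
apply: (@bdd_fun_itv _ _ _ 1) => g; rewrite open_content_ge0//=.
by rewrite -(open_contentT cK mI) le_open_content.
Qed.

(** One inequality translates each function below [U]. The other needs a single function below [U]
    that is nearly optimal for many translates at once; finitely many group elements suffice, as
    [expect] is a limit of finite sums. *)
Lemma open_content_stationary U : open U ->
  expect mu (fun g => open_content I (act g @^-1` U)) = open_content I U.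
Proof.
move=> oU; have bc := bdd_open_content (fun g => act g @^-1` U).
have bI (f : K -> R) : bdd_fun f -> bdd_fun (fun g => I (fun x => f (act g x))).
  exact: bdd_mean_comp.
apply/eqP; rewrite eq_le; apply/andP; split; last first.
  apply: open_content_le => // f fU; have [cf f01] := fU.
  rewrite -(statI cf); apply: (mean_le mE) => //.
    exact/bI/(below_bdd cK fU).
  move=> g; apply: open_content_ub => //; split; first exact: comp_act.
  move=> x; have := f01 (act g x); rewrite !indicE.
  by congr (_ <= _ <= _%:R); congr nat_of_bool; apply/idP/idP; rewrite !inE.
apply/ler_addgt0Pr => e e0; apply: expect_le_fsum => // J.
have [f hf] : {f : G -> K -> R & forall g, below (act g @^-1` U) (f g) /\
    open_content I (act g @^-1` U) - e < I (f g)}.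
  apply: (@choice _ _ (fun g f => below (act g @^-1` U) f /\
    open_content I (act g @^-1` U) - e < I f)) => g.
  by have [f ? ?] := open_content_adherent cK mI (act g @^-1` U) e0; exists f.
(* Each summand carries a nearly optimal function for the preimage of [U] under [g] back to [U];
   hence [h] translated by [g] dominates [f g] for every [g] in [J]. *)
pose h x := Num.min 1 (\sum_(g <- J) f g (act g^-1%g x)).
have f0 g x : 0 <= f g x by have [[_ /(_ x)/andP[]]] := hf g.
have hU : below U h.
  apply: belowP.
  - apply: continuous_minr; first exact: cst_continuous.
    by apply: continuous_fsum => g; apply: comp_act; have [[]] := hf g.
  - by move=> x; rewrite le_min ler01 ge_min lexx/= andbT sumr_ge0.
  - move=> x nU; rewrite /h big1 => [|g _]; first by apply/min_idPr; exact: ler01.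
    have [fgU _] := hf g; apply: (below_eq0 fgU).
    by rewrite /preimage /= actVK.
have bh : bdd_fun h by apply: (below_bdd cK hU).
have hI : \sum_(g <- J) mu g * I (fun x => h (act g x)) <= I h.
  rewrite -(statI hU.1); apply: (@fsum_has_sum_le _ _ (fun g => mu g * I (fun x => h (act g x)))).
    move=> g; rewrite mulr_ge0 ?mu0//; apply: (mean_ge0 mI); first exact: bdd_fun_comp.
    by move=> x; have [_ /(_ (act g x))/andP[]] := hU.
  by apply: expect_has_sum => //; exact: bI.
have := open_content_ub cK mI hU.
suff : \sum_(g <- J) mu g * open_content I (act g @^-1` U) <=
    \sum_(g <- J) mu g * I (fun x => h (act g x)) + e by lra.
apply: (@le_trans _ _ (\sum_(g <- J) (mu g * I (fun x => h (act g x)) + mu g * e))).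
  rewrite big_seq [leRHS]big_seq; apply: ler_sum => g gJ.
  rewrite -mulrDr ler_wpM2l ?mu0//.
  have [fgU /ltW] := hf g; rewrite lerBlDr => /le_trans; apply.
  have bfg := below_bdd cK fgU.
  rewrite lerD2r; apply: mean_le => //.
    exact: bdd_fun_comp.
  move=> x; rewrite /h le_min (below_le1 x fgU)/= (big_fsetD1 g)//= actKV.
  by rewrite lerDl sumr_ge0.
rewrite big_split/= lerD2l -mulr_suml; apply: ler_piMl; first exact: ltW.
exact: (fsum_has_sum_le J mu0 mu1).
Qed.

(** Unique stationarity compares measures on Borel sets, so stationarity is propagated from open
    sets to all Borel sets by complements and disjoint countable unions. *)
Lemma riesz_stationary (P : probability (borel K) R) :
  (forall U, open U -> P U = (open_content I U)%:E) ->
  stationary mu (act : G -> borel K -> borel K) P.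
Proof.
move=> hP.
have [m mm hm] := integral_mean P.
have mP := integral_mean_represents hm.
have mact g : measurable_fun [set: borel K] (act g : borel K -> borel K).
  apply: (@measurability _ _ (borel K) (borel K) setT (act g) (@open K)) => //.
  move=> _ [U oU <-]; rewrite setTI; apply: open_measurable_borel.
  by apply: open_comp => // x _; exact: cact.
have preE g (A : set K) : (fun x => \1_A (act g x)) = \1_(act g @^-1` A) :> (K -> R) by [].
have mpre g (A : set (borel K)) : measurable A -> measurable (act g @^-1` A : set (borel K)).
  by move=> mA; rewrite -[X in measurable X]setTI; exact: mact.
have bexp (f : K -> R) : bdd_fun f -> bdd_fun (fun g => m (fun x => f (act g x))).
  exact: bdd_mean_comp.
have key (A : set K) : measurable (A : set (borel K)) ->
    expect mu (fun g => m (fun x => \1_A (act g x))) = m \1_A.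
  move: A; apply: borel_ind.
  - move=> U oU.
    have mU V : open V -> m \1_V = open_content I V.
      by move=> oV; have := mP V (open_measurable_borel oV); rewrite hP// => -[].
    rewrite mU// -open_content_stationary//; congr (expect mu); apply/funext => g.
    by rewrite preE mU//; apply: open_comp => // x _; exact: cact.
  - move=> A mA hA.
    have CE : \1_(~` A) = (fun x => 1 - \1_A x) :> (K -> R).
      by apply/funext => x; rewrite !indicE in_setC; case: (_ \in A) => /=; lra.
    rewrite CE meanB//; [|exact: bdd_fun_cst|exact: bdd_indic].
    rewrite -hA mean_cst// -(mean_cst mE 1) -(meanB mE); first last.
    + exact/bexp/bdd_indic.
    + exact: bdd_fun_cst.
    congr (expect mu); apply/funext => g.
    rewrite meanB ?mean_cst//; [exact: bdd_fun_cst|exact/bdd_fun_comp/bdd_indic].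
  - move=> A mA tA hA.
    pose S n x := \sum_(i < n) \1_(A i) x : R.
    pose r n x := \1_(\bigcup_n A n) x - S n x.
    have bS n : bdd_fun (S n) by exists 1 => x; exact: trivIset_indic_sum_norm.
    have bU : bdd_fun (\1_(\bigcup_n A n) : K -> R) by exact: bdd_indic.
    have mU : measurable (\bigcup_n A n : set (borel K)) by exact: bigcupT_measurable.
    have rbd n x : `|r n x| <= 2.
      rewrite (le_trans (ler_normB _ _))//.
      have := trivIset_indic_sum_norm R tA n x; rewrite -/(S n x) indicE.
      by case: (_ \in _) => /=; rewrite ?normr1 ?normr0; lra.
    have mr n : measurable_fun [set: borel K] (r n : borel K -> R).
      apply: measurable_funB; first exact: (@measurable_indicator R _ (borel K)).
      by apply: measurable_sum => i; exact: (@measurable_indicator R _ (borel K)).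
    have r0 x : r n x @[n --> \oo] --> (0 : R).
      rewrite -(subrr (\1_(\bigcup_n A n) x)); apply: cvgB; first exact: cvg_cst.
      exact: trivIset_indic_cvg.
    have c1 : m (r n) @[n --> \oo] --> (0 : R).
      by apply: (mean_dominated hm mr rbd); exact: aeW.
    have c2 : expect mu (fun g => m (fun x => r n (act g x))) @[n --> \oo] --> (0 : R).
      apply: (@expect_dominated _ 2) => [n g|g]; first exact: mean_abs_le.
      apply: (@mean_dominated _ _ _ P m (fun n x => r n (act g x)) 2 hm) => //.
        by move=> n; exact: (measurableT_comp (mr n) (mact g)).
      by apply: aeW => x; exact: r0.
    have SE n : expect mu (fun g => m (fun x => S n (act g x))) = m (S n).
      have sumE (k : (K -> R) -> R) : mean k -> k (S n) = \sum_(i < n) k \1_(A i).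
        by move=> mk; rewrite mean_sum// => i; exact: bdd_indic.
      rewrite sumE//.
      have -> : \sum_(i < n) m \1_(A i) =
          \sum_(i < n) expect mu (fun g => m (fun x => \1_(A i) (act g x))).
        by apply: eq_bigr => i _; rewrite hA.
      rewrite -(mean_sum mE)//; last by move=> i; exact/bexp/bdd_indic.
      congr (expect mu); apply/funext => g.
      exact: (sumE (fun f => m (fun x => f (act g x))) (mean_comp (act g) mm)).
    (* The defect of stationarity for the union. By additivity it equals the defect of each
       remainder [r n], and both terms of the latter tend to 0. *)
    pose D := m \1_(\bigcup_n A n) -
      expect mu (fun g => m (fun x => \1_(\bigcup_n A n) (act g x))).
    have DE n : m (r n) - expect mu (fun g => m (fun x => r n (act g x))) = D.
      rewrite meanB// (_ : expect mu (fun g => m (fun x => r n (act g x))) =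
        expect mu (fun g => m (fun x => \1_(\bigcup_n A n) (act g x))) - m (S n)).
        by rewrite /D; ring.
      rewrite -SE -(meanB mE); try exact: bexp.
      by congr (expect mu); apply/funext => g; rewrite meanB//; exact: bdd_fun_comp.
    have c3 : D @[_ --> \oo] --> (0 : R).
      have : m (r n) - expect mu (fun g => m (fun x => r n (act g x)))
          @[n --> \oo] --> (0 - 0 : R) by exact: cvgB.
      by rewrite subrr; under eq_fun do rewrite DE.
    have D0 : D = 0.
      by apply: cvg_unique (@cvg_cst _ D _ \oo _) c3; exact: norm_hausdorff.
    by apply/eqP; rewrite eq_sym -subr_eq0 -/D D0.
move=> A mA; rewrite mP// -key// -(expect_esum mu0 mu1).
- apply: eq_esum => g _; congr (_ * _)%E; rewrite /pushforward preE.
  by rewrite mP//; exact: mpre.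
- by move=> g; apply: (mean_ge0 mm) => [|x]; [exact/bdd_fun_comp/bdd_indic|rewrite indicE].
- exact/bexp/bdd_indic.
Qed.

End StationaryRiesz.

(** * Transfer between a measurable action and its compact models *)

Section Models.
Context (R : realType) (G : groupType).
Context d (Y : measurableType d) (act : G -> Y -> Y) (eta : probability Y R).
Hypotheses (mact : forall g, measurable_fun [set: Y] (act g)).
Context (m : (Y -> R) -> R).
Hypotheses (mm : mean m) (hm : forall f, measurable_fun setT f -> bdd_fun f ->
    (\int[eta]_x (f x)%:E)%E = (m f)%:E).

Lemma mean_ae_eq (f g : Y -> R) : measurable_fun setT f -> bdd_fun f ->
  measurable_fun setT g -> bdd_fun g -> {ae eta, forall y, f y = g y} ->
  m f = m g.
Proof.
move=> mf bf mg bg fg; apply/eqP; rewrite -subr_eq0 -meanB//.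
have [M hM] := bdd_funB bf bg.
have := @mean_dominated _ _ _ eta m (fun _ y => f y - g y) M hm
  (fun _ => measurable_funB mf mg) (fun _ => hM).
move=> h; apply/eqP.
have {}h : m (fun y => f y - g y) @[_ --> \oo] --> (0 : R).
  by apply: h; apply: filterS fg => y ->; rewrite subrr; exact: cvg_cst.
by apply: cvg_unique (@cvg_cst _ _ _ \oo _) h; exact: norm_hausdorff.
Qed.

Context (Z : ptopologicalType) (actZ : G -> Z -> Z) (nu : probability (borel Z) R).
Hypothesis cactZ : forall g, continuous (actZ g).
Context (phi : Y -> Z) (psi : Z -> Y).
Hypotheses (mphi : measurable_fun [set: Y] (phi : Y -> borel Z))
  (phinu : forall B, measurable B -> pushforward eta (phi : Y -> borel Z) B = nu B)
  (phiact : forall g, {ae eta, forall y, phi (act g y) = actZ g (phi y)}).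

Lemma measurable_model_act g :
  measurable_fun [set: borel Z] (actZ g : borel Z -> borel Z).
Proof.
apply: (@measurability _ _ (borel Z) (borel Z) setT (actZ g) (@open Z)) => //.
move=> _ [U oU <-]; rewrite setTI; apply: open_measurable_borel.
by apply: open_comp => // x _; exact: cactZ.
Qed.

Lemma model_integral (F : Z -> R) : measurable_fun [set: borel Z] (F : borel Z -> R) ->
  bdd_fun F -> (\int[nu]_x (F x)%:E)%E = (m (fun y => F (phi y)))%:E.
Proof.
move=> mF bF; have [n mn hn] := integral_mean nu.
rewrite hn//; congr (_%:E).
apply: (@mean_eq_measurable _ _ (borel Z) n (fun f => m (fun y => f (phi y)))) => //.
  exact: mean_comp.
move=> B mB; have := integral_mean_represents hn mB.
have mpre : measurable (phi @^-1` B) by rewrite -[X in measurable X]setTI; exact: mphi.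
rewrite -phinu// /pushforward (integral_mean_represents hm mpre) => -[<-].
by [].
Qed.

Lemma model_translate (F : Z -> R) g : continuous F -> bdd_fun F ->
  m (fun y => F (phi (act g y))) = m (fun y => F (actZ g (phi y))).
Proof.
move=> cF bF.
have mF := continuous_measurable_borel cF.
have mFp := measurableT_comp mF mphi.
apply: mean_ae_eq.
- exact: (measurableT_comp mFp (mact g)).
- exact: bdd_fun_comp.
- exact: (measurableT_comp (measurableT_comp mF (measurable_model_act g)) mphi).
- exact: bdd_fun_comp.
- by apply: filterS (phiact g) => y ->.
Qed.

Lemma model_translate_integral (F : Z -> R) g : continuous F -> bdd_fun F ->
  (\int[nu]_x (F (actZ g x))%:E)%E = (m (fun y => F (phi (act g y))))%:E.
Proof.
move=> cF bF; rewrite model_translate// -(@model_integral (fun x => F (actZ g x)))//.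
  exact: (measurableT_comp (continuous_measurable_borel cF) (measurable_model_act g)).
exact: bdd_fun_comp.
Qed.

Lemma model_translate_pushforward (F : Z -> R) g : continuous F ->
  (forall x, 0 <= F x <= 1) ->
  (\int[pushforward nu (actZ g : borel Z -> borel Z)]_(x in [set: borel Z]) (F x)%:E)%E =
  (m (fun y => F (phi (act g y))))%:E.
Proof.
move=> cF F01; rewrite -model_translate_integral//; last exact: bdd_fun_itv F01.
rewrite (@ge0_integral_pushforward _ _ (borel Z) (borel Z) R (actZ g)
  (measurable_model_act g) nu)//.
- by apply/measurable_EFinP; exact: continuous_measurable_borel.
- by move=> x _; rewrite lee_fin; have /andP[] := F01 x.
Qed.

(** If [actZ a] fixes [phi y], then almost surely [phi (act a y) = phi y], and applying [psi] gives
    [act a y = y]. This uses [psi (phi _)] at the point [act a y]; nonsingularity keeps the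
    exceptional set null after translation by [a]. *)
Lemma model_free (mpsi : measurable_fun [set: borel Z] (psi : borel Z -> Y)) a :
  hausdorff_space Z -> nonsingular act eta ->
  {ae eta, forall y, psi (phi y) = y} ->
  eta.-negligible [set y | act a y = y] ->
  open [set z | actZ a z <> z] /\ nu [set z | actZ a z <> z] = 1%E.
Proof.
move=> hZ ns psiphi free.
have oU : open [set z | actZ a z <> z].
  rewrite openE => z /= az; move: hZ; rewrite open_hausdorff => /(_ (actZ a z) z).
  move=> [|[U V] /= [/set_mem Uaz /set_mem Vz] [oU oV /eqP UV]]; first exact/eqP.
  have : nbhs z (V `&` actZ a @^-1` U).
    apply: filterI; first exact: open_nbhs_nbhs.
    by apply: cactZ; exact: open_nbhs_nbhs.
  apply: filterS => w [Vw Uw] /= aw.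
  have : (U `&` V) w by split => //; rewrite -aw.
  by rewrite UV.
split=> //.
have mU := open_measurable_borel oU.
have mpre : measurable (phi @^-1` [set z | actZ a z <> z]).
  by rewrite -[X in measurable X]setTI; exact: mphi.
rewrite -phinu// /pushforward.
suff : {ae eta, forall y, (phi @^-1` [set z | actZ a z <> z]) y}.
  move=> aeU; rewrite (integral_mean_represents hm mpre) -(mean_1 mm); congr (_%:E).
  apply: mean_ae_eq.
  - exact: measurable_indicator.
  - exact: bdd_indic.
  - exact: measurable_cst.
  - exact: bdd_fun_cst.
  - by apply: filterS aeU => y Uy; rewrite indicE mem_set.
have psiphia : {ae eta, forall y, psi (phi (act a y)) = act a y}.
  have [N [mN N0 sN]] := psiphi.
  exists (act a @^-1` N); split.
  - by rewrite -[X in measurable X]setTI; exact: mact.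
  - by have [_] := ns a N mN; apply.
  - by move=> y /= hy; apply: sN.
have free' : {ae eta, forall y, act a y <> y}.
  by move: free; congr (_.-negligible _); apply/seteqP; split=> y /= => [h nh|/contrapT].
near=> y => /= fixy.
have h1 : act a y <> y by near: y.
have h2 : phi (act a y) = actZ a (phi y) by near: y; exact: phiact.
have h3 : psi (phi y) = y by near: y.
have h4 : psi (phi (act a y)) = act a y by near: y.
by apply: h1; rewrite -h4 h2 fixy h3.
Unshelve. all: by end_near. Qed.

End Models.

Section Boundary.
Context (R : realType) (G : groupType) (mu : G -> R).
Hypotheses (mum : prob_mass mu) (cG : countable [set: G]).
Context d (Y : measurableType d) (act : G -> Y -> Y) (eta : probability Y R).
Hypotheses (actY : is_action act)
  (mact : forall g, measurable_fun [set: Y] (act g))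
  (stat : stationary mu act eta).
Context (m : (Y -> R) -> R).
Hypotheses (mm : mean m) (hm : forall f, measurable_fun setT f -> bdd_fun f ->
    (\int[eta]_x (f x)%:E)%E = (m f)%:E).

(** Along almost every path the translated measures converge to a Dirac mass at some [x0]. The
    integrals of [F] and of [F ^+ 2] then tend to [F x0] and [F x0 ^+ 2], so the variance tends to
    0. *)
Lemma boundary_variance_vanishes (X : ptopologicalType) (actX : G -> X -> X)
    (nu : probability (borel X) R) :
  compact_model act eta actX nu -> topological_mu_boundary mu actX nu ->
  forall f, measurable_fun setT f -> bdd_fun f -> variance_vanishes mu act m f.
Proof.
move=> [_ [phi [psi [[mphi mpsi] [phinu _] psiphi _ phiact]]]].
move=> [[_ _ _ cact] metX _ [d' [Om [P [s [iid aebd]]]]]].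
apply: (variance_vanishes_metrizable mum actY mact stat mm hm metX mphi mpsi psiphi).
move=> F cF F01.
have bF : bdd_fun F by apply: (@bdd_fun_itv _ _ _ 1).
have bFp : bdd_fun (fun y => F (phi y)) by exact: bdd_fun_comp.
apply: (cvg_iter_markov mum cG iid (bdd_translate_variance act mm bFp)).
apply: filterS aebd => w [] x0 wx0.
have lim (H : X -> R) : continuous H -> (forall x, 0 <= H x <= 1) ->
    m (fun y => H (phi (act (walk s k w) y))) @[k --> \oo] --> H x0.
  move=> cH H01; have := wx0 H cH.
  rewrite integral_dirac//; last first.
    by apply/measurable_EFinP; exact: continuous_measurable_borel.
  rewrite diracE in_setT mul1e => h.
  have E k : fine (\int[pushforward nu (actX (walk s k w) : borel X -> borel X)]_(x in [set: borel X]) (H x)%:E)%E =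
      m (fun y => H (phi (act (walk s k w) y))).
    by rewrite (model_translate_pushforward mact mm hm cact mphi phinu phiact _ cH H01).
  have := fine_cvg h; rewrite (_ : fine \o _ = (fun k => m (fun y => H (phi (act (walk s k w) y)))));
    [by apply|exact/funext].
have h1 := lim F cF F01.
have h2 : m (fun y => F (phi (act (walk s k w) y)) ^+ 2) @[k --> \oo] --> F x0 ^+ 2.
  apply: (lim (fun x => F x ^+ 2)) => x; last first.
    by have /andP[f0 f1] := F01 x; rewrite exprn_ge0// exprn_ile1.
  by rewrite /continuous_at expr2; under eq_fun do rewrite expr2; apply: cvgM; exact: cF.
rewrite -(subrr (F x0 ^+ 2)); apply: cvgB => //.
by under eq_fun do rewrite expr2; rewrite expr2; exact: cvgM.
Qed.

(** The boundary property lives on [X] and unique stationarity on [K]. Pulling [f] back along [phi]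
    to [Y] gives the same translated variances, so [Y] carries the property from one model to the
    other. *)
Lemma model_variance_vanishes (K : ptopologicalType) (actK : G -> K -> K)
    (nu : probability (borel K) R) (I : (K -> R) -> R) :
  (forall f, measurable_fun setT f -> bdd_fun f -> variance_vanishes mu act m f) ->
  compact_model act eta actK nu ->
  (forall f, continuous f -> (\int[nu]_x (f x)%:E)%E = (I f)%:E) ->
  forall f, continuous f -> variance_vanishes mu actK I f.
Proof.
move=> vY [[cK hK _ cact] [phi [psi [[mphi _] [phinu _] _ _ phiact]]]] hI f cf.
have bf := continuous_bdd cK cf.
have -> : variance_vanishes mu actK I f =
    variance_vanishes mu act m (fun y => f (phi y)).
  rewrite /variance_vanishes (_ : translate_variance actK I f =
    translate_variance act m (fun y => f (phi y)))//.
  apply/funext => g; rewrite /translate_variance /mvariance.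
  have E (h : K -> R) : continuous h ->
      I (fun x => h (actK g x)) = m (fun y => h (phi (act g y))).
    move=> ch; apply: (@EFin_inj R); rewrite -hI.
      by rewrite (model_translate_integral mact mm hm cact mphi phinu phiact g ch)//;
        exact: continuous_bdd.
    by move=> x; apply: continuous_comp; [exact: cact|exact: ch].
  rewrite (E f cf) (E (fun x => f x ^+ 2))// => x.
  by rewrite /continuous_at expr2; under eq_fun do rewrite expr2; apply: cvgM; exact: cf.
apply: vY; last exact: bdd_fun_comp.
exact: (measurableT_comp (continuous_measurable_borel cf) mphi).
Qed.

End Boundary.

(** * The Hilbert space l2(G) and its reduced C*-algebra *)

Section ComplexSums.
Context (R : realType).
Local Notation C := (R[i]).
Local Notation Re := (@complex.Re R).
Local Notation Im := (@complex.Im R).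

Lemma Re_cvg (T : Type) (F : set_system T) {FF : Filter F} (z : T -> C^o) (l : C^o) :
  z @ F --> l -> (fun t => Re (z t)) @ F --> Re l.
Proof.
move=> /cvgrPdist_lt h; apply/cvgrPdist_lt => e e0.
have := h e%:C%C; rewrite ltcR => /(_ e0); apply: filterS => t.
rewrite normc_def ltcR; apply: le_lt_trans.
rewrite -sqrtr_sqr ler_wsqrtr//.
by case: (l) (z t) => a b [c d] /=; rewrite lerDl sqr_ge0.
Qed.

Lemma complex_cvg (T : Type) (F : set_system T) {FF : Filter F} (u v : T -> R) a b :
  u @ F --> a -> v @ F --> b ->
  (fun t => (u t +i* v t)%C : C^o) @ F --> ((a +i* b)%C : C^o).
Proof.
move=> /cvgrPdist_lt hu /cvgrPdist_lt hv; apply/cvgrPdist_lt => -[e i].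
rewrite ltcE/= => /andP[/eqP -> e0].
have e2 : 0 < e / 2 by rewrite divr_gt0.
have := hv _ e2; have := hu _ e2; apply: filterS2 => t h1 h2.
rewrite normc_def ltcR/= -[ltRHS]ger0_norm ?ltW// -sqrtr_sqr.
rewrite ltr_sqrt ?exprn_gt0//.
have h1' : (a - u t) ^+ 2 <= (e / 2) ^+ 2.
  by rewrite -real_normK ?num_real// lerXn2r ?nnegrE ?normr_ge0 ?ltW.
have h2' : (b - v t) ^+ 2 <= (e / 2) ^+ 2.
  by rewrite -real_normK ?num_real// lerXn2r ?nnegrE ?normr_ge0 ?ltW.
have h3 : 0 < (e / 2) ^+ 2 by rewrite exprn_gt0.
have -> : e ^+ 2 = 4 * (e / 2) ^+ 2 by field.
lra.
Qed.

End ComplexSums.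

Lemma real_cauchy (R : realType) (a b : nat -> R) :
  (forall n k, `|a (n + k)%N - a n| <= b n) -> b n @[n --> \oo] --> (0 : R) ->
  exists l : R, a n @[n --> \oo] --> l.
Proof.
move=> hab /cvgrPdist_lt b0.
suff /cauchy_cvgP/cvg_ex[l hl] : cauchy (a n @[n --> \oo]) by exists l.
apply: cauchy_exP => e e0; have [N _ hN] := b0 e e0.
exists (a N); exists N => // n /= Nn; rewrite /ball/= distrC.
rewrite -(subnKC Nn) (le_lt_trans (hab N (n - N)%N))//.
by rewrite (le_lt_trans (ler_norm _))//; have := hN N (leqnn N); rewrite sub0r normrN.
Qed.

Section HilbertSpace.
Context (R : realType) (G : groupType).
Local Notation C := (R[i]).
Local Notation Re := (@complex.Re R).
Local Notation Im := (@complex.Im R).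
Local Notation H := (l2 R G).
Implicit Types (x y z : H) (c : C) (g h : G).

Definition sqabs (c : C) : R := Re c ^+ 2 + Im c ^+ 2.

Lemma sqabs_ge0 c : 0 <= sqabs c. Proof. by rewrite addr_ge0 ?sqr_ge0. Qed.

Lemma sqabsM c c' : sqabs (c * c') = sqabs c * sqabs c'.
Proof. by case: c c' => a b [a' b']; rewrite /sqabs /=; ring. Qed.

Definition norm2 x : R := fine (sqnorm x).

Lemma has_sum_norm2 x : has_sum (fun g => sqabs (x g)) (norm2 x).
Proof.
have sE : sqnorm x = (\esum_(g in [set: G]) (sqabs (x g))%:E)%E.
  by apply: eq_esum => g _; rewrite -add_Re2_Im2.
have : (sqnorm x < +oo)%E by case: x {sE} => x /= /asboolP.
move=> xoo; apply: esum_has_sum => [g|]; first exact: sqabs_ge0.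
rewrite -sE /norm2 fineK// ge0_fin_numE// sE esum_ge0// => g _.
by rewrite lee_fin sqabs_ge0.
Qed.

Arguments has_sum_norm2 x : clear implicits.

Lemma norm2_ge0 x : 0 <= norm2 x.
Proof. by apply: (has_sum_ge0 _ (has_sum_norm2 x)) => g; exact: sqabs_ge0. Qed.

Lemma square_summable_has_sum (f : G -> C^o) l :
  has_sum (fun g => sqabs (f g)) l -> f \in square_summable (R := R) (G := G).
Proof.
move=> hf; apply/asboolP.
rewrite (_ : sqnorm f = \esum_(g in [set: G]) (sqabs (f g))%:E)%E.
  by rewrite (has_sum_esum _ hf) ?ltry// => g; exact: sqabs_ge0.
by apply: eq_esum => g _; rewrite -add_Re2_Im2.
Qed.

Lemma l2P x y : (forall g, x g = y g) -> x = y.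
Proof. by move=> xy; apply: val_inj; apply/funext. Qed.

(** The real part of [c] times the conjugate of [c']. Working with the real inner product keeps the
    analysis over [R]; imaginary parts are recovered through multiplication by [- 'i], as in
    [innerE]. *)
Definition reprod (c c' : C) : R := Re c * Re c' + Im c * Im c'.

Lemma reprod_bound c c' : `|reprod c c'| <= 2^-1 * (sqabs c + sqabs c').
Proof.
case: c c' => a b [a' b']; rewrite /reprod /sqabs /= ler_norml.
have h1 := sqr_ge0 (a + a'); have h2 := sqr_ge0 (b + b').
have h3 := sqr_ge0 (a - a'); have h4 := sqr_ge0 (b - b').
by apply/andP; split; lra.
Qed.

Definition rinner x y : R :=
  lim (fsum (fun g => reprod (x g) (y g)) @ summability.totally).

Lemma has_sum_rinner x y : has_sum (fun g => reprod (x g) (y g)) (rinner x y).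
Proof.
have hb := has_sumZ 2^-1 (has_sumD (has_sum_norm2 x) (has_sum_norm2 y)).
have [|l hl] := @dominated_has_sum R G (fun g => reprod (x g) (y g)) _ _ _ hb;
  last by apply: cvgP hl.
by move=> g; exact: reprod_bound.
Qed.

Arguments has_sum_rinner x y : clear implicits.

Lemma rinnerP x y l : has_sum (fun g => reprod (x g) (y g)) l -> rinner x y = l.
Proof. by move=> h; exact: has_sum_unique (has_sum_rinner x y) h. Qed.

Lemma rinnerC x y : rinner x y = rinner y x.
Proof.
apply: rinnerP; have := has_sum_rinner y x.
by congr (has_sum _ _); apply/funext => g; rewrite /reprod mulrC [X in _ + X]mulrC.
Qed.

Lemma rinnerDl x y z : rinner (x + y) z = rinner x z + rinner y z.
Proof.
apply: rinnerP; have := has_sumD (has_sum_rinner x z) (has_sum_rinner y z).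
congr (has_sum _ _); apply/funext => g; rewrite [(x + y) g]/(x g + y g).
by case: (x g) (y g) (z g) => a b [a' b'] [a'' b'']; rewrite /reprod /=; ring.
Qed.

Lemma rinnerZl (k : R) x y : rinner (k%:C%C *: x) y = k * rinner x y.
Proof.
apply: rinnerP; have := has_sumZ k (has_sum_rinner x y).
congr (has_sum _ _); apply/funext => g; rewrite [(_ *: x) g]/(k%:C%C * x g).
by case: (x g) (y g) => a b [a' b']; rewrite /reprod /=; ring.
Qed.

Lemma rinnerDr x y z : rinner x (y + z) = rinner x y + rinner x z.
Proof. by rewrite rinnerC rinnerDl rinnerC [X in _ + X]rinnerC. Qed.

Lemma rinnerZr (k : R) x y : rinner x (k%:C%C *: y) = k * rinner x y.
Proof. by rewrite rinnerC rinnerZl rinnerC. Qed.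

Lemma rinner_conjZ c x y : rinner (c *: x) y = rinner x (c^*%C *: y).
Proof.
apply: rinnerP; have := has_sum_rinner x (c^*%C *: y).
congr (has_sum _ _); apply/funext => g.
rewrite [(c *: x) g]/(c * x g) [(_ *: y) g]/(c^*%C * y g).
by case: c (x g) (y g) => a b [a' b'] [a'' b'']; rewrite /reprod /=; ring.
Qed.

Lemma rinner_conjZr c x y : rinner x (c *: y) = rinner (c^*%C *: x) y.
Proof. by rewrite rinnerC rinner_conjZ rinnerC. Qed.

Lemma rinnerN1 x y : rinner (- x) y = - rinner x y.
Proof. by rewrite -scaleN1r (_ : -1 = (-1 : R)%:C%C) ?rinnerZl ?mulN1r// rmorphN1. Qed.

Lemma rinnerBl x y z : rinner (x - y) z = rinner x z - rinner y z.
Proof. by rewrite rinnerDl rinnerN1. Qed.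

Lemma rinnerBr x y z : rinner x (y - z) = rinner x y - rinner x z.
Proof. by rewrite rinnerC rinnerBl rinnerC [X in _ - X]rinnerC. Qed.

Lemma rinner_norm2 x : rinner x x = norm2 x.
Proof.
apply: rinnerP; have := has_sum_norm2 x.
by congr (has_sum _ _); apply/funext => g; rewrite /reprod /sqabs -!expr2.
Qed.

Lemma innerE x y : inner x y = (rinner x y +i* rinner (- 'i *: x) y)%C.
Proof.
rewrite /inner /summability.sum; apply: (@cvg_lim C^o); first exact: norm_hausdorff.
rewrite (_ : summability.partial_sum _ = (fun J =>
    (fsum (fun g => reprod (x g) (y g)) J
     +i* fsum (fun g => reprod ((- 'i *: x) g) (y g)) J)%C)).
  exact: complex_cvg (has_sum_rinner x y) (has_sum_rinner (- 'i *: x) y).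
apply/funext => J; rewrite partial_sumE /fsum.
elim: (enum_fset J) => [|g r ih]; first by rewrite !big_nil.
rewrite !big_cons ih [(_ *: x) g]/(- 'i * x g).
case: (x g) (y g) => a b [a' b']; apply/eqP.
by rewrite eq_complex /reprod /=; apply/andP; split; apply/eqP; ring.
Qed.

Lemma Re_inner x y : Re (inner x y) = rinner x y.
Proof. by rewrite innerE. Qed.

Lemma rinner_eq_inner x y x' y' :
  (forall c, rinner (c *: x) y = rinner (c *: x') y') -> inner x y = inner x' y'.
Proof. by move=> h; rewrite !innerE h; have := h 1; rewrite !scale1r => ->. Qed.

Lemma norm2Z c x : norm2 (c *: x) = sqabs c * norm2 x.
Proof.
have := has_sumZ (sqabs c) (has_sum_norm2 x) => h.
apply: has_sum_unique (has_sum_norm2 (c *: x)) _; move: h.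
by congr (has_sum _ _); apply/funext => g; rewrite -sqabsM.
Qed.

Lemma norm2D x y : norm2 (x + y) = norm2 x + 2 * rinner x y + norm2 y.
Proof. by rewrite -!rinner_norm2 rinnerDl !rinnerDr [rinner y x]rinnerC; ring. Qed.

Lemma sqabs_le_norm2 x g : sqabs (x g) <= norm2 x.
Proof.
have := fsum_has_sum_le [fset g]%fset _ (has_sum_norm2 x).
by rewrite /fsum big_seq_fset1; apply=> h; exact: sqabs_ge0.
Qed.

Lemma norm2_eq0 x : norm2 x = 0 -> x = 0.
Proof.
move=> x0; apply: l2P => g; have := sqabs_le_norm2 x g; rewrite x0.
rewrite /sqabs [(0 : H) g]/(0 : C); case: (x g) => a b /= h.
have a0 := sqr_ge0 a; have b0 := sqr_ge0 b.
have /eqP : a ^+ 2 = 0 by lra.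
have /eqP : b ^+ 2 = 0 by lra.
by rewrite !sqrf_eq0 => /eqP -> /eqP ->.
Qed.

(** Stated for an arbitrary semidefinite form because it is also applied to [<T x, y>] with [T]
    positive, in [positive_obound]. *)
Lemma psd_cauchy_schwarz (B : H -> H -> R) :
  (forall x y, B x y = B y x) -> (forall x y z, B (x + y) z = B x z + B y z) ->
  (forall k x y, B (k%:C%C *: x) y = k * B x y) -> (forall x, 0 <= B x x) ->
  forall x y, B x y ^+ 2 <= B x x * B y y.
Proof.
move=> BC BD BZ B0 x y.
have q t : 0 <= B x x + 2 * t * B x y + t ^+ 2 * B y y.
  have := B0 (x + t%:C%C *: y).
  rewrite BD ![B _ (_ + _)]BC !BD !BZ [B x (_ *: y)]BC [B y (_ *: y)]BC !BZ [B y x]BC.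
  by congr (_ <= _); ring.
have [yy|yy] := eqVneq (B y y) 0.
  rewrite yy mulr0; have [->|xy] := eqVneq (B x y) 0; first by rewrite expr0n.
  (* When [B y y = 0] the polynomial is affine in [t]; this [t] gives it the value [-1]. *)
  have := q (- (B x x + 1) / (2 * B x y)).
  rewrite yy mulr0 addr0 (_ : 2 * _ * _ = - (B x x + 1)); last by field; rewrite xy.
  lra.
have yp : 0 < B y y by rewrite lt_neqAle eq_sym yy B0.
have := q (- B x y / B y y).
rewrite (_ : _ + _ + _ = B x x - B x y ^+ 2 / B y y); last by field.
by rewrite subr_ge0 ler_pdivrMr.
Qed.

Lemma rinner_cauchy_schwarz x y : rinner x y ^+ 2 <= norm2 x * norm2 y.
Proof.
rewrite -!rinner_norm2; apply: psd_cauchy_schwarz.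
- exact: rinnerC.
- exact: rinnerDl.
- exact: rinnerZl.
- by move=> z; rewrite rinner_norm2 norm2_ge0.
Qed.

Lemma l2norm_ge0 x : 0 <= l2norm x. Proof. exact: sqrtr_ge0. Qed.

Lemma l2norm_sqr x : l2norm x ^+ 2 = norm2 x.
Proof. by rewrite sqr_sqrtr// norm2_ge0. Qed.

Lemma l2norm_le x (k : R) : 0 <= k -> (l2norm x <= k) = (norm2 x <= k ^+ 2).
Proof. by move=> k0; rewrite -l2norm_sqr ler_pXn2r ?nnegrE ?l2norm_ge0. Qed.

Lemma rinner_le x y : `|rinner x y| <= l2norm x * l2norm y.
Proof.
rewrite -(@ler_pXn2r _ 2) ?nnegrE ?mulr_ge0 ?l2norm_ge0//.
by rewrite real_normK ?num_real// exprMn !l2norm_sqr rinner_cauchy_schwarz.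
Qed.

Lemma l2norm_triangle x y : l2norm (x + y) <= l2norm x + l2norm y.
Proof.
rewrite l2norm_le ?addr_ge0 ?l2norm_ge0// norm2D sqrrD !l2norm_sqr.
rewrite lerD2r lerD2l.
by have := le_trans (ler_norm _) (rinner_le x y); lra.
Qed.

Lemma l2norm0 : l2norm (0 : H) = 0.
Proof.
apply/eqP; rewrite -sqrf_eq0 l2norm_sqr.
by rewrite -(scale0r (0 : H)) norm2Z /sqabs /= expr0n addr0 mul0r.
Qed.

Lemma l2norm_eq0 x : l2norm x = 0 -> x = 0.
Proof. by move=> h; apply: norm2_eq0; rewrite -l2norm_sqr h expr0n. Qed.

Definition cabs (c : C) : R := Num.sqrt (sqabs c).

Lemma cabs_ge0 c : 0 <= cabs c. Proof. exact: sqrtr_ge0. Qed.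

Lemma l2normZ c x : l2norm (c *: x) = cabs c * l2norm x.
Proof. by rewrite -sqrtrM ?sqabs_ge0// -norm2Z. Qed.

Lemma cabs_real (k : R) : cabs k%:C%C = `|k|.
Proof. by rewrite /cabs /sqabs /= expr0n addr0 sqrtr_sqr. Qed.

Lemma l2normN x : l2norm (- x) = l2norm x.
Proof.
rewrite -scaleN1r l2normZ (_ : -1 = (-1 : R)%:C%C) ?cabs_real ?normrN1 ?mul1r//.
by rewrite rmorphN1.
Qed.

Lemma l2normB x y : l2norm (x - y) <= l2norm x + l2norm y.
Proof. by rewrite -(l2normN y) l2norm_triangle. Qed.

Lemma rinner_separates x y : (forall z, rinner x z = rinner y z) -> x = y.
Proof.
move=> h; apply/eqP; rewrite -subr_eq0; apply/eqP/norm2_eq0.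
by rewrite -rinner_norm2 rinnerBl h subrr.
Qed.

(** Coordinates converge, and the bound on [u (n + k) - u n] passes to the limit in [k] on every
    finite set of coordinates. This shows that [u n - v] is square summable, so the limit is
    obtained as [u 0 - w]. *)
Lemma l2_cauchy (u : nat -> H) (b : nat -> R) :
  (forall n k, l2norm (u (n + k)%N - u n) <= b n) ->
  b n @[n --> \oo] --> (0 : R) ->
  exists v, forall n, l2norm (u n - v) <= b n.
Proof.
move=> hu b0.
have hsq n k g : sqabs (u (n + k)%N g - u n g) <= b n ^+ 2.
  apply: le_trans (sqabs_le_norm2 (u (n + k)%N - u n) g) _.
  by rewrite -l2norm_sqr lerXn2r ?nnegrE ?l2norm_ge0// (le_trans (l2norm_ge0 _) (hu n k)).
have b_ge0 n : 0 <= b n by exact: le_trans (l2norm_ge0 _) (hu n 0%N).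
have [a ha] : {a : G -> R & forall g, Re (u n g) @[n --> \oo] --> a g}.
  apply: (@choice _ _ (fun g l => Re (u n g) @[n --> \oo] --> l)) => g.
  apply: real_cauchy b0 => n k; rewrite -(@ler_pXn2r _ 2) ?nnegrE// real_normK ?num_real//.
  apply: le_trans (hsq n k g); rewrite /sqabs.
  by case: (u _ g) (u _ g) => c d [c' d'] /=; rewrite lerDl sqr_ge0.
have [a' ha'] : {a' : G -> R & forall g, Im (u n g) @[n --> \oo] --> a' g}.
  apply: (@choice _ _ (fun g l => Im (u n g) @[n --> \oo] --> l)) => g.
  apply: real_cauchy b0 => n k; rewrite -(@ler_pXn2r _ 2) ?nnegrE// real_normK ?num_real//.
  apply: le_trans (hsq n k g); rewrite /sqabs.
  by case: (u _ g) (u _ g) => c d [c' d'] /=; rewrite lerDr sqr_ge0.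
pose v g : C := (a g +i* a' g)%C.
have sqabsE g (c : C) : sqabs (c - v g) = (Re c - a g) ^+ 2 + (Im c - a' g) ^+ 2.
  by case: c.
have hs n (J : {fset G}) : fsum (fun g => sqabs (u n g - v g)) J <= b n ^+ 2.
  have cJ : fsum (fun g => sqabs (u n g - u (n + k)%N g)) J @[k --> \oo] -->
      fsum (fun g => sqabs (u n g - v g)) J.
    rewrite /fsum; elim: (enum_fset J) => [|g r ih].
      by rewrite big_nil; under eq_fun do rewrite big_nil; exact: cvg_cst.
    rewrite big_cons (_ : (fun k => _) = (fun k =>
        ((Re (u n g) - Re (u (n + k)%N g)) ^+ 2 + (Im (u n g) - Im (u (n + k)%N g)) ^+ 2)
        + \sum_(j <- r) sqabs (u n j - u (n + k)%N j))); last first.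
      apply/funext => k; rewrite big_cons; congr (_ + _).
      by case: (u _ g) (u _ g) => c d [c' d'].
    rewrite sqabsE; apply: cvgD => //.
    have shift (w : nat -> R) (l : R) : w k @[k --> \oo] --> l -> w (n + k)%N @[k --> \oo] --> l.
      move=> /cvgrPdist_lt hw; apply/cvgrPdist_lt => e /hw[N _ hN].
      by exists N => // k /= Nk; apply: hN; exact: leq_trans Nk (leq_addl _ _).
    apply: cvgD; rewrite !expr2; under eq_fun do rewrite expr2.
      by apply: cvgM; apply: cvgB; try exact: cvg_cst; exact: shift (ha g).
    by apply: cvgM; apply: cvgB; try exact: cvg_cst; exact: shift (ha' g).
  rewrite -(cvg_lim _ cJ)//; apply: limr_le; first by apply: cvgP cJ.
  apply: nearW => k.
  apply: (@le_trans _ _ (norm2 (u (n + k)%N - u n))).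
    rewrite (_ : fsum _ _ = fsum (fun g => sqabs ((u (n + k)%N - u n) g)) J).
      by apply: (fsum_has_sum_le J _ (has_sum_norm2 _)) => g; exact: sqabs_ge0.
    apply: eq_bigr => g _; rewrite [(u (n + k)%N - u n) g]/(u (n + k)%N g - u n g).
    by case: (u _ g) (u _ g) => c d [c' d']; rewrite /sqabs /=; ring.
  by rewrite -l2norm_sqr lerXn2r ?nnegrE ?l2norm_ge0.
have hd n : exists w : H, (forall g, w g = u n g - v g) /\ norm2 w <= b n ^+ 2.
  have [|l hl] := nonneg_has_sum _ (hs n); first by move=> g; exact: sqabs_ge0.
  exists (L2 (square_summable_has_sum hl)); split => //.
  have := has_sum_norm2 (L2 (square_summable_has_sum hl)).
  move=> /= h; rewrite (has_sum_unique h hl).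
  by rewrite -(cvg_lim _ hl)//; apply: limr_le; [apply: cvgP hl|apply: nearW => J; exact: hs].
have [w [hw _]] := hd 0%N.
exists (u 0%N - w) => n; have [wn [hwn le]] := hd n.
rewrite (_ : u n - (u 0%N - w) = wn) ?l2norm_le//.
apply: l2P => g; rewrite hwn -[LHS]/((u n g : C) - ((u 0%N g : C) - (w g : C))) hw.
have -> (c c' c'' : C) : c - (c' - (c' - c'')) = c - c'' by rewrite subKr.
by [].
Qed.

End HilbertSpace.

Arguments has_sum_norm2 {R G} x.
Arguments has_sum_rinner {R G} x y.

(** * Bounded operators and the span of the regular representation *)

Section Operators.
Context (R : realType) (G : groupType).
Local Notation C := (R[i]).
Local Notation Re := (@complex.Re R).
Local Notation Im := (@complex.Im R).
Local Notation H := (l2 R G).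
Local Notation op := (H -> H).
Implicit Types (x y z : H) (c : C) (g h : G) (S T : op).

Definition obound (M : R) T := forall x, l2norm (T x) <= M * l2norm x.

Definition radjoint T S := forall x y, rinner (T x) y = rinner x (S y).

Lemma fun_lincombE c S T x : (c *: S + T) x = c *: S x + T x.
Proof. by []. Qed.

Lemma fun_subE S T x : (S - T) x = S x - T x.
Proof. by []. Qed.

Lemma linear_opB T x y : linear T -> T (x - y) = T x - T y.
Proof. by move=> lT; rewrite addrC -scaleN1r lT scaleN1r addrC. Qed.

Lemma linear_op0 T : linear T -> T 0 = 0.
Proof. by move=> lT; have := linear_opB 0 0 lT; rewrite !subrr. Qed.

Lemma linear_opZ T c x : linear T -> T (c *: x) = c *: T x.
Proof. by move=> lT; have := lT c x 0; rewrite !addr0 (linear_op0 lT) addr0. Qed.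

Lemma linear_opD T x y : linear T -> T (x + y) = T x + T y.
Proof. by move=> lT; have := lT 1 x y; rewrite !scale1r. Qed.

Lemma linear_lincomb c S T : linear S -> linear T -> linear (c *: S + T).
Proof.
move=> lS lT k x y; rewrite !fun_lincombE lS lT !scalerDr !scalerA mulrC.
by rewrite -!addrA; congr (_ + _); rewrite addrCA.
Qed.

Lemma linear_comp S T : linear S -> linear T -> linear (S \o T).
Proof. by move=> lS lT k x y; rewrite /= lT lS. Qed.

Lemma oboundW M N T : M <= N -> obound M T -> obound N T.
Proof. by move=> MN h x; rewrite (le_trans (h x))// ler_wpM2r// l2norm_ge0. Qed.

Lemma bounded_operatorP T : bounded_operator T ->
  linear T /\ exists2 M, 0 < M & obound M T.
Proof.
move=> [lT [M hM]]; split => //; exists (`|M| + 1); first by rewrite ltr_wpDl.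
by apply: oboundW hM; rewrite (le_trans (ler_norm M))// lerDl.
Qed.

Lemma obound_lincomb c M N S T : obound M S -> obound N T ->
  obound (cabs c * M + N) (c *: S + T).
Proof.
move=> hS hT x; rewrite fun_lincombE (le_trans (l2norm_triangle _ _))//.
by rewrite mulrDl lerD// l2normZ -mulrA ler_wpM2l// cabs_ge0.
Qed.

Lemma obound_comp M N S T : 0 <= M -> obound M S -> obound N T ->
  obound (M * N) (S \o T).
Proof.
by move=> M0 hS hT x; rewrite (le_trans (hS _))// -mulrA ler_wpM2l.
Qed.

Lemma bounded_lincomb c S T : bounded_operator S -> bounded_operator T ->
  bounded_operator (c *: S + T).
Proof.
move=> [lS [M hM]] [lT [N hN]]; split; first exact: linear_lincomb.
by exists (cabs c * M + N); exact: obound_lincomb.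
Qed.

Lemma bounded_comp S T : bounded_operator S -> bounded_operator T ->
  bounded_operator (S \o T).
Proof.
move=> /bounded_operatorP[lS [M M0 hM]] [lT [N hN]].
by split; [exact: linear_comp|exists (M * N); exact: obound_comp (ltW M0) hM hN].
Qed.

Lemma adjoint_radjoint T S : adjoint T S -> radjoint T S.
Proof. by move=> h x y; rewrite -!Re_inner h. Qed.

Lemma radjoint_adjoint T S : linear T -> radjoint T S -> adjoint T S.
Proof.
by move=> lT h x y; apply: rinner_eq_inner => c; rewrite -linear_opZ// h.
Qed.

Lemma radjointC T S : radjoint T S -> radjoint S T.
Proof. by move=> h x y; rewrite rinnerC -h rinnerC. Qed.

Lemma radjoint_linear T S : linear T -> radjoint T S -> linear S.
Proof.
move=> lT h k x y; apply: rinner_separates => z.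
rewrite ![rinner _ z]rinnerC -h !rinnerDr [rinner (T z) y]h; congr (_ + _).
by rewrite !rinner_conjZr -linear_opZ// h.
Qed.

Lemma radjoint_obound M T S : radjoint T S -> obound M T -> obound M S.
Proof.
move=> h hM x.
have [S0|S0] := eqVneq (l2norm (S x)) 0.
  rewrite S0; have [x0|x0] := eqVneq (l2norm x) 0; first by rewrite x0 mulr0.
  have xp : 0 < l2norm x by rewrite lt_neqAle eq_sym x0 l2norm_ge0.
  by have := le_trans (l2norm_ge0 _) (hM x).
have Sp : 0 < l2norm (S x) by rewrite lt_neqAle eq_sym S0 l2norm_ge0.
rewrite -(ler_pM2l Sp) -expr2 l2norm_sqr -rinner_norm2 -h.
apply: le_trans (ler_norm _) _; apply: le_trans (rinner_le _ _) _.
apply: le_trans (ler_wpM2r (l2norm_ge0 _) (hM _)) _.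
by rewrite mulrCA mulrA.
Qed.

Lemma radjoint_lincomb c S S' T T' : linear S -> radjoint S S' -> radjoint T T' ->
  radjoint (c *: S + T) (c^*%C *: S' + T').
Proof.
move=> lS hS hT x y; rewrite !fun_lincombE rinnerDl rinnerDr hT; congr (_ + _).
by rewrite -linear_opZ// hS rinner_conjZ.
Qed.

Lemma lam_linear g : linear (@lam R G g).
Proof. by move=> k x y; apply: l2P => h. Qed.

Lemma lam1 : @lam R G 1%g = idfun.
Proof. by apply/funext => x; apply: l2P => h; rewrite -[LHS]/(x (1^-1 * h)%g) invg1 mul1g. Qed.

Lemma lamM g h : lam g \o lam h = @lam R G (g * h)%g.
Proof. apply/funext => x; apply: l2P => k.
by rewrite -[LHS]/(x (h^-1 * (g^-1 * k))%g) -[RHS]/(x ((g * h)^-1 * k)%g) invgM mulgA.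
Qed.

Lemma lamMx g h x : lam g (lam h x) = lam (g * h)%g x.
Proof. by rewrite -lamM. Qed.

Lemma lam1x x : lam 1%g x = x. Proof. by rewrite lam1. Qed.

Lemma rinner_lam g x y : rinner (lam g x) (lam g y) = rinner x y.
Proof.
apply: rinnerP; have := @has_sum_reindex R G _ _ (fun h => (g^-1 * h)%g)
  (fun h => (g * h)%g) _ _ (has_sum_rinner x y).
by apply => h; rewrite ?mulKg ?mulVKg.
Qed.

Lemma lam_radjoint g : radjoint (@lam R G g) (lam g^-1%g).
Proof. by move=> x y; rewrite -(rinner_lam g^-1%g) lamMx mulVg lam1x. Qed.

Lemma l2norm_lam g x : l2norm (lam g x) = l2norm x.
Proof.
apply/eqP; rewrite -(@eqrXn2 _ 2) ?l2norm_ge0//.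
by rewrite !l2norm_sqr -!rinner_norm2 rinner_lam.
Qed.

Lemma lam_obound g : obound 1 (@lam R G g).
Proof. by move=> x; rewrite l2norm_lam mul1r. Qed.

Lemma lam_bounded g : bounded_operator (@lam R G g).
Proof. by split; [exact: lam_linear|exists 1; exact: lam_obound]. Qed.

Lemma zero_bounded : bounded_operator (0 : op).
Proof.
split; first by move=> k x y; rewrite scaler0 addr0.
by exists 0 => x; rewrite mul0r l2norm0.
Qed.

Inductive lam_span : set op :=
| lam_span0 : lam_span 0
| lam_spanD c g S : lam_span S -> lam_span (c *: lam g + S).

Lemma lam_span_bounded S : lam_span S -> bounded_operator S.
Proof.
elim=> [|c g S' _ ih]; first exact: zero_bounded.
by apply: bounded_lincomb => //; exact: lam_bounded.
Qed.

Lemma lam_span_lincomb c S T : lam_span S -> lam_span T -> lam_span (c *: S + T).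
Proof.
move=> hS hT; elim: hS => [|k g S' _ ih]; first by rewrite scaler0 add0r.
by rewrite scalerDr scalerA -addrA; exact: lam_spanD.
Qed.

Lemma lam_span_lam g : lam_span (lam g).
Proof.
have := lam_spanD 1 g lam_span0.
by rewrite scale1r addr0.
Qed.

Lemma lam_span_comp S T : lam_span S -> lam_span T -> lam_span (S \o T).
Proof.
move=> hS hT.
have hl g : lam_span (lam g \o T).
  elim: hT => [|k h T' _ ih].
    rewrite (_ : _ \o _ = 0); first exact: lam_span0.
    by apply/funext => x; rewrite /= (linear_op0 (@lam_linear g)).
  rewrite (_ : _ \o _ = k *: lam (g * h)%g + (lam g \o T')); first exact: lam_spanD.
  by apply/funext => x; rewrite /= !fun_lincombE lam_linear -lamM.
elim: hS => [|k g S' _ ih].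
  by rewrite (_ : _ \o _ = 0)//; exact: lam_span0.
rewrite (_ : _ \o _ = k *: (lam g \o T) + (S' \o T))//.
exact: lam_span_lincomb.
Qed.

Lemma lam_span_adjoint S : lam_span S -> exists2 S', lam_span S' & radjoint S S'.
Proof.
elim=> [|c g S' hS' [S'' hS'' adj]].
  exists 0; first exact: lam_span0.
  have r0 (x : H) : rinner 0 x = 0 by rewrite -(subrr (0 : H)) rinnerBl subrr.
  by move=> x y; apply: (etrans (r0 y)); rewrite rinnerC; exact/esym/r0.
exists (c^*%C *: lam g^-1%g + S''); first exact: lam_spanD.
by apply: radjoint_lincomb => //; [exact: lam_linear|exact: lam_radjoint].
Qed.

Definition span_closure : set op := [set T | bounded_operator T /\
  forall e : R, 0 < e -> exists2 S, lam_span S & obound e (T - S)].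

Lemma lam_span_closure S : lam_span S -> span_closure S.
Proof.
move=> hS; split; first exact: lam_span_bounded.
move=> e e0; exists S => // x.
by rewrite fun_subE subrr l2norm0 mulr_ge0 ?l2norm_ge0// ltW.
Qed.

(** The reduced algebra is an intersection of C*-subalgebras. Exhibiting this concrete member of the
    family proves that the span of the [lam g] is norm dense in it. *)
Lemma span_closure_cstar : cstar_subalgebra span_closure.
Proof.
split.
- by move=> T [].
- split; first exact/lam_span_closure/lam_span0.
  move=> k S T [bS hS] [bT hT]; split; first exact: bounded_lincomb.
  move=> e e0; have k0 := cabs_ge0 k.
  have [|S' spS' hS'] := hS (e / (2 * (cabs k + 1))).
    by rewrite divr_gt0// mulr_gt0// ltr_wpDl.
  have [|T' spT' hT'] := hT (e / 2); first by rewrite divr_gt0.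
  exists (k *: S' + T'); first exact: lam_span_lincomb.
  rewrite (_ : _ - _ = k *: (S - S') + (T - T')); last first.
    by rewrite scalerBr opprD addrACA.
  apply: oboundW (obound_lincomb k hS' hT').
  rewrite [leRHS](splitr e) lerD2r.
  have k1 : 0 < cabs k + 1 by rewrite ltr_wpDl.
  rewrite (_ : cabs k * _ = e / 2 * (cabs k / (cabs k + 1))); last first.
    by field; rewrite gt_eqF.
  apply: ler_piMr; first by rewrite divr_ge0// ltW.
  by rewrite ler_pdivrMr// mul1r lerDl.
- move=> S T [bS hS] [bT hT]; split; first exact: bounded_comp.
  have [lS [M M0 hM]] := bounded_operatorP bS.
  have [lT [N N0 hN]] := bounded_operatorP bT.
  move=> e e0.
  have [|S' spS' hS'] := hS (e / 2 / N); first by rewrite !divr_gt0.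
  have [lS' [M' M'0 hM']] := bounded_operatorP (lam_span_bounded spS').
  (* The order of choices matters: the precision for [T] is relative to the bound [M'] of the
     approximant [S'], chosen first. *)
  have [|T' spT' hT'] := hT (e / 2 / M'); first by rewrite !divr_gt0.
  exists (S' \o T'); first exact: lam_span_comp.
  move=> x; rewrite (_ : _ x = (S - S') (T x) + S' ((T - T') x)); last first.
    by rewrite !fun_subE /= (linear_opB _ _ lS') addrA subrK.
  apply: le_trans (l2norm_triangle _ _) _.
  rewrite [e in leRHS](splitr e) mulrDl lerD//.
    apply: le_trans (hS' _) _; apply: le_trans (ler_wpM2l _ (hN x)) _.
      by rewrite !divr_ge0// ltW.
    by rewrite mulrA divfK// gt_eqF.
  apply: le_trans (hM' _) _; apply: le_trans (ler_wpM2l (ltW M'0) (hT' x)) _.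
  by rewrite mulrA mulrCA mulfV ?mulr1 ?gt_eqF.
- move=> S T [bS hS] /adjoint_radjoint adj.
  have [lS [M M0 hM]] := bounded_operatorP bS.
  split.
    split; first exact: radjoint_linear lS adj.
    by exists M; exact: radjoint_obound adj hM.
  move=> e e0; have [S' spS' hS'] := hS e e0.
  have [T' spT' adj'] := lam_span_adjoint spS'; exists T' => //.
  apply: radjoint_obound hS' => x y.
  by rewrite !fun_subE rinnerBl rinnerBr adj adj'.
- move=> T bT hT; split => // e e0.
  have e2 : 0 < e / 2 by rewrite divr_gt0.
  have [S [_ hS] TS] := hT _ e2; have [S' spS' SS'] := hS _ e2.
  exists S' => // x; rewrite (_ : _ x = (T x - S x) + (S - S') x); last first.
    by rewrite !fun_subE addrA subrK.
  apply: le_trans (l2norm_triangle _ _) _.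
  by rewrite [e in leRHS](splitr e) mulrDl lerD// TS.
Qed.

End Operators.

(** * Adjoints and square roots in the reduced algebra *)

Section ReducedAlgebra.
Context (R : realType) (G : groupType).
Local Notation C := (R[i]).
Local Notation Re := (@complex.Re R).
Local Notation Im := (@complex.Im R).
Local Notation H := (l2 R G).
Local Notation op := (H -> H).
Local Notation A := (@reduced_cstar R G).
Implicit Types (x y z : H) (c : C) (g h : G) (S T : op).

Lemma reduced_span_closure T : A T -> span_closure T.
Proof.
apply; first exact: span_closure_cstar.
by move=> g; apply: lam_span_closure; exact: lam_span_lam.
Qed.

Lemma reduced_bounded T : A T -> bounded_operator T.
Proof. by move=> /reduced_span_closure[]. Qed.

Lemma reduced_linear T : A T -> linear T.
Proof. by move=> /reduced_bounded[]. Qed.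

Lemma reduced_lam g : A (lam g). Proof. by move=> B _; apply. Qed.

Lemma reduced_idfun : A idfun. Proof. by rewrite -lam1; exact: reduced_lam. Qed.

Lemma reduced_zero : A 0.
Proof. by move=> B [_ [B0 _] _ _ _] _. Qed.

Lemma reduced_lincomb c S T : A S -> A T -> A (c *: S + T).
Proof.
move=> AS AT B hB hl; have [_ [_ Blin] _ _ _] := hB.
by apply: Blin; [exact: AS|exact: AT].
Qed.

Lemma reduced_scale c S : A S -> A (c *: S).
Proof. by move=> AS; rewrite -[_ *: _]addr0; exact: reduced_lincomb reduced_zero. Qed.

Lemma reduced_sub S T : A S -> A T -> A (S - T).
Proof.
by move=> AS AT; rewrite addrC -scaleN1r; exact: reduced_lincomb.
Qed.

Lemma reduced_comp S T : A S -> A T -> A (S \o T).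
Proof.
move=> AS AT B hB hl; have [_ _ Bcomp _ _] := hB.
by apply: Bcomp; [exact: AS|exact: AT].
Qed.

Lemma reduced_closed T : bounded_operator T ->
  (forall e : R, 0 < e -> exists2 S, A S & obound e (T - S)) -> A T.
Proof.
move=> bT hT B hB hl; have [_ _ _ _ Bcl] := hB.
apply: Bcl => // e /hT[S AS hS]; exists S; first exact: AS.
by move=> x; exact: hS.
Qed.

Lemma lam_span_reduced S : lam_span S -> A S.
Proof.
elim=> [|c g S' _ ih]; first exact: reduced_zero.
by apply: reduced_lincomb => //; exact: reduced_lam.
Qed.

Lemma geometric_le0 (t K c : R) : 0 <= c < 1 ->
  (forall n, t <= K * c ^+ n) -> t <= 0.
Proof.
move=> /andP[c0 c1] ht.
have h : K * c ^+ n @[n --> \oo] --> (K * 0 : R).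
  apply: cvgM; first exact: cvg_cst.
  by apply: cvg_expr; rewrite ger0_norm.
rewrite -(mulr0 K) -(cvg_lim _ h)//; apply: limr_ge; first by apply: cvgP h.
exact: nearW.
Qed.

Lemma operator_limit (S : nat -> op) (K c : R) : 0 <= c < 1 ->
  (forall n k, obound (K * c ^+ n) (S (n + k)%N - S n)) ->
  exists T, forall n, obound (K * c ^+ n) (S n - T).
Proof.
move=> /andP[c0 c1] hS.
have ex x : exists v, forall n, l2norm (S n x - v) <= K * c ^+ n * l2norm x.
  apply: l2_cauchy => [n k|]; first exact: hS.
  rewrite -(mul0r (l2norm x)); apply: cvgM; last exact: cvg_cst.
  rewrite -(mulr0 K); apply: cvgM; first exact: cvg_cst.
  by apply: cvg_expr; rewrite ger0_norm.
have [T hT] := choice ex.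
by exists T => n x; exact: hT.
Qed.

(** The definition gives closure under an adjoint once one exists. Existence comes from density:
    adjoints of approximants in the span are explicit, and they form a Cauchy sequence because
    taking adjoints preserves operator bounds. *)
Lemma reduced_adjoint T : A T -> exists T', A T' /\ radjoint T T'.
Proof.
move=> AT; have [bT hT] := reduced_span_closure AT.
have [S hS] : {S : nat -> op & forall n, lam_span (S n) /\ obound (2^-1 ^+ n) (T - S n)}.
  apply: (@choice _ _ (fun n S => lam_span S /\ obound (2^-1 ^+ n) (T - S))) => n.
  by have [|S spS hS] := hT (2^-1 ^+ n); [rewrite exprn_gt0|exists S].
have [S' hS'] : {S' : nat -> op & forall n, lam_span (S' n) /\ radjoint (S n) (S' n)}.
  apply: (@choice _ _ (fun n T => lam_span T /\ radjoint (S n) T)) => n.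
  by have [S' spS' adj] := lam_span_adjoint (hS n).1; exists S'.
have half01 : 0 <= (2^-1 : R) < 1 by lra.
have [|T' hT'] := @operator_limit S' 2 2^-1 half01.
  move=> n k.
  have : radjoint (S (n + k)%N - S n) (S' (n + k)%N - S' n).
    by move=> x y; rewrite !fun_subE rinnerBl rinnerBr (hS' _).2 (hS' _).2.
  move/radjoint_obound; apply => x.
  rewrite (_ : _ x = (T - S n) x - (T - S (n + k)%N) x); last first.
    by rewrite !fun_subE opprB addrC addrA subrK.
  apply: le_trans (l2normB _ _) _; rewrite mulrDl mul1r mulrDl lerD//.
    exact: (hS n).2.
  apply: le_trans ((hS (n + k)%N).2 x) _; rewrite ler_wpM2r ?l2norm_ge0//.
  by apply: ler_wiXn2l; [lra|lra|exact: leq_addr].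
exists T'; have adj : radjoint T T'.
  move=> x y; apply/eqP; rewrite -subr_eq0 -normr_le0.
  apply: (@geometric_le0 _ (3 * (l2norm x * l2norm y)) _ half01) => n.
  rewrite (_ : _ - _ = rinner ((T - S n) x) y + rinner x ((S' n - T') y)); last first.
    by rewrite !fun_subE rinnerBl rinnerBr (hS' n).2; ring.
  apply: le_trans (ler_normD _ _) _.
  have h1 := rinner_le ((T - S n) x) y; have h2 := rinner_le x ((S' n - T') y).
  have h3 := ler_wpM2r (l2norm_ge0 y) ((hS n).2 x).
  have h4 := ler_wpM2l (l2norm_ge0 x) (hT' n y).
  by move: h1 h2 h3 h4; set t := _ ^+ n; lra.
split=> // B hB hl; have [_ _ _ Badj _] := hB.
apply: (Badj T); first exact: AT.
by apply: radjoint_adjoint => //; exact: reduced_linear.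
Qed.

Lemma radjointB S S' T T' : radjoint S S' -> radjoint T T' ->
  radjoint (S - T) (S' - T').
Proof. by move=> hS hT x y; rewrite !fun_subE rinnerBl rinnerBr hS hT. Qed.

Lemma radjoint_idfun : radjoint (@idfun H) idfun. Proof. by []. Qed.

(* The square root is [1 - X], with [X] the fixed point of the contraction
   [X |-> (T + X X) / 2] of the ball of radius [c]. *)
Lemma square_root T (c : R) : A T -> radjoint T T -> 0 <= c < 1 -> obound c T ->
  exists S, [/\ A S, radjoint S S & S \o S = idfun - T].
Proof.
move=> AT adjT c01 hT; have /andP[c0 c1] := c01.
pose half : C := (2^-1 : R)%:C%C.
have halfE : cabs half = 2^-1 by rewrite cabs_real ger0_norm.
pose next (X : op) : op := half *: (T + (X \o X)).
pose X n := iter n next 0.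
have XS n : X n.+1 = half *: (T + (X n \o X n)) by [].
have X0 x : X 0%N x = 0 by [].
have AX0 : A (X 0%N) by exact: reduced_zero.
clearbody X.
have AX n : A (X n).
  elim: n => [//|n ih].
  rewrite XS; apply: reduced_scale; rewrite -[T]scale1r; apply: reduced_lincomb => //.
  exact: reduced_comp.
have lX n : linear (X n) by exact: (reduced_linear (AX n)).
have adjX n : radjoint (X n) (X n).
  elim: n => [|n ih].
    by move=> x y; rewrite !X0 -(subrr (0 : H)) rinnerBl rinnerBr !subrr.
  rewrite XS => x y; rewrite -[LHS]/(rinner (half *: (T x + X n (X n x))) y).
  rewrite -[RHS]/(rinner x (half *: (T y + X n (X n y)))) rinnerZl rinnerZr.
  by rewrite rinnerDl rinnerDr adjT ih ih.
have bX n : obound c (X n).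
  elim: n => [|n ih] x; first by rewrite X0 l2norm0 mulr_ge0 ?l2norm_ge0.
  rewrite XS -[X in l2norm X]/(half *: (T x + X n (X n x))) l2normZ halfE.
  have h1 := l2norm_triangle (T x) (X n (X n x)).
  have h2 := hT x; have h3 := obound_comp c0 ih ih x.
  have h4 : c * c * l2norm x <= c * l2norm x.
    by rewrite ler_wpM2r ?l2norm_ge0// ler_piMl// ltW.
  by move: h1 h2 h3 h4 => /=; lra.
have dX n : obound (c ^+ n) (X n.+1 - X n).
  elim: n => [|n ih] x.
    rewrite fun_subE X0 subr0 expr0; apply: le_trans (bX 1%N x) _.
    by rewrite ler_wpM2r ?l2norm_ge0// ltW.
  rewrite fun_subE XS [X n.+1 in X in _ - X]XS.
  rewrite (_ : _ - _ = half *: (X n.+1 ((X n.+1 - X n) x) + (X n.+1 - X n) (X n x))); last first.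
    rewrite -[LHS]/(half *: (T x + X n.+1 (X n.+1 x)) - half *: (T x + X n (X n x))).
    rewrite -scalerBr !fun_subE (linear_opB _ _ (lX n.+1)); congr (_ *: _).
    by rewrite addrA subrK opprD addrACA subrr add0r.
  rewrite l2normZ halfE.
  have h1 := l2norm_triangle (X n.+1 ((X n.+1 - X n) x)) ((X n.+1 - X n) (X n x)).
  have h2 := bX n.+1 ((X n.+1 - X n) x).
  have h3 := ler_wpM2l c0 (ih x).
  have h4 := ih (X n x).
  have cn0 : 0 <= c ^+ n by rewrite exprn_ge0.
  have h5 := ler_wpM2l cn0 (bX n x).
  rewrite exprS; rewrite mulrA in h3; rewrite mulrA [c ^+ n * c]mulrC in h5.
  by move: h1 h2 h3 h4 h5; lra.
have d1 : 0 < 1 - c by rewrite subr_gt0.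
have ddX n k : obound ((1 - c)^-1 * c ^+ n) (X (n + k)%N - X n).
  (* The exact geometric sum, and not just its upper bound, is what an induction on [k] can
     carry. *)
  suff h : obound ((1 - c)^-1 * (c ^+ n - c ^+ (n + k))) (X (n + k)%N - X n).
    apply: oboundW h; apply: ler_wpM2l; first by rewrite invr_ge0 ltW.
    by rewrite lerBlDr lerDl exprn_ge0.
  elim: k => [|k ih] x.
    by rewrite addn0 fun_subE !subrr l2norm0 mulr0 mul0r.
  rewrite addnS (_ : _ x = (X (n + k).+1 - X (n + k)%N) x + (X (n + k)%N - X n) x); last first.
    by rewrite !fun_subE addrA subrK.
  apply: le_trans (l2norm_triangle _ _) _.
  apply: le_trans (lerD (dX _ x) (ih x)) _.
  rewrite -mulrDl ler_wpM2r ?l2norm_ge0// le_eqVlt; apply/orP; left; apply/eqP.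
  by rewrite exprS; field; rewrite gt_eqF.
have [Y hY] := operator_limit c01 ddX.
set K := (1 - c)^-1 in ddX hY.
have K0 : 0 <= K by rewrite invr_ge0 ltW.
have limit_eq x y (L : R) : (forall n, l2norm (x - y) <= L * c ^+ n) -> x = y.
  move=> h; apply/eqP; rewrite -subr_eq0; apply/eqP/l2norm_eq0/eqP.
  by rewrite eq_le l2norm_ge0 andbT; exact: geometric_le0 c01 h.
have bY : obound (c + K) Y.
  move=> x; rewrite (_ : Y x = X 0%N x - (X 0%N - Y) x); last first.
    by rewrite fun_subE subKr.
  apply: le_trans (l2normB _ _) _; rewrite mulrDl; apply: lerD; first exact: bX.
  by have := hY 0%N x; rewrite expr0 mulr1.
have lY : linear Y.
  move=> k x y; apply: (limit_eq _ _ (K * l2norm (k *: x + y) + cabs k * (K * l2norm x) + K * l2norm y)) => n.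
  rewrite (_ : _ - _ = k *: (X n - Y) x + (X n - Y) y - (X n - Y) (k *: x + y)); last first.
    rewrite !fun_subE lX scalerBr; set u := Y (_ + _).
    have zE (V : zmodType) (p q r s t : V) : t - (q + s) = p - q + (r - s) - (p + r - t).
      by rewrite addrACA -opprD opprB addrCA [RHS]addrC [p + r - _ - _]addrAC subrr add0r addrC.
    exact: zE.
  have h1 := l2normB (k *: (X n - Y) x + (X n - Y) y) ((X n - Y) (k *: x + y)).
  have h2 := l2norm_triangle (k *: (X n - Y) x) ((X n - Y) y).
  have h3 := ler_wpM2l (cabs_ge0 k) (hY n x); rewrite -l2normZ in h3.
  have h4 := hY n y; have h5 := hY n (k *: x + y).
  by move: h1 h2 h3 h4 h5; set t := c ^+ n; lra.
have AY : A Y.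
  apply: reduced_closed.
    by split => //; exists (c + K).
  move=> e e0.
  have [n hn] : exists n, K * c ^+ n <= e.
    apply: contrapT => /forallNP hn.
    have : e <= 0 by apply: (@geometric_le0 _ K c c01) => n; have /negP := hn n; rewrite -ltNge => /ltW.
    by rewrite leNgt e0.
  exists (X n) => // x; rewrite fun_subE -opprB l2normN.
  by apply: le_trans (hY n x) _; rewrite ler_wpM2r ?l2norm_ge0.
have adjY : radjoint Y Y.
  move=> x y; apply/eqP; rewrite -subr_eq0 -normr_le0.
  apply: (@geometric_le0 _ (2 * K * (l2norm x * l2norm y)) _ c01) => n.
  rewrite (_ : _ - _ = rinner x ((X n - Y) y) - rinner ((X n - Y) x) y); last first.
    by rewrite !fun_subE rinnerBl rinnerBr adjX; ring.
  apply: le_trans (ler_normB _ _) _.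
  have h1 := rinner_le ((X n - Y) x) y; have h2 := rinner_le x ((X n - Y) y).
  have h3 := ler_wpM2r (l2norm_ge0 y) (hY n x).
  have h4 := ler_wpM2l (l2norm_ge0 x) (hY n y).
  by move: h1 h2 h3 h4; set t := c ^+ n; lra.
have YY x : Y x + Y x = T x + Y (Y x).
  apply: (limit_eq _ _ (2 * K * l2norm x + c * (K * l2norm x) + K * ((c + K) * l2norm x))) => n.
  have XX : X n.+1 x + X n.+1 x = T x + X n (X n x).
    rewrite XS -[X in X + X]/(half *: (T x + X n (X n x))) -scalerDl.
    by rewrite /half -rmorphD /= (_ : 2^-1 + 2^-1 = 1) ?scale1r//; field.
  rewrite (_ : _ - _ = - ((X n.+1 - Y) x + (X n.+1 - Y) x)
    + (X n ((X n - Y) x) + (X n - Y) (Y x))); last first.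
    rewrite !fun_subE (linear_opB _ _ (lX n)).
    rewrite [X in _ = _ + X](_ : _ = X n (X n x) - Y (Y x)); last first.
      by rewrite addrA subrK.
    have zE (V : zmodType) (p q r s t : V) : p + p = r + s ->
        q + q - (r + t) = - (p - q + (p - q)) + (s - t).
      move=> e; rewrite (addrACA p) e -opprD opprB opprD.
      by rewrite [in RHS](opprD r s) !addrA subrK.
    exact: zE.
  have h1 := l2norm_triangle (- ((X n.+1 - Y) x + (X n.+1 - Y) x)) (X n ((X n - Y) x) + (X n - Y) (Y x)).
  rewrite l2normN in h1.
  have h2 := l2norm_triangle ((X n.+1 - Y) x) ((X n.+1 - Y) x).
  have h3 := l2norm_triangle (X n ((X n - Y) x)) ((X n - Y) (Y x)).
  have h4 : l2norm ((X n.+1 - Y) x) <= K * c ^+ n * l2norm x.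
    apply: le_trans (hY n.+1 x) _; rewrite ler_wpM2r ?l2norm_ge0// ler_wpM2l//.
    by rewrite exprS ler_piMl ?exprn_ge0// ltW.
  have h5 := le_trans (bX n _) (ler_wpM2l c0 (hY n x)).
  have Kn : 0 <= K * c ^+ n by rewrite mulr_ge0// exprn_ge0.
  have h6 := le_trans (hY n (Y x)) (ler_wpM2l Kn (bY x)).
  by move: h1 h2 h3 h4 h5 h6; set t := c ^+ n; lra.
exists (idfun - Y); split.
- by apply: reduced_sub => //; exact: reduced_idfun.
- exact: radjointB radjoint_idfun adjY.
- apply/funext => x; rewrite /= !fun_subE /= (linear_opB _ _ lY).
  rewrite opprB -!addrA; congr (_ + _).
  by rewrite addrCA -opprD YY opprD addrCA subrr addr0.
Qed.

End ReducedAlgebra.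

(** * Stationary states and means on the unit sphere *)

Section States.
Context (R : realType) (G : groupType).
Local Notation C := (R[i]).
Local Notation Re := (@complex.Re R).
Local Notation Im := (@complex.Im R).
Local Notation H := (l2 R G).
Local Notation op := (H -> H).
Local Notation A := (@reduced_cstar R G).
Implicit Types (x y z : H) (c : C) (g h : G) (S T : op).

(** Cauchy-Schwarz for the form [<T x, y>] at [x] and [T x] bounds the fourth power of the norm of
    [T x] by [<T x, x> <T (T x), T x>], and the hypothesis bounds both factors. *)
Lemma positive_obound T (q : R) : linear T -> radjoint T T -> 0 <= q ->
  (forall x, 0 <= rinner (T x) x <= q * norm2 x) -> obound q T.
Proof.
move=> lT adjT q0 hT x.
have := @psd_cauchy_schwarz R G (fun x y => rinner (T x) y) _ _ _ _ x (T x).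
move=> /= cs; have {cs} : rinner (T x) (T x) ^+ 2 <=
    rinner (T x) x * rinner (T (T x)) (T x).
  apply: cs => [y z|y z w|k y z|y].
  - by rewrite adjT rinnerC.
  - by rewrite linear_opD// rinnerDl.
  - by rewrite linear_opZ// rinnerZl.
  - by have /andP[] := hT y.
rewrite rinner_norm2 => cs.
have h : norm2 (T x) ^+ 2 <= q ^+ 2 * norm2 x * norm2 (T x).
  apply: le_trans cs _.
  rewrite (_ : q ^+ 2 * _ * _ = (q * norm2 x) * (q * norm2 (T x))); last by ring.
  by have /andP[? ?] := hT x; have /andP[? ?] := hT (T x); exact: ler_pM.
rewrite l2norm_le ?mulr_ge0 ?l2norm_ge0// exprMn l2norm_sqr.
have [T0|T0] := eqVneq (norm2 (T x)) 0.
  by rewrite T0 mulr_ge0 ?norm2_ge0// exprn_ge0.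
have Tp : 0 < norm2 (T x) by rewrite lt_neqAle eq_sym T0 norm2_ge0.
by rewrite -(ler_pM2r Tp) -expr2.
Qed.

Section OneState.
Context (tau : op -> C).
Hypothesis st : is_state tau.

Lemma state_lincomb c S T : A S -> A T -> tau (c *: S + T) = c * tau S + tau T.
Proof. by case: st => lin _ _; exact: lin. Qed.

Lemma state0 : tau 0 = 0.
Proof.
have := state_lincomb (-1) (@reduced_idfun R G) (@reduced_idfun R G).
by rewrite scaleN1r mulN1r !addNr.
Qed.

Lemma stateZ c S : A S -> tau (c *: S) = c * tau S.
Proof.
move=> AS; have := state_lincomb c AS (@reduced_zero R G).
by rewrite state0 !addr0.
Qed.

Lemma stateB S T : A S -> A T -> tau (S - T) = tau S - tau T.
Proof.
move=> AS AT; have := state_lincomb (-1) AT AS.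
by rewrite scaleN1r mulN1r => h; rewrite [S - T]addrC h addrC.
Qed.

(** For [e > 0] the operator [T + e] is a positive multiple of the square of a self-adjoint element
    of the algebra, to which the positivity axiom applies; then [e] tends to 0. *)
Lemma state_positive T : A T -> radjoint T T ->
  (forall x, 0 <= rinner (T x) x) -> 0 <= tau T.
Proof.
move=> AT adjT T0; have [lT [M M0 hM]] := bounded_operatorP (reduced_bounded AT).
have key (e : R) : 0 < e -> 0 <= tau T + e%:C%C.
  move=> e0; pose s := M + e.
  have s0 : 0 < s by rewrite addr_gt0.
  pose q := M / s.
  have q01 : 0 <= q < 1.
    by rewrite divr_ge0 ?ltW//= ltr_pdivrMr// mul1r ltrDl.
  (* This is [(M - T) / (M + e)]. It is positive with bound [q < 1], as [square_root] requires, and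
     [1 - a] is [(T + e) / (M + e)]. *)
  pose a : op := (- s^-1)%:C%C *: T + (q%:C%C *: idfun).
  have aE x : a x = (- s^-1)%:C%C *: T x + q%:C%C *: x by [].
  have Aa : A a.
    by apply: reduced_lincomb => //; apply: reduced_scale; exact: reduced_idfun.
  have adja : radjoint a a.
    by move=> x y; rewrite !aE rinnerDl rinnerDr !rinnerZl !rinnerZr adjT.
  have TM x : rinner (T x) x <= M * norm2 x.
    apply: le_trans (ler_norm _) _; apply: le_trans (rinner_le _ _) _.
    rewrite -l2norm_sqr expr2 mulrA; exact: (ler_wpM2r (l2norm_ge0 _) (hM x)).
  have ba : obound q a.
    apply: positive_obound => //; [exact: reduced_linear|by case/andP: q01|] => x.
    rewrite aE rinnerDl !rinnerZl rinner_norm2 mulNr addrC subr_ge0.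
    have si : 0 < s^-1 by rewrite invr_gt0.
    apply/andP; split.
      by rewrite /q mulrC mulrAC ler_wpM2r ?(ltW si).
    by rewrite lerBlDr lerDl mulr_ge0// ltW.
  have [b [Ab adjb bb]] := square_root Aa adja q01 ba.
  have := let: And3 _ pos _ := st in pos b b Ab
    (radjoint_adjoint (reduced_linear Ab) adjb).
  rewrite bb stateB//; last exact: reduced_idfun.
  have tau1 : tau idfun = 1 by case: st.
  rewrite state_lincomb//; last by apply: reduced_scale; exact: reduced_idfun.
  rewrite stateZ; last exact: reduced_idfun.
  rewrite tau1 mulr1.
  have -> : 1 - ((- s^-1)%:C%C * tau T + q%:C%C) = (s^-1)%:C%C * (tau T + e%:C%C).
    case: (tau T) => u v; apply/eqP; rewrite eq_complex/=; apply/andP.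
    by split; apply/eqP; rewrite /q /s; field; rewrite gt_eqF.
  by rewrite pmulr_rge0// ltcR invr_gt0.
case E : (tau T) => [u v].
have im : v = 0.
  by have := key 1 ltr01; rewrite E lecE/= => /andP[/eqP]; rewrite addr0.
rewrite lecE/= im eqxx/=; apply/ler_addgt0Pr => e e0.
by have := key e e0; rewrite E lecE/= => /andP[].
Qed.

(** [T] need not be self-adjoint. Write [T = S + i D] with [S] and [D] self-adjoint: [S] has the
    same real quadratic form as [T], hence is positive, while [tau D] is real because [D + M] is
    positive, so [i D] contributes nothing to the real part. *)
Lemma state_Re_ge0 T : A T -> (forall x, 0 <= rinner (T x) x) -> 0 <= Re (tau T).
Proof.
move=> AT T0; have [T' [AT' adj]] := reduced_adjoint AT.
have lT := reduced_linear AT; have lT' := reduced_linear AT'.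
have adj' := radjointC adj.
pose S : op := (2^-1)%:C%C *: T + ((2^-1)%:C%C *: T').
pose D : op := (0 -i* 2^-1)%C *: T + ((0 +i* 2^-1)%C *: T').
have AS : A S by apply: reduced_lincomb => //; exact: reduced_scale.
have AD : A D by apply: reduced_lincomb => //; exact: reduced_scale.
have TE : T = 'i%C *: D + S.
  rewrite /S /D scalerDr !scalerA addrACA -!scalerDl.
  rewrite (_ : 'i%C * _ + _ = 1) ?scale1r; last first.
    by apply/eqP; rewrite eq_complex/=; apply/andP; split; apply/eqP; field.
  rewrite (_ : 'i%C * _ + _ = 0) ?scale0r ?addr0//.
  by apply/eqP; rewrite eq_complex/=; apply/andP; split; apply/eqP; field.
have adjS : radjoint S S.
  move=> x y; rewrite -[LHS]/(rinner ((2^-1)%:C%C *: T x + (2^-1)%:C%C *: T' x) y).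
  rewrite -[RHS]/(rinner x ((2^-1)%:C%C *: T y + (2^-1)%:C%C *: T' y)).
  by rewrite rinnerDl rinnerDr !rinnerZl !rinnerZr adj adj' addrC.
have adjD : radjoint D D.
  move=> x y; rewrite -[LHS]/(rinner ((0 -i* 2^-1)%C *: T x + (0 +i* 2^-1)%C *: T' x) y).
  rewrite -[RHS]/(rinner x ((0 -i* 2^-1)%C *: T y + (0 +i* 2^-1)%C *: T' y)).
  rewrite rinnerDl rinnerDr !rinner_conjZ adj adj' (linear_opZ _ _ lT) (linear_opZ _ _ lT').
  by rewrite /= opprK addrC.
have [lD [M M0 hM]] := bounded_operatorP (reduced_bounded AD).
have tau1 : tau idfun = 1 by case: st.
have ImD : Im (tau D) = 0.
  have : 0 <= tau (D + M%:C%C *: idfun).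
    apply: state_positive.
    - rewrite -[D]scale1r; apply: reduced_lincomb => //.
      by apply: reduced_scale; exact: reduced_idfun.
    - move=> x y; rewrite -[LHS]/(rinner (D x + M%:C%C *: x) y).
      rewrite -[RHS]/(rinner x (D y + M%:C%C *: y)).
      by rewrite rinnerDl rinnerDr rinnerZl rinnerZr adjD.
    - move=> x; rewrite -[X in 0 <= X]/(rinner (D x + M%:C%C *: x) x).
      rewrite rinnerDl rinnerZl rinner_norm2.
      have := rinner_le (D x) x; rewrite ler_norml => /andP[h _].
      have := ler_wpM2r (l2norm_ge0 x) (hM x); rewrite -mulrA -expr2 l2norm_sqr.
      by move: h; lra.
  rewrite -{1}[D]scale1r state_lincomb//; last by apply: reduced_scale; exact: reduced_idfun.
  rewrite stateZ ?tau1 ?mulr1 ?mul1r; last exact: reduced_idfun.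
  by case: (tau D) => u v; rewrite lecE/= addr0 => /andP[/eqP].
have S0 : 0 <= tau S.
  apply: state_positive => // x.
  rewrite -[X in 0 <= X]/(rinner ((2^-1)%:C%C *: T x + (2^-1)%:C%C *: T' x) x).
  rewrite rinnerDl !rinnerZl adj' [rinner x (T x)]rinnerC.
  by have := T0 x; lra.
rewrite TE state_lincomb//.
move: ImD S0; case: (tau D) (tau S) => u v [u' v'] /= ->; rewrite lecE/=.
by move=> /andP[_ ?]; rewrite mulr0 mul0r subr0 add0r.
Qed.

Lemma state_Re_le T (M : R) : A T -> obound M T -> `|Re (tau T)| <= M.
Proof.
move=> AT hM; have tau1 : tau idfun = 1 by case: st.
have A1 := @reduced_idfun R G.
have bnd x : `|rinner (T x) x| <= M * norm2 x.
  apply: le_trans (rinner_le _ _) _; rewrite -l2norm_sqr expr2 mulrA.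
  exact: (ler_wpM2r (l2norm_ge0 _) (hM x)).
rewrite ler_norml; apply/andP; split.
  have := @state_Re_ge0 (M%:C%C *: idfun + T) (reduced_lincomb _ A1 AT).
  rewrite state_lincomb// tau1 mulr1; case: (tau T) => u v /= h.
  rewrite lerNl -subr_ge0 opprK; apply: h => x.
  rewrite -[X in 0 <= X]/(rinner (M%:C%C *: x + T x) x) rinnerDl rinnerZl rinner_norm2.
  by have := bnd x; rewrite ler_norml => /andP[]; lra.
have := @state_Re_ge0 (M%:C%C *: idfun - T) (reduced_sub (reduced_scale _ A1) AT).
rewrite stateB// ?stateZ// ?tau1 ?mulr1; last exact: reduced_scale.
case: (tau T) => u v /= h; rewrite -subr_ge0; apply: h => x.
rewrite -[X in 0 <= X]/(rinner (M%:C%C *: x - T x) x) rinnerBl rinnerZl rinner_norm2.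
by have := bnd x; rewrite ler_norml => /andP[]; lra.
Qed.

End OneState.
End States.

(** * Comparison of states, and the canonical trace *)

Section CanonicalTrace.
Context (R : realType) (G : groupType).
Local Notation C := (R[i]).
Local Notation Re := (@complex.Re R).
Local Notation Im := (@complex.Im R).
Local Notation H := (l2 R G).
Local Notation op := (H -> H).
Local Notation A := (@reduced_cstar R G).
Implicit Types (x y z : H) (c : C) (g h : G) (S T : op).

Lemma inner_lincomb c x y z : inner (c *: x + y) z = c * inner x z + inner y z.
Proof.
case: c => p q; pose ri : C := (- 'i)%C.
have iE w : ri *: (((p +i* q)%C : C) *: x + w) = p%:C%C *: (ri *: x) + (q%:C%C *: x + ri *: w).
  rewrite scalerDr addrA; congr (_ + _); rewrite !scalerA -scalerDl; congr (_ *: _).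
  by apply/eqP; rewrite eq_complex/=; apply/andP; split; apply/eqP; ring.
have cE : ((p +i* q)%C : C) *: x = p%:C%C *: x + (- q)%:C%C *: (ri *: x).
  rewrite !scalerA -scalerDl; congr (_ *: _).
  by apply/eqP; rewrite eq_complex/=; apply/andP; split; apply/eqP; ring.
rewrite !innerE -!/ri iE {1}cE !rinnerDl !rinnerZl.
by apply/eqP; rewrite eq_complex/=; apply/andP; split; apply/eqP; ring.
Qed.

Lemma inner_self x : inner x x = (norm2 x)%:C%C.
Proof.
rewrite innerE rinner_norm2; congr (_ +i* _)%C.
pose ri : C := (- 'i)%C; rewrite -/ri.
have riJ : (ri^*)%C = - ri by apply/eqP; rewrite eq_complex/= !opprK oppr0 !eqxx.
have : rinner (ri *: x) x = - rinner (ri *: x) x.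
  by rewrite [LHS]rinner_conjZ riJ rinnerC scaleNr rinnerN1.
by move: (rinner _ _) => t; lra.
Qed.

Lemma canonical_trace_state : is_state (@canonical_trace R G).
Proof.
split.
- by move=> k a b _ _; rewrite /canonical_trace -inner_lincomb.
- move=> a b Aa adj; have la := reduced_linear Aa.
  have radj := adjoint_radjoint adj.
  have adj' := radjoint_adjoint (radjoint_linear la radj) (radjointC radj).
  by rewrite /canonical_trace /= adj' inner_self lecE/= eqxx norm2_ge0.
- by rewrite -lam1 canonical_trace_lam eqxx.
Qed.

Lemma state_Im (tau : op -> C) T : is_state tau -> A T ->
  Im (tau T) = Re (tau ((- 'i)%C *: T)).
Proof. by move=> st AT; rewrite stateZ//; case: (tau T) => u v /=; ring. Qed.

(** Real parts of states are continuous for the operator bound and the span of the [lam g] is dense;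
    imaginary parts are real parts at [- 'i] times the operator. The whole theorem thereby reduces
    to the values [tau (lam g)]. *)
Lemma states_agree (t t' : op -> C) : is_state t -> is_state t' ->
  (forall g, t (lam g) = t' (lam g)) -> forall T, A T -> t T = t' T.
Proof.
move=> st st' tt'.
have span S : lam_span S -> t S = t' S.
  elim=> [|c g S' hS' ih]; first by rewrite !state0.
  rewrite (state_lincomb st) ?(state_lincomb st')// ?ih ?tt'//;
    try exact: reduced_lam; exact: lam_span_reduced.
have key T : A T -> Re (t T) = Re (t' T).
  move=> AT; apply/eqP; rewrite -subr_eq0 -normr_le0; apply/ler_addgt0Pr => e e0.
  rewrite add0r; have e2 : 0 < e / 2 by rewrite divr_gt0.
  have [_ /(_ _ e2)[S spS hS]] := reduced_span_closure AT.
  have AS := lam_span_reduced spS; have AD := reduced_sub AT AS.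
  have h := state_Re_le st AD hS; have h' := state_Re_le st' AD hS.
  have -> : Re (t T) - Re (t' T) = Re (t (T - S)) - Re (t' (T - S)).
    by rewrite !stateB// (span _ spS); case: (t T) (t' T) (t' S) => u v [u' v'] [u'' v''] /=; ring.
  rewrite (le_trans (ler_normB _ _))//; lra.
move=> T AT; have h1 := key _ AT; have h2 := key _ (reduced_scale (- 'i)%C AT).
move: h1 h2; rewrite -!state_Im//.
by case: (t T) (t' T) => u v [u' v'] /= -> ->.
Qed.

Lemma reduced_inner_act g T : A T -> A (inner_act g T).
Proof.
by move=> AT; apply: reduced_comp (reduced_lam _); apply: reduced_comp AT; exact: reduced_lam.
Qed.

Lemma inner_actM g h T : inner_act g (inner_act h T) = inner_act (g * h)%g T.
Proof. by rewrite /inner_act invgM -!lamM. Qed.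

Lemma inner_act_lam g h : inner_act g (@lam R G h) = lam (g * h * g^-1)%g.
Proof. by rewrite /inner_act !lamM. Qed.

Lemma state_act_state g (tau : op -> C) : is_state tau -> is_state (state_act g tau).
Proof.
move=> st; split.
- move=> k a b Aa Ab; rewrite /state_act -(state_lincomb st); try exact: reduced_inner_act.
  congr tau; apply/funext => x; rewrite /inner_act /= !fun_lincombE /=.
  exact: lam_linear.
- move=> a b Aa adj; have [_ pos _] := st.
  have la := reduced_linear Aa; have radj := adjoint_radjoint adj.
  have Ai := reduced_inner_act g^-1%g Aa.
  have := pos (inner_act g^-1%g a) (inner_act g^-1%g b) Ai.
  rewrite (_ : inner_act g^-1%g b \o inner_act g^-1%g a = inner_act g^-1%g (b \o a)).
    apply; apply: radjoint_adjoint; first exact: reduced_linear.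
    move=> x y; rewrite /inner_act /= lam_radjoint radj [LHS]lam_radjoint.
    by rewrite !invgK.
  apply/funext => x; rewrite /inner_act /= (lamMx g^-1%g^-1%g) mulVg.
  by rewrite lam1x.
- rewrite /state_act (_ : inner_act _ _ = idfun); first by case: st.
  by apply/funext => x; rewrite /inner_act /= lamMx mulgV lam1x.
Qed.

(** Every translate is again a state with the same values on the [lam h], as conjugation fixes the
    identity and only it; by [states_agree] the trace is even invariant. *)
Lemma canonical_trace_stationary (mu : G -> R) : has_sum mu 1 ->
  stationary_state mu (@canonical_trace R G).
Proof.
move=> mu1 a Aa; have st := canonical_trace_state.
have inv g : state_act g (@canonical_trace R G) a = canonical_trace a.
  apply: (states_agree (state_act_state g st) st) => // h.
  rewrite /state_act inner_act_lam !canonical_trace_lam; congr (_%:R); congr nat_of_bool.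
  by rewrite -(inj_eq (mulgI g)) mulg1 !mulgA mulgV mul1g invgK -(inj_eq (mulIg g^-1%g)) mulgK mulgV.
rewrite (_ : summability.partial_sum _ = (fun J =>
    (fsum mu J * Re (canonical_trace a) +i* (fsum mu J * Im (canonical_trace a)))%C)).
  case: (canonical_trace a) => u v /=.
  rewrite -[X in _ --> X](_ : (1 * u +i* (1 * v))%C = (u +i* v)%C); last by rewrite !mul1r.
  by apply: complex_cvg; apply: cvgM => //; exact: cvg_cst.
apply/funext => J; rewrite partial_sumE /fsum !mulr_suml.
elim: (enum_fset J) => [|g r ih]; first by rewrite !big_nil.
rewrite !big_cons ih inv; case: (canonical_trace a) => u v.
by apply/eqP; rewrite eq_complex/=; apply/andP; split; apply/eqP; ring.
Qed.

Lemma stationary_state_Re (mu : G -> R) (tau : op -> C) a :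
  stationary_state mu tau -> A a ->
  has_sum (fun g => mu g * Re (tau (inner_act g^-1%g a))) (Re (tau a)).
Proof.
move=> stat Aa; have := Re_cvg (stat a Aa).
have E J : Re (summability.partial_sum
      (fun g => (mu g)%:C%C * state_act g tau a : C^o) J) =
    fsum (fun g => mu g * Re (tau (inner_act g^-1%g a))) J.
  rewrite partial_sumE /fsum /state_act.
  elim: (enum_fset J) => [|g r ih]; first by rewrite !big_nil.
  rewrite !big_cons -ih; case: (tau _) (\sum_(_ <- _) _) => u v [u' v'] /=; ring.
by rewrite /has_sum; under eq_fun do rewrite E; apply.
Qed.

End CanonicalTrace.

(** * Stationary means by averaging *)

Section MeanAverage.
Context (R : realType) (G : groupType) (mu : G -> R).
Hypothesis mum : prob_mass mu.
Context (T : Type) (act : G -> T -> T).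
Hypothesis actT : is_action act.

Let mu0 := prob_mass_ge0 mum.
Let mu1 := prob_mass_has_sum mum.
Let mE := mean_expect mu0 mu1.

Definition average (F : T -> R) v := expect mu (fun g => F (act g v)).

Lemma mean_iter_average k v : mean (fun F => iter k average F v).
Proof.
elim: k v => [v|k ih v]; first by split => // f _; apply.
have bi f : bdd_fun f -> bdd_fun (iter k average f).
  by move=> [M hM]; exists M => x; apply: (mean_abs_le (ih x)).
split=> [c f g hf hg|f hf f0|]; rewrite /= /average.
- rewrite -(mean_lin mE); [|exact/bdd_fun_comp/bi|exact/bdd_fun_comp/bi].
  by congr (expect mu); apply/funext => g'; rewrite (mean_lin (ih _)).
- apply: (mean_ge0 mE); first exact/bdd_fun_comp/bi.
  by move=> x; apply: (mean_ge0 (ih _)).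
- by rewrite -[RHS](mean_1 mE); congr (expect mu); apply/funext => g'; exact: (mean_1 (ih _)).
Qed.

Lemma bdd_iter_average k F : bdd_fun F -> bdd_fun (iter k average F).
Proof.
by move=> [M hM]; exists M => x; apply: (mean_abs_le (mean_iter_average k x)).
Qed.

(** Cesaro averages of the iterates of [average], followed by a generalized limit. The last clause
    says that averaging does not alter the values at functions on which [m] was stationary already;
    quadratic forms will be such functions. *)
Lemma stationary_mean_exists (m : (T -> R) -> R) : mean m ->
  exists m', [/\ mean m',
    forall F, bdd_fun F -> expect mu (fun g => m' (fun v => F (act g v))) = m' F
  & forall F, bdd_fun F -> (forall h, expect mu (fun g =>
        m (fun v => F (act (h * g)%g v))) = m (fun v => F (act h v))) ->
      m' F = m F].
Proof.
move=> mm.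
have mk k : mean (fun F => m (iter k average F)).
  split=> [c f g hf hg|f hf f0|].
  - rewrite -(mean_lin mm); [|exact: bdd_iter_average|exact: bdd_iter_average].
    by congr m; apply/funext => v; rewrite (mean_lin (mean_iter_average k v)).
  - apply: (mean_ge0 mm); first exact: bdd_iter_average.
    by move=> v; apply: (mean_ge0 (mean_iter_average k v)).
  - by rewrite -[RHS](mean_1 mm); congr m; apply/funext => v;
      rewrite (mean_1 (mean_iter_average k v)).
have [L mL hL] := mean_limit R.
pose a n F := n.+1%:R^-1 * \sum_(k < n.+1) m (iter k average F).
have ma n : mean (a n).
  have n0 : (0 : R) < n.+1%:R by rewrite ltr0n.
  split=> [c f g hf hg|f hf f0|]; rewrite /a.
  - rewrite (eq_bigr (fun k : 'I_n.+1 => c * m (iter k average f) + m (iter k average g))).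
      by rewrite big_split/= -mulr_sumr; ring.
    by move=> k _; rewrite (mean_lin (mk k)).
  - by rewrite mulr_ge0 ?invr_ge0 ?(ltW n0)// sumr_ge0// => k _; exact: (mean_ge0 (mk k)).
  - rewrite (eq_bigr (fun=> 1)); last by move=> k _; exact: (mean_1 (mk k)).
    by rewrite sumr_const card_ord mulVf// gt_eqF.
have ba F : bdd_fun F -> bdd_fun (fun n => a n F).
  by move=> [M hM]; exists M => n; exact: (mean_abs_le (ma n)).
pose m' F := L (fun n => a n F).
have mm' : mean m'.
  split=> [c f g hf hg|f hf f0|]; rewrite /m'.
  - rewrite -(mean_lin mL); [|exact: ba|exact: ba].
    by congr L; apply/funext => n; rewrite (mean_lin (ma n)).
  - by apply: (mean_ge0 mL) => [|n]; [exact: ba|exact: (mean_ge0 (ma n))].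
  - by rewrite -[RHS](mean_1 mL); congr L; apply/funext => n; rewrite (mean_1 (ma n)).
exists m'; split => //.
- move=> F [M hM]; have bF : bdd_fun F by exists M.
  have bQ : bdd_fun (average F) by exact: (bdd_iter_average 1 bF).
  rewrite -(mean_expectC mu0 mu1 mm' (F := fun g v => F (act g v)) (M := M))//.
  rewrite -/(average F); apply/eqP; rewrite -subr_eq0 /m'.
  rewrite -(meanB mL); [|exact: ba|exact: ba].
  apply/eqP; apply: hL; first by apply: bdd_funB; exact: ba.
  (* The sum telescopes, so the defect of stationarity of the averages is of order [1 / n]. *)
  have dE n : a n (average F) - a n F =
      n.+1%:R^-1 * (m (iter n.+1 average F) - m F).
    rewrite /a -mulrBr -sumrB; congr (_ * _).
    rewrite -(big_mkord xpredT (fun k => m (iter k average (average F)) - m (iter k average F))).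
    elim: (n.+1) => [|k ih]; first by rewrite big_nil subrr.
    by rewrite big_nat_recr//= ih -iterSr /= addrC addrA subrK.
  under eq_fun do rewrite dE.
  have h : n.+1%:R^-1 * (2 * M) @[n --> \oo] --> (0 : R).
    by rewrite -(mul0r (2 * M)); apply: cvgM; [exact: cvg_harmonic|exact: cvg_cst].
  have bnd n : `|n.+1%:R^-1 * (m (iter n.+1 average F) - m F)| <= n.+1%:R^-1 * (2 * M).
    rewrite normrM ger0_norm ?invr_ge0// ler_wpM2l ?invr_ge0//.
    rewrite (le_trans (ler_normB _ _))// (_ : 2 * M = M + M) ?lerD//; last by ring.
      exact: (mean_abs_le (mk n.+1)).
    exact: (mean_abs_le mm).
  apply: (@squeeze_cvgr _ _ _ _ (fun n => - (n.+1%:R^-1 * (2 * M))) (fun n => n.+1%:R^-1 * (2 * M))) => //.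
    by apply: nearW => n; rewrite -ler_norml.
  by rewrite -oppr0; exact: cvgN.
- move=> F [M hM] hF.
  (* The induction moves from [F] to its translates, which is why the stationarity hypothesis is
     asked at every [h]. *)
  have key k h : m (iter k average (fun v => F (act h v))) = m (fun v => F (act h v)).
    elim: k h => [//|k ih] h; rewrite iterSr.
    rewrite (_ : average _ = fun v => expect mu (fun g => F (act (h * g)%g v))); last first.
      apply/funext => v; congr (expect mu); apply/funext => g.
      by rewrite (proj2 actT).
    rewrite (mean_expectC mu0 mu1 (mk k) (F := fun g v => F (act (h * g)%g v)) (M := M))//.
    by rewrite -[RHS]hF; congr (expect mu); apply/funext => g; exact: ih.
  have FE : (fun v => F (act 1%g v)) = F by apply/funext => v; rewrite (proj1 actT).
  rewrite /m' (_ : (fun n => a n F) = fun=> m F) ?(mean_cst mL)//.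
  apply/funext => n; rewrite /a (eq_bigr (fun=> m F)).
    by rewrite sumr_const card_ord -[X in _ * X]mulr_natl mulKf// pnatr_eq0.
  by move=> k _; rewrite -{1}FE key FE.
Qed.

End MeanAverage.

(** * From states to means on the unit sphere *)

Section StateMean.
Context (R : realType) (G : groupType).
Local Notation Re := (@complex.Re R).
Local Notation H := (l2 R G).
Local Notation A := (@reduced_cstar R G).

(** On unit vectors the quadratic form of a bounded operator is a bounded function, and that of the
    identity is the constant 1. *)
Definition sphere := {v : H | norm2 v = 1}.

Lemma sphere_lam_subproof (g : G) (v : sphere) : norm2 (lam g (sval v)) = 1.
Proof. by rewrite -rinner_norm2 rinner_lam rinner_norm2; case: v. Qed.

Definition sphere_act (g : G) (v : sphere) : sphere :=
  exist _ (lam g (sval v)) (sphere_lam_subproof g v).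

Lemma sphere_inj (u v : sphere) : sval u = sval v -> u = v.
Proof. by case: u v => [u hu] [v hv] /= uv; exact: eq_exist. Qed.

Lemma sphere_action : is_action sphere_act.
Proof.
split=> [v|g h v]; apply: sphere_inj; first exact: lam1x.
by rewrite /= lamMx.
Qed.

Definition qform (T : H -> H) (v : sphere) : R := rinner (T (sval v)) (sval v).

Lemma qform_bound T (M : R) v : obound M T -> `|qform T v| <= M.
Proof.
move=> hM; case: v => v v1; rewrite /qform /=.
have n1 : l2norm v = 1 by rewrite /l2norm -/(norm2 v) v1 sqrtr1.
apply: le_trans (rinner_le _ _) _; rewrite n1 mulr1.
by have := hM v; rewrite n1 mulr1.
Qed.

Lemma qform_bdd T : A T -> bdd_fun (qform T).
Proof.
move=> /reduced_bounded/bounded_operatorP[_ [M _ hM]].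
by exists M => v; exact: qform_bound.
Qed.

(** The positivity needed for the extension is [state_Re_ge0], after normalizing vectors. It also
    shows that the real part of [tau T] depends on the quadratic form of [T] alone. *)
Lemma state_mean (tau : (H -> H) -> R[i]) : is_state tau ->
  exists2 m, mean m & forall T, A T -> m (qform T) = Re (tau T).
Proof.
move=> st; have tau1 : tau idfun = 1 by case: st.
have [|m mm hm] := @mean_of_positive_graph R sphere
  [set p | exists2 T, A T & p = (qform T, Re (tau T))].
  split.
  - by move=> _ [T AT ->]; exact: qform_bdd.
  - move=> c _ _ [S AS ->] [T AT ->] /=; exists (c%:C%C *: S + T).
      exact: reduced_lincomb.
    congr (_, _); first by apply/funext => v; rewrite /qform fun_lincombE rinnerDl rinnerZl.
    by rewrite state_lincomb//; case: (tau S) (tau T) => u v [u' v'] /=; ring.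
  - exists idfun; first exact: reduced_idfun.
    rewrite tau1; congr (_, _); apply/funext => -[v v1].
    by rewrite /qform /= rinner_norm2.
  - move=> _ [T AT ->] /= T0; apply: state_Re_ge0 => // x.
    have [x0|x0] := eqVneq (norm2 x) 0.
      by rewrite (norm2_eq0 x0) (linear_op0 (reduced_linear AT)) rinner_norm2 norm2_ge0.
    have xp : 0 < l2norm x.
      rewrite lt_neqAle l2norm_ge0 andbT eq_sym; apply: contra x0 => /eqP x0.
      by rewrite -l2norm_sqr x0 expr0n.
    pose k := (l2norm x)^-1.
    have k1 : norm2 (k%:C%C *: x) = 1.
      rewrite norm2Z /sqabs /= expr0n addr0 -l2norm_sqr -exprMn mulVf ?expr1n//.
      by rewrite gt_eqF.
    have := T0 (exist _ _ k1); rewrite /qform /= (linear_opZ _ _ (reduced_linear AT)).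
    rewrite rinnerZl rinnerZr mulrA pmulr_rge0//.
    by rewrite mulr_gt0// invr_gt0.
by exists m => // T AT; exact: (hm (qform T, Re (tau T)) (ex_intro2 _ _ T AT erefl)).
Qed.

Lemma qform_sphere_act T g : qform (inner_act g^-1%g T) = fun v => qform T (sphere_act g v).
Proof.
apply/funext => v; rewrite /qform /inner_act /= invgK lam_radjoint.
by rewrite invgK.
Qed.

(** Translating a quadratic form on the sphere conjugates its operator. Stationarity of [tau] at all
    conjugates of [T] is thus the condition under which averaging preserves the value at
    [qform T]. *)
Lemma stationary_state_mean (mu : G -> R) (tau : (H -> H) -> R[i]) :
  prob_mass mu -> is_state tau -> stationary_state mu tau ->
  exists m, [/\ mean m, forall T, A T -> m (qform T) = Re (tau T)
  & forall F, bdd_fun F -> expect mu (fun g => m (fun v => F (sphere_act g v))) = m F].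
Proof.
move=> mum st stat; have [m mm hm] := state_mean st.
have [m' [mm' statm' hm']] := stationary_mean_exists mum sphere_action mm.
exists m'; split => // T AT; rewrite -hm//; apply: hm'; first exact: qform_bdd.
move=> h; apply: has_sum_expect.
- exact: prob_mass_ge0.
- exact: prob_mass_has_sum.
- have [M hM] := qform_bdd AT; exists M => g; apply: (mean_abs_le mm) => v; exact: hM.
- rewrite -qform_sphere_act hm; last exact: reduced_inner_act.
  have := stationary_state_Re stat (reduced_inner_act h^-1%g AT).
  congr (has_sum _ _); apply/funext => g; congr (_ * _).
  rewrite -qform_sphere_act hm; last exact: reduced_inner_act.
  by rewrite inner_actM invgM.
Qed.

End StateMean.

(** * Decay of the coefficients *)

Section OrbitMeans.
Context (R : realType) (G : groupType).
Local Notation H := (l2 R G).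
Local Notation sphere := (sphere R G).
Context (K : Type) (act : G -> K -> K) (y0 : K).
Hypothesis actK : is_action act.

Definition weight (v : sphere) (g : G) : R := sqabs (sval v g).

Lemma weight_ge0 v g : 0 <= weight v g. Proof. exact: sqabs_ge0. Qed.

Lemma weight_has_sum v : has_sum (weight v) 1.
Proof. by have := has_sum_norm2 (sval v); rewrite (svalP v). Qed.

(* [orbit_mean f v] integrates [f] against the image of the probability
   [|v|^2] on [G] under the orbit map of [y0]. *)
Definition orbit_mean (f : K -> R) (v : sphere) : R :=
  expect (weight v) (fun g => f (act g y0)).

Lemma mean_orbit_mean v : mean (fun f => orbit_mean f v).
Proof.
exact: (mean_comp (fun g => act g y0) (mean_expect (weight_ge0 v) (weight_has_sum v))).
Qed.

Lemma bdd_orbit_mean f : bdd_fun f -> bdd_fun (orbit_mean f).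
Proof.
by move=> [M hM]; exists M => v; exact: (mean_abs_le (mean_orbit_mean v)).
Qed.

(** The weights of [lam h v] are those of [v] translated by [h], and the orbit map intertwines
    translation with [act h]. *)
Lemma orbit_mean_act f h v : bdd_fun f ->
  orbit_mean f (sphere_act h v) = orbit_mean (fun x => f (act h x)) v.
Proof.
move=> bf; apply: has_sum_expect.
- exact: weight_ge0.
- exact: weight_has_sum.
- exact: bdd_fun_comp.
have hs := expect_has_sum (weight_ge0 v) (weight_has_sum v)
  (bdd_fun_comp (fun g => act g y0) (bdd_fun_comp (act h) bf)).
have := @has_sum_reindex R G _ _ (fun g => (h^-1 * g)%g) (fun g => (h * g)%g) _ _ hs.
move=> /(_ (mulVKg h) (mulKg h)); congr (has_sum _ _); apply/funext => g /=.
by rewrite -(proj2 actK) mulVKg.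
Qed.

Lemma mean_orbit_mean_comp (m : (sphere -> R) -> R) : mean m ->
  mean (fun f => m (orbit_mean f)).
Proof.
move=> mm; split=> [c f g hf hg|f hf f0|].
- rewrite -(mean_lin mm); [|exact: bdd_orbit_mean|exact: bdd_orbit_mean].
  by congr m; apply/funext => v; rewrite (mean_lin (mean_orbit_mean v)).
- apply: (mean_ge0 mm); first exact: bdd_orbit_mean.
  by move=> v; apply: (mean_ge0 (mean_orbit_mean v)).
- by rewrite -[RHS](mean_1 mm); congr m; apply/funext => v; exact: (mean_1 (mean_orbit_mean v)).
Qed.

Lemma weighted_young (p q t e : R) : 0 < e ->
  `|p * q * t| <= 2^-1 * (e * p ^+ 2 + e^-1 * (q ^+ 2 * t ^+ 2)).
Proof.
move=> e0; have ei : 0 < e^-1 by rewrite invr_gt0.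
have h1 : 0 <= e^-1 * (e * p + q * t) ^+ 2 by rewrite mulr_ge0 ?sqr_ge0 ?ltW.
have h2 : 0 <= e^-1 * (e * p - q * t) ^+ 2 by rewrite mulr_ge0 ?sqr_ge0 ?ltW.
have E1 : e^-1 * (e * p + q * t) ^+ 2 =
    e * p ^+ 2 + e^-1 * (q ^+ 2 * t ^+ 2) + 2 * (p * q * t).
  by field; rewrite gt_eqF.
have E2 : e^-1 * (e * p - q * t) ^+ 2 =
    e * p ^+ 2 + e^-1 * (q ^+ 2 * t ^+ 2) - 2 * (p * q * t).
  by field; rewrite gt_eqF.
by rewrite E1 in h1; rewrite E2 in h2; rewrite ler_norml; apply/andP; split; lra.
Qed.

Lemma reprod_young (c c' : R[i]) (t e : R) : 0 < e ->
  `|reprod c c' * t| <= 2^-1 * (e * sqabs c + e^-1 * (sqabs c' * t ^+ 2)).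
Proof.
move=> e0; case: c c' => a b [a' b']; rewrite /reprod /sqabs /= mulrDl.
have h1 := weighted_young a a' t e0; have h2 := weighted_young b b' t e0.
by rewrite (le_trans (ler_normD _ _))//; lra.
Qed.

Lemma reprodC (c c' : R[i]) : reprod c c' = reprod c' c.
Proof. by rewrite /reprod mulrC [X in _ + X]mulrC. Qed.

(* Both [f x - c] and [f (a x) - c'] occur with [x = g y0] and the same weight
   in the quadratic form of [z *: lam a], up to the substitution [g |-> a g];
   their difference is the constant [c - c']. *)
Lemma qform_lam_bound (f : K -> R) (z : R[i]) a v (c c' e : R) : bdd_fun f ->
  sqabs z = 1 -> 0 < e ->
  `|c - c'| * `|qform (z *: lam a) v| <= e + (2 * e)^-1 *
    (orbit_mean (fun x => (f x - c) ^+ 2) v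
     + orbit_mean (fun x => (f (act a x) - c') ^+ 2) v).
Proof.
move=> bf z1 e0.
pose p g := z * sval v (a^-1 * g)%g; pose q g := sval v g : R[i].
pose f1 g := f (act g y0).
have hT : has_sum (fun g => reprod (p g) (q g)) (qform (z *: lam a) v).
  exact: has_sum_rinner.
have pE g : sqabs (p g) = weight v (a^-1 * g)%g.
  by rewrite /p sqabsM z1 mul1r.
have w1 := weight_has_sum v.
have w1a : has_sum (fun g => weight v (a^-1 * g)%g) 1.
  apply: (@has_sum_reindex R G _ _ (fun g => (a^-1 * g)%g) (fun g => (a * g)%g) _ _ w1).
    exact: mulVKg.
  exact: mulKg.
have bsq k (d : R) : bdd_fun k -> bdd_fun (fun x : K => (k x - d) ^+ 2).
  by move=> bk; apply: bdd_funX; apply: bdd_funB => //; exact: bdd_fun_cst.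
have o1 := expect_has_sum (weight_ge0 v) w1 (bdd_fun_comp (fun g => act g y0) (bsq f c bf)).
have o2 := expect_has_sum (weight_ge0 v) w1
  (bdd_fun_comp (fun g => act g y0) (bsq _ c' (bdd_fun_comp (act a) bf))).
have o2a := @has_sum_reindex R G _ _ (fun g => (a^-1 * g)%g) (fun g => (a * g)%g)
  (mulVKg a) (mulKg a) o2.
have hs := has_sumD
  (has_sumZ 2^-1 (has_sumD (has_sumZ e w1) (has_sumZ e^-1 o2a)))
  (has_sumZ 2^-1 (has_sumD (has_sumZ e w1a) (has_sumZ e^-1 o1))).
rewrite -normrM; apply: le_trans (has_sum_abs_le _ (has_sumZ (c - c') hT) hs) _ => /=.
  move=> g.
  have -> : (c - c') * reprod (p g) (q g) =
      reprod (q g) (p g) * (f1 g - c') - reprod (p g) (q g) * (f1 g - c).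
    by rewrite (reprodC (q g)); ring.
  apply: le_trans (ler_normB _ _) _; apply: lerD.
    have := reprod_young (q g) (p g) (f1 g - c') e0; rewrite pE.
    by rewrite -(proj2 actK) mulVKg.
  by have := reprod_young (p g) (q g) (f1 g - c) e0; rewrite pE.
rewrite -/(orbit_mean (fun x => (f x - c) ^+ 2) v).
rewrite -/(orbit_mean (fun x => (f (act a x) - c') ^+ 2) v).
rewrite le_eqVlt; apply/orP; left; apply/eqP.
by field; rewrite gt_eqF.
Qed.

End OrbitMeans.

Lemma cvg_sum0 (R : realType) (J : Type) (r : seq J) (f : nat -> J -> R) :
  (forall j, f k j @[k --> \oo] --> (0 : R)) ->
  \sum_(j <- r) f k j @[k --> \oo] --> (0 : R).
Proof.
move=> hf; elim: r => [|j r ih].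
  by under eq_fun do rewrite big_nil; exact: cvg_cst.
rewrite (_ : (fun k => _) = (fun k => f k j + \sum_(j <- r) f k j)).
  by rewrite -[X in _ --> X]addr0; apply: cvgD.
by apply/funext => k; rewrite big_cons.
Qed.

Section MovedPoints.
Context (R : realType) (K : ptopologicalType).
Hypotheses (cK : compact [set: K]) (hK : hausdorff_space K).

(** A Urysohn function with value 1 at [x] and 0 at [s x] has squared oscillation above [1 / 2] on a
    neighbourhood of [x]. Finitely many such neighbourhoods cover [C], and the factor 2 raises the
    bound to 1. *)
Lemma moved_points_cover (s : K -> K) (C : set K) : continuous s -> compact C ->
  (forall x, C x -> s x <> x) -> exists (D : {fset K}) (u : K -> K -> R),
    (forall x, continuous (u x)) /\
    forall y, C y -> 1 <= \sum_(x <- D) 2 * (u x y - u x (s y)) ^+ 2.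
Proof.
move=> cs cC sC.
have [u hu] : {u : K -> K -> R & forall x, continuous (u x) /\
    (C x -> u x x = 1 /\ u x (s x) = 0)}.
  apply: (@choice _ _ (fun x ux => continuous (ux : K -> R) /\
    (C x -> ux x = 1 /\ ux (s x) = 0))) => x.
  have [Cx|nCx] := pselect (C x); last first.
    by exists (fun=> 0); split => // y; exact: cst_continuous.
  have oU : open (~` [set s x]).
    by apply: closed_openC; apply: compact_closed => //; exact: compact_set1.
  have Ux : (~` [set s x]) x by move=> /= /esym; exact: sC.
  have [f [cf f01 fx]] := @separating_function R K cK hK _ x oU Ux.
  exists f; split => // _; split => //; have /andP[f0] := f01 (s x).
  by rewrite indicE memNset//= => f1; apply/eqP; rewrite eq_le f0 f1.
pose W x := [set y | 2^-1 < (u x y - u x (s y)) ^+ 2].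
have oW x : C x -> open (W x).
  move=> _; have [cu _] := hu x; apply: (@open_comp _ _ (fun y => (u x y - u x (s y)) ^+ 2)
    [set t | 2^-1 < t]); last exact: open_gt.
  move=> y _; rewrite /continuous_at expr2; under eq_fun do rewrite expr2.
  have h : (fun y => u x y - u x (s y)) @ y --> u x y - u x (s y).
    apply: cvgB; first exact: cu.
    by apply: (@continuous_comp _ _ _ s (u x)); [exact: cs|exact: cu].
  exact: cvgM.
move: cC; rewrite compact_cover => /(_ K C W oW) [|D DC CD].
  move=> x Cx; exists x => //; have [_ /(_ Cx)[ux usx]] := hu x.
  by rewrite /W /= ux usx subr0 expr1n invf_lt1// ltr1n.
exists D, u; split; first by move=> x; have [] := hu x.
move=> y /CD[x /= xD Wxy]; rewrite (big_fsetD1 x)//=.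
rewrite -[leLHS]addr0 lerD//; last first.
  by apply: sumr_ge0 => w _; rewrite mulr_ge0// sqr_ge0.
by move: Wxy; rewrite /W /=; lra.
Qed.

End MovedPoints.

(** * Mean decay of the coefficients of a non-trivial group element *)

Section Decay.
Context (R : realType) (G : groupType) (mu : G -> R).
Hypothesis mum : prob_mass mu.
Local Notation H := (l2 R G).
Local Notation sphere := (sphere R G).
Context (K : ptopologicalType) (act : G -> K -> K) (y0 : K).
Hypotheses (cK : compact [set: K]) (hK : hausdorff_space K)
  (actK : is_action act) (cact : forall g, continuous (act g)).
Context (m : (sphere -> R) -> R).
Hypotheses (mm : mean m) (statm : forall F, bdd_fun F ->
  expect mu (fun g => m (fun v => F (sphere_act g v))) = m F).

Let I f := m (orbit_mean act y0 f).
Let mI : mean I := mean_orbit_mean_comp act y0 mm.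
Let mE k := mean_iter_markov mum k 1%g.

Lemma mean_sphere_act_harmonic F k : bdd_fun F ->
  iter k (markov_op mu) (fun h => m (fun v => F (sphere_act h v))) 1%g = m F.
Proof.
move=> bF; rewrite iter_markov_harmonic => [|h].
  by congr m; apply/funext => v; rewrite (proj1 (@sphere_action R G)).
rewrite /markov_op -(statm (bdd_fun_comp (sphere_act h) bF)).
congr (expect mu); apply/funext => g; congr m; apply/funext => v.
by rewrite (proj2 (@sphere_action R G)).
Qed.

Lemma orbit_mean_translate f h : bdd_fun f ->
  m (fun v => orbit_mean act y0 f (sphere_act h v)) = I (fun x => f (act h x)).
Proof. by move=> bf; congr m; apply/funext => v; rewrite orbit_mean_act. Qed.

Lemma orbit_mean_stationary f : bdd_fun f ->
  expect mu (fun g => I (fun x => f (act g x))) = I f.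
Proof.
move=> bf; rewrite -[RHS]statm; last exact: bdd_orbit_mean.
by congr (expect mu); apply/funext => g; rewrite orbit_mean_translate.
Qed.

Lemma orbit_mean_harmonic f k : bdd_fun f ->
  iter k (markov_op mu) (fun h => I (fun x => f (act h x))) 1%g = I f.
Proof.
move=> bf; rewrite -[RHS](mean_sphere_act_harmonic k); last exact: bdd_orbit_mean.
by congr (iter k _ _ _); apply/funext => h; rewrite orbit_mean_translate.
Qed.

Context (z : R[i]) (a : G).
Hypothesis z1 : sqabs z = 1.
Let T : H -> H := z *: lam a.
(** A harmonic function of [h]: its average along the walk is the mean of [|qform T|] at every time,
    so bounding that average at one large time is enough. *)
Let t h := m (fun v => `|qform T (sphere_act h v)|).

Let bT : bdd_fun (fun v => `|qform T v|).
Proof.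
by apply/bdd_fun_norm/qform_bdd; apply: reduced_scale; exact: reduced_lam.
Qed.

Let t_ge0 h : 0 <= t h.
Proof. by apply: (mean_ge0 mm) => //; exact: (bdd_fun_comp (sphere_act h) bT). Qed.

Let qform_le1 v : `|qform T v| <= 1.
Proof.
apply: qform_bound => x.
by rewrite /T l2normZ /cabs z1 sqrtr1 l2norm_lam.
Qed.

Let t_le1 h : t h <= 1.
Proof.
rewrite -(mean_1 mm); apply: (mean_le mm) => //; first exact: (bdd_fun_comp (sphere_act h) bT).
exact: bdd_fun_cst.
Qed.

Let tv f h := translate_variance act I f h.

Let tv_centered f h : bdd_fun f ->
  I (fun x => (f (act h x) - I (fun x => f (act h x))) ^+ 2) = tv f h.
Proof. by move=> bf; rewrite -(mvariance_centered mI)//; exact: bdd_fun_comp. Qed.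

(** With [c] and [c'] the means of [f] and of [f] composed with [act a], both translated by [h], the
    oscillation is a variance plus [(c - c') ^+ 2]. The variance is multiplied by [t h <= 1]. The
    square is at most [2 * M * |c - c'|], and [|c - c'| * t h] is controlled by averaging
    [qform_lam_bound] over the sphere. *)
Lemma oscillation_bound f M e h : (forall x, `|f x| <= M) -> 0 < e ->
  I (fun x => (f (act h x) - f (act a (act h x))) ^+ 2) * t h <=
  tv (fun x => f x - f (act a x)) h +
  2 * M * (e + (2 * e)^-1 * (tv f h + tv (fun x => f (act a x)) h)).
Proof.
move=> fM e0; have bf : bdd_fun f by exists M.
have bfa : bdd_fun (fun x => f (act a x)) by exact: bdd_fun_comp.
have bh (k : K -> R) : bdd_fun k -> bdd_fun (fun x => k (act h x)) by exact: bdd_fun_comp.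
have bsq (k : K -> R) c : bdd_fun k -> bdd_fun (fun x : K => (k x - c) ^+ 2).
  by move=> bk; apply: bdd_funX; apply: bdd_funB => //; exact: bdd_fun_cst.
pose c := I (fun x => f (act h x)); pose c' := I (fun x => f (act a (act h x))).
have cM : `|c| <= M by exact: (mean_abs_le mI).
have c'M : `|c'| <= M by exact: (mean_abs_le mI).
have osc : I (fun x => (f (act h x) - f (act a (act h x))) ^+ 2) =
    tv (fun x => f x - f (act a x)) h + (c - c') ^+ 2.
  have := mvariance_cst mI 0 (bh _ (bdd_funB bf bfa)).
  under eq_fun do rewrite subr0.
  by move=> ->; rewrite subr0 (meanB mI (bh _ bf) (bh _ bfa)).
have tcc : `|c - c'| * t h <= e + (2 * e)^-1 * (tv f h + tv (fun x => f (act a x)) h).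
  rewrite -(tv_centered h bf) -(tv_centered h bfa) -/c -/c'.
  have bv (k : K -> R) : bdd_fun k -> bdd_fun (fun v => orbit_mean act y0 k (sphere_act h v)).
    by move=> bk; apply: bdd_fun_comp; exact: bdd_orbit_mean.
  have btv : bdd_fun (fun v => `|qform T (sphere_act h v)|) by exact: (bdd_fun_comp (sphere_act h) bT).
  rewrite -(orbit_mean_translate h (bsq f c bf)) -(orbit_mean_translate h (bsq _ c' bfa)).
  have b1 := bv _ (bsq f c bf); have b2 := bv _ (bsq _ c' bfa).
  have b3 := bdd_funZ (2 * e)^-1 (bdd_funD b1 b2).
  rewrite -(meanZ mm _ btv).
  apply: le_trans (_ : m (fun v => e + (2 * e)^-1 *
    (orbit_mean act y0 (fun x => (f x - c) ^+ 2) (sphere_act h v) +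
     orbit_mean act y0 (fun x => (f (act a x) - c') ^+ 2) (sphere_act h v))) <= _); last first.
    by rewrite (meanD mm (bdd_fun_cst _ e) b3) (mean_cst mm)
      (meanZ mm _ (bdd_funD b1 b2)) (meanD mm b1 b2).
  apply: (mean_le mm).
  - exact: bdd_funZ.
  - by apply: bdd_funD; [exact: bdd_fun_cst|apply: bdd_funZ; exact: bdd_funD].
  - by move=> v; apply: qform_lam_bound.
rewrite osc mulrDl; apply: lerD.
  rewrite ler_piMr//; apply: (mvariance_ge0 mI).
  exact: (bh _ (bdd_funB bf bfa)).
have cc : (c - c') ^+ 2 <= 2 * M * `|c - c'|.
  rewrite -real_normK ?num_real// expr2 ler_wpM2r//.
  by rewrite (le_trans (ler_normB _ _))// mulr_natl mulr2n lerD.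
apply: le_trans (ler_wpM2r (t_ge0 h) cc) _.
rewrite -(mulrA (2 * M)); apply: ler_wpM2l => //.
by rewrite mulr_ge0// (le_trans _ (fM y0)).
Qed.

Hypothesis vI : forall f, continuous f -> variance_vanishes mu act I f.

Lemma oscillation_decay (f : K -> R) : continuous f ->
  iter k (markov_op mu)
    (fun h => I (fun x => (f (act h x) - f (act a (act h x))) ^+ 2) * t h) 1%g
  @[k --> \oo] --> (0 : R).
Proof.
move=> cf; have cfa : continuous (fun x => f (act a x)).
  by move=> x; apply: continuous_comp; [exact: cact|exact: cf].
have cd : continuous (fun x => f x - f (act a x)).
  by move=> x; apply: cvgB; [exact: cf|exact: cfa].
have bf := continuous_bdd cK cf; have bfa := continuous_bdd cK cfa.
have bd := continuous_bdd cK cd.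
have btv (k : K -> R) : bdd_fun k -> bdd_fun (tv k) by exact: bdd_translate_variance.
have [M [M0 fM]] : exists M, 0 < M /\ forall x, `|f x| <= M.
  have [M hM] := bf; exists (M + 1); split=> [|x].
    by rewrite ltr_wpDl// (le_trans _ (hM y0)).
  by rewrite (le_trans (hM x))// lerDl.
have bt : bdd_fun t.
  by apply: (@bdd_fun_itv _ _ _ 1) => h; rewrite t_ge0 t_le1.
pose osc h := I (fun x => (f (act h x) - f (act a (act h x))) ^+ 2).
have bosc : bdd_fun osc.
  have [N hN] := bdd_funX 2 bd; exists N => h; apply: (mean_abs_le mI) => x.
  exact: hN.
have osc0 h : 0 <= osc h.
  apply: (mean_ge0 mI); first exact: (bdd_fun_comp (act h) (bdd_funX 2 bd)).
  by move=> x; exact: sqr_ge0.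
apply/cvgrPdist_lt => e e0.
(* Once the variances have vanished, the bound of [oscillation_bound] with parameter [d] tends to
   [2 * M * d = e / 2]. *)
have d0 : 0 < e / (4 * M) by rewrite divr_gt0// mulr_gt0.
pose d := e / (4 * M).
pose V k g := iter k (markov_op mu) (tv g) 1%g.
have lim : V k (fun x => f x - f (act a x)) +
    2 * M * (d + (2 * d)^-1 * (V k f + V k (fun x => f (act a x))))
    @[k --> \oo] --> 0 + 2 * M * (d + (2 * d)^-1 * (0 + 0)).
  apply: cvgD; first exact: vI.
  apply: cvgM; first exact: cvg_cst.
  apply: cvgD; first exact: cvg_cst.
  apply: cvgM; first exact: cvg_cst.
  by apply: cvgD; exact: vI.
have limE : 0 + 2 * M * (d + (2 * d)^-1 * (0 + 0)) = e / 2.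
  by rewrite /d; field; rewrite !gt_eqF.
rewrite limE in lim.
have e2 : 0 < e / 2 by rewrite divr_gt0.
have /cvgrPdist_lt/(_ _ e2) := lim; apply: filterS => k.
rewrite sub0r normrN ltr_norml => /andP[+ _].
rewrite ger0_norm; last first.
  apply: (mean_ge0 (mE k)); first exact: (bdd_funM bosc bt).
  by move=> h; rewrite mulr_ge0// osc0.
move=> h1; apply: (@le_lt_trans _ _ (V k (fun x => f x - f (act a x)) +
    2 * M * (d + (2 * d)^-1 * (V k f + V k (fun x => f (act a x)))))); last lra.
have b1 := btv _ bf; have b2 := btv _ bfa; have b3 := btv _ bd.
have b4 := bdd_funZ (2 * d)^-1 (bdd_funD b1 b2).
have b5 := bdd_funD (bdd_fun_cst _ d) b4.
have b6 := bdd_funZ (2 * M) b5.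
rewrite -(meanD (mE k) b1 b2) -(meanZ (mE k) _ (bdd_funD b1 b2)).
rewrite -[X in _ * (X + _)](mean_cst (mE k)) -(meanD (mE k) (bdd_fun_cst _ d) b4).
rewrite -(meanZ (mE k) _ b5) -(meanD (mE k) b3 b6).
apply: (mean_le (mE k)).
- exact: (bdd_funM bosc bt).
- exact: (bdd_funD b3 b6).
- by move=> h; exact: oscillation_bound.
Qed.

Hypothesis free : open_content I [set x | act a x <> x] = 1.

(** Freeness provides [g0], of mean almost 1 and carried by a compact set of moved points. There the
    squared oscillations of finitely many functions add up to at least 1, so [t] is dominated by its
    products with oscillations, which decay along the walk, plus the translated mean of [1 - g0],
    which is harmonic and small. *)
Lemma qform_abs_mean0 : m (fun v => `|qform T v|) = 0.
Proof.
apply/eqP; rewrite eq_le; apply/andP; split; last exact: (mean_ge0 mm).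
apply/ler_addgt0Pr => e e0; rewrite add0r.
have e4 : 0 < e / 4 by rewrite divr_gt0.
have [f0 f0U] := open_content_adherent cK mI [set x | act a x <> x] e4.
rewrite free => If0; have cf0 := f0U.1.
pose g0 := shrink (e / 4) f0.
have g0E x : g0 x != 0 -> e / 4 <= f0 x.
  by apply: contraR; rewrite -ltNge => /ltW f0e; apply/eqP; exact: shrink_eq0.
have [|||D [u [cu hu]]] := @moved_points_cover R K cK hK (act a) [set x | e / 4 <= f0 x].
- exact: cact.
- exact: compact_superlevel.
- move=> x /= ex ax; move: ex; rewrite (below_eq0 f0U) ?leNgt ?e4// => /(_ ax).
have cg0 : continuous g0 by exact: continuous_shrink.
have b0 := continuous_bdd cK cg0.
have b1 : bdd_fun (fun x => 1 - g0 x) by apply: bdd_funB => //; exact: bdd_fun_cst.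
(* One [e / 4] is lost in the choice of [f0], another in shrinking it. *)
have Ig0 : I (fun x => 1 - g0 x) <= e / 2.
  have := mean_shrink cK mI (ltW e4) cf0; rewrite -/g0 (meanB mI)//; last exact: bdd_fun_cst.
  by rewrite (mean_cst mI); lra.
pose osc y h := I (fun x => (u y (act h x) - u y (act a (act h x))) ^+ 2).
have bu y : bdd_fun (fun x => (u y x - u y (act a x)) ^+ 2).
  apply: bdd_funX; apply: bdd_funB; first exact: continuous_bdd.
  by apply: bdd_fun_comp; exact: continuous_bdd.
have bt : bdd_fun t.
  by apply: (@bdd_fun_itv _ _ _ 1) => h; rewrite t_ge0 t_le1.
have bI (k : K -> R) : bdd_fun k -> bdd_fun (fun h => I (fun x => k (act h x))).
  exact: bdd_mean_comp.
have bosc y : bdd_fun (fun h => osc y h * t h).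
  by apply: bdd_funM => //; exact: (bI (fun x => (u y x - u y (act a x)) ^+ 2)).
have bsum : bdd_fun (fun h => \sum_(y <- D) 2 * (osc y h * t h)).
  by apply: bdd_fun_sum => y; exact: bdd_funZ.
have bI1 := bI _ b1.
(* Multiply by [t h] the inequality that bounds 1 by the oscillations plus the mean of [1 - g0], and
   use [t h <= 1] in the last term only. *)
have tle h : t h <= \sum_(y <- D) 2 * (osc y h * t h) + I (fun x => 1 - g0 (act h x)).
  have bs y : bdd_fun (fun x => 2 * (u y (act h x) - u y (act a (act h x))) ^+ 2).
    by apply: bdd_funZ; exact: (bdd_fun_comp (act h) (bu y)).
  have b1h : bdd_fun (fun x => 1 - g0 (act h x)) by exact: (bdd_fun_comp (act h) b1).
  have : 1 <= \sum_(y <- D) 2 * osc y h + I (fun x => 1 - g0 (act h x)).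
    rewrite -[leLHS](mean_1 mI) (_ : \sum_(y <- D) 2 * osc y h =
      I (fun x => \sum_(y <- D) 2 * (u y (act h x) - u y (act a (act h x))) ^+ 2)).
      rewrite -(meanD mI)//; last exact: bdd_fun_sum.
      apply: (mean_le mI); first exact: bdd_fun_cst.
        by apply: bdd_funD => //; exact: bdd_fun_sum.
      move=> x; have /andP[g00 g01] : 0 <= g0 (act h x) <= 1.
        have /andP[f00 _] := f0U.2 (act h x).
        have /andP[-> g0f] := shrink_bounds (ltW e4) f00.
        by rewrite (le_trans g0f)// (below_le1 _ f0U).
      have [gz|/g0E/hu hx] := eqVneq (g0 (act h x)) 0.
        by rewrite gz subr0 lerDr sumr_ge0// => y _; rewrite mulr_ge0// sqr_ge0.
      by rewrite (le_trans hx)// lerDl subr_ge0.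
    rewrite mean_sum//; apply: eq_bigr => y _; rewrite (meanZ mI)//.
    exact: (bdd_fun_comp (act h) (bu y)).
  move=> h1; have I0 : 0 <= I (fun x => 1 - g0 (act h x)).
    apply: (mean_ge0 mI) => // x; have /andP[f00 _] := f0U.2 (act h x).
    have /andP[_ g0f] := shrink_bounds (ltW e4) f00.
    by rewrite subr_ge0 (le_trans g0f)// (below_le1 _ f0U).
  have := ler_wpM2r (t_ge0 h) h1; rewrite mul1r mulrDl mulr_suml.
  under [in X in _ <= X -> _]eq_bigr do rewrite -mulrA.
  by move=> /le_trans; apply; rewrite lerD2l ler_piMr.
pose L k y := iter k (markov_op mu) (fun h => osc y h * t h) 1%g.
have lim : \sum_(y <- D) 2 * L k y @[k --> \oo] --> (0 : R).
  apply: cvg_sum0 => y; rewrite -(mulr0 2); apply: cvgM; first exact: cvg_cst.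
  exact: oscillation_decay.
have e2 : 0 < e / 2 by rewrite divr_gt0.
have /cvgrPdist_lt/(_ _ e2)[k _ /(_ k (leqnn k))] := lim.
rewrite /= sub0r normrN ltr_norml => /andP[_ hk].
rewrite -(mean_sphere_act_harmonic k bT) -/t.
have -> : e = e / 2 + e / 2 by lra.
apply: (@le_trans _ _ (\sum_(y <- D) 2 * L k y + I (fun x => 1 - g0 x))); last first.
  by apply: lerD => //; exact: ltW.
rewrite -(orbit_mean_harmonic k b1).
have -> : \sum_(y <- D) 2 * L k y =
    iter k (markov_op mu) (fun h => \sum_(y <- D) 2 * (osc y h * t h)) 1%g.
  rewrite (mean_sum (mE k)); last by move=> y; exact: bdd_funZ.
  by apply: eq_bigr => y _; rewrite (meanZ (mE k)).
rewrite -(meanD (mE k) bsum bI1).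
apply: (mean_le (mE k)) => //; exact: bdd_funD.
Qed.

End Decay.

(** All hypotheses meet here: [tau] gives a mean on the sphere, whose image on [K] is identified
    with [nu] by unique stationarity; [nu] brings vanishing variances and freeness, and the decay of
    coefficients applies. *)
Lemma free_USB_state_lam (R : realType) (G : groupType) (mu : G -> R)
    d (Y : measurableType d) (act : G -> Y -> Y) (eta : probability Y R)
    (tau : (l2 R G -> l2 R G) -> R[i]) (a : G) :
  countable [set: G] -> prob_mass mu -> mu_USB mu act eta ->
  essentially_free act eta -> is_state tau -> stationary_state mu tau ->
  a <> 1%g -> tau (lam a) = 0.
Proof.
move=> cG mum [[[actY mact ns] stat [X [actX [nuX [modX bdX]]]]]].
move=> [K [actK [nu [modK [_ uniq]]]]] free st statau a1.
have [[cK hK aK cact] [phi [psi [[mphi mpsi] [phinu _] psiphi _ phiact]]]] := modK.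
have [n mn hn] := integral_mean eta.
have vY := boundary_variance_vanishes mum cG actY mact stat mn hn modX bdX.
have [m [mm mtau statm]] := stationary_state_mean mum st statau.
(* The base point of the orbit map is arbitrary: stationarity of [I] comes from that of [m]. *)
pose I f := m (orbit_mean actK point f).
have mI : mean I by exact: mean_orbit_mean_comp.
have statI f : continuous f -> expect mu (fun g => I (fun x => f (actK g x))) = I f.
  move=> cf; exact: (orbit_mean_stationary point aK statm (continuous_bdd cK cf)).
have [P hP] := riesz_open cK hK mI.
have statP := riesz_stationary mum cK aK cact mI statI hP.
(* Through this equality [nu] inherits the values [open_content I] on open sets, although no
   regularity of [nu] is assumed. *)
have Pnu := uniq P statP.
have nuo U : open U -> nu U = (open_content I U)%:E.
  by move=> oU; rewrite -Pnu ?hP//; exact: open_measurable_borel.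
have nuI f : continuous f -> (\int[nu]_x (f x)%:E)%E = (I f)%:E.
  by move=> cf; exact: (riesz_representation cK mI nuo cf).
have vI f : continuous f -> variance_vanishes mu actK I f.
  by move=> cf; exact: (model_variance_vanishes mact mn hn vY modK nuI cf).
have [oU nuU] := model_free mact mn hn cact mphi phinu phiact mpsi hK ns psiphi (free a a1).
have IU : open_content I [set x | actK a x <> x] = 1.
  by apply: (@EFin_inj R); rewrite -nuo.
(* A unimodular factor [z] is carried along so that [z = 1] yields the real part and [z = - 'i] the
   imaginary part. *)
have key z : sqabs z = 1 -> complex.Re (tau (z *: lam a)) = 0.
  move=> z1; have Az : reduced_cstar (z *: lam a : l2 R G -> l2 R G).
    by apply: reduced_scale; exact: reduced_lam.
  apply/eqP; rewrite -mtau// -normr_le0.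
  rewrite -(qform_abs_mean0 mum cK hK aK cact mm statm z1 vI IU).
  by apply: (mean_abs mm); exact: qform_bdd.
have Re0 : complex.Re (tau (lam a)) = 0.
  rewrite -(key 1); first by rewrite scale1r.
  by rewrite /sqabs /= expr1n expr0n addr0.
have Im0 : complex.Im (tau (lam a)) = 0.
  rewrite (state_Im st (@reduced_lam R G a)).
  by apply: key; rewrite /sqabs /=; ring.
by move: Re0 Im0; case: (tau (lam a)) => u v /= -> ->.
Qed.

Theorem theorem4p12 (R : realType) (G : groupType) (mu : G -> R) :
  countable [set: G] ->
  prob_mass mu ->
  (exists (d : measure_display) (Y : measurableType d) (act : G -> Y -> Y)
      (eta : probability Y R),
    mu_USB mu act eta /\ essentially_free act eta) ->
  [/\ is_state (@canonical_trace R G),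
      stationary_state mu (@canonical_trace R G)
    & forall tau : (l2 R G -> l2 R G) -> R[i],
        is_state tau -> stationary_state mu tau ->
        forall a, reduced_cstar a -> tau a = canonical_trace a].
Proof.
move=> cG mum [d [Y [act [eta [usb free]]]]]; split.
- exact: canonical_trace_state.
- exact/canonical_trace_stationary/prob_mass_has_sum.
move=> tau st statau; apply: states_agree => //; first exact: canonical_trace_state.
move=> g; rewrite canonical_trace_lam; case: eqP => [->|g1].
  by rewrite lam1; case: st.
exact: (free_USB_state_lam cG mum usb free st statau g1).
Qed.
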